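(* Let $X$ be a complex projective abelian surface, $n\geq 2$, and let $w=(1,0,-(n+1))\in S^+=H^{even}(X,\mathbb{Z})$ be the Chern character of the ideal sheaf of a length $n+1$ subscheme of $X$. Let \[c_w:=-(n+1)^2\alpha^2+4(n+1)^3\beta+4(n+1)\gamma\ \in\ \wedge^4V,\] where $\alpha=\sum_{i=1}^4e_i\wedge e_i^*$, $\beta=e_1\wedge e_2\wedge e_3\wedge e_4$, $\gamma=e_1^*\wedge e_2^*\wedge e_3^*\wedge e_4^*$. (1) The class $c_w$ spans the $1$-dimensional subspace of $\wedge^4_{\mathbb{Q}}V$ invariant under $\mathrm{Spin}(V)_w$. (2) The period domain \[\Omega_{w^\perp}=\{\ell\in\mathbb{P}(w^\perp\otimes_{\mathbb{Z}}\mathbb{C}):(\ell,\ell)=0,\ (\ell,\bar\ell)<0\}\] is also the period domain of integral weight $1$ Hodge structures $(V,J)$, where $J:V_{\mathbb{R}}\to V_{\mathbb{R}}$ is a complex structure satisfying: (a) $V^{1,0}$ and $V^{0,1}$ are maximal isotropic with respect to the symmetric bilinear pairing $(\bullet,\bullet)_V$ on $V_{\mathbb{C}}$. (b) Each of the two lifts of $J\in SO(V_{\mathbb{R}})$ to $\mathrm{Spin}(V_{\mathbb{R}})$ maps to an involution of $S^+_{\mathbb{R}}$, determined by $J$ up to sign, one of whose eigenspaces is a negative definite $2$-dimensional subspace of $w^\perp_{\mathbb{R}}$. (c) The class $c_w$ is of Hodge type $(2,2)$. That is, $\ell\mapsto (V,J_\ell)$, with $V^{1,0}=Z_\ell:=\{v\in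 V_{\mathbb{C}}: v\cdot\ell=0\}$ and $V^{0,1}=Z_{\bar\ell}$, identifies $\Omega_{w^\perp}$ with the set of such Hodge structures.
   Context: $V:=H^1(X,\mathbb{Z})\oplus H^1(X,\mathbb{Z})^*$ with the form $((a_1,a_2),(b_1,b_2))_V=b_2(a_1)+a_2(b_1)$. $S:=H^*(X,\mathbb{Z})$, $S^+:=H^{even}$, $S^-:=H^{odd}$. On $S$ the symmetric pairing is $(s,t)_S=\int_X\tau(s)\cup t$, where $\tau$ acts on $H^i(X,\mathbb{Z})$ by $(-1)^{i(i-1)/2}$; on $S^+=H^0\oplus H^2\oplus H^4$ it is $((r,c,s),(r',c',s'))=rs'+r's-\int_Xc\cup c'$, unimodular of signature $(4,4)$. $w^\perp\subset S^+$ is the sublattice orthogonal to $w$. $\{e_1,e_2,e_3,e_4\}$ is a basis of $H^1(X,\mathbb{Z})$ compatible with the orientation, $\int_Xe_1\wedge e_2\wedge e_3\wedge e_4=1$, and $\{e_i^*\}$ is the dual basis of $H^1(X,\mathbb{Z})^*$. The Clifford algebra $C(V)$ is the quotient of the tensor algebra by $v\cdot w+w\cdot v=(v,w)_V$; it acts on $S$ with $w\in H^1(X,\mathbb{Z})$ acting by $w\wedge(\bullet)$ and $\theta\in H^1(X,\mathbb{Z})^*$ by the contraction derivation $D_\theta$ (this is the product $v\cdot\ell$ above, after extending scalars). With $x\mapsto x^*$ the anti-automorphism such that $v^*=-v$ for $v\in V$, $\mathrm{Spin}(V)=\{x\in C(V)^{even}:xx^*=1,\ xVx^*\subset V\}$,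 acting on $V$ by $v\mapsto xvx^{-1}$ and on $S^\pm$ via the module structure; $\mathrm{Spin}(V_{\mathbb{R}})$ is defined similarly. $\mathrm{Spin}(V)_w$ is the stabilizer of $w\in S^+$. For a complex structure $J$, $V^{1,0}$ and $V^{0,1}$ are its $i$ and $-i$ eigenspaces in $V_{\mathbb{C}}$, and $\wedge^4V$ carries the induced Hodge structure. *)

(* Defs.v *)
(* The real numbers are an abstract realType R, and the complex numbers are R[i]. *)
From HB Require Import structures.
From mathcomp Require Import boolp classical_sets functions reals complex.
From mathcomp Require Import all_boot all_order all_algebra ring.

Set Implicit Arguments.
Unset Strict Implicit.
Unset Printing Implicit Defensive.
Import Order.TTheory GRing.Theory Num.Theory.
Local Open Scope ring_scope.

(* The exterior algebra of K^m: the coordinate s I of s is the coefficient of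
   e_I = e_(i_1) /\ ... /\ e_(i_k), where I = {i_1 < ... < i_k}.
   K^o is K, seen as a module over itself. *)
Notation ext K m := {ffun {set 'I_m} -> K^o}.

Section Exterior.
Variables (K : comNzRingType) (m : nat).
Implicit Types (a b s : ext K m) (I J : {set 'I_m}) (v : 'rV[K]_m).

Definition inversions I J : nat := \sum_(i in I) #|[set j in J | (j < i)%N]|.

(* e_I /\ e_J is (-1)^(inversions I J) e_(I u J) if I and J are disjoint, and 0 otherwise. *)
Definition ext_mul a b : ext K m :=
  [ffun L : {set 'I_m} =>
     \sum_(I in powerset L) (-1) ^+ inversions I (L :\: I) * (a I * b (L :\: I))].

Definition ext_mono I : ext K m := [ffun J : {set 'I_m} => (J == I)%:R].

Definition ext_one : ext K m := ext_mono finset.set0.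

Definition ext_vec v : ext K m := \sum_i v 0 i *: ext_mono [set i].

Definition ext_prod (vs : seq 'rV[K]_m) : ext K m :=
  foldr (fun v s => ext_mul (ext_vec v) s) ext_one vs.

Definition ext_deg (k : nat) s : Prop := forall I, #|I| != k -> s I = 0.

Definition ext_even s : Prop := forall I, odd #|I| -> s I = 0.

(* The contraction D_theta, theta in the dual of K^m in the dual coordinates: it sends e_I to
   the sum over i in I of (-1)^(number of j in I with j < i) theta_i e_(I \ i). *)
Definition contraction (theta : 'rV[K]_m) s : ext K m :=
  [ffun L : {set 'I_m} =>
     \sum_(i | i \notin L)
        (-1) ^+ #|[set j in L | (j < i)%N]| * (theta 0 i * s (i |: L))].

(* The endomorphism of the exterior algebra induced by the endomorphism v |-> v g of K^m;
   enum I is increasing. *)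
Definition ext_map (g : 'M[K]_m) s : ext K m :=
  \sum_(I : {set 'I_m}) s I *: ext_prod [seq row i g | i <- enum I].

End Exterior.

Arguments ext_one {K m}.
Arguments ext_mono {K m}.

Definition ext_apply (K L : comNzRingType) (f : K -> L) m (s : ext K m) : ext L m :=
  [ffun I => f (s I)].

(* Extension of scalars from the integers. *)
Definition ext_int (K : comNzRingType) m (s : ext int m) : ext K m :=
  ext_apply (fun z : int => z%:~R) s.

(* The Clifford algebra of (M, b): the quotient of the tensor algebra of M, presented as the
   associative K-algebra generated by M subject to the linearity of M -> T(M), by the
   relations v w + w v = b v w. *)
Section Clifford.
Variables (K : comNzRingType) (M : lmodType K) (b : M -> M -> K).

Inductive cl_expr : Type :=
| CScal of K
| CGen of M
| CAdd of cl_expr & cl_expr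
| CMul of cl_expr & cl_expr.

Inductive cl_eq : cl_expr -> cl_expr -> Prop :=
| cl_refl x : cl_eq x x
| cl_sym x y : cl_eq x y -> cl_eq y x
| cl_trans x y z : cl_eq x y -> cl_eq y z -> cl_eq x z
| cl_congD x x' y y' : cl_eq x x' -> cl_eq y y' -> cl_eq (CAdd x y) (CAdd x' y')
| cl_congM x x' y y' : cl_eq x x' -> cl_eq y y' -> cl_eq (CMul x y) (CMul x' y')
| cl_addA x y z : cl_eq (CAdd x (CAdd y z)) (CAdd (CAdd x y) z)
| cl_addC x y : cl_eq (CAdd x y) (CAdd y x)
| cl_add0 x : cl_eq (CAdd (CScal 0) x) x
| cl_addN x : cl_eq (CAdd (CMul (CScal (-1)) x) x) (CScal 0)
| cl_mulA x y z : cl_eq (CMul x (CMul y z)) (CMul (CMul x y) z)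
| cl_1mul x : cl_eq (CMul (CScal 1) x) x
| cl_mul1 x : cl_eq (CMul x (CScal 1)) x
| cl_mulDl x y z : cl_eq (CMul (CAdd x y) z) (CAdd (CMul x z) (CMul y z))
| cl_mulDr x y z : cl_eq (CMul x (CAdd y z)) (CAdd (CMul x y) (CMul x z))
| cl_scalD k l : cl_eq (CScal (k + l)) (CAdd (CScal k) (CScal l))
| cl_scalM k l : cl_eq (CScal (k * l)) (CMul (CScal k) (CScal l))
| cl_scalC k x : cl_eq (CMul (CScal k) x) (CMul x (CScal k))
| cl_genD u v : cl_eq (CGen (u + v)) (CAdd (CGen u) (CGen v))
| cl_genZ k v : cl_eq (CGen (k *: v)) (CMul (CScal k) (CGen v))
| cl_rel v w : cl_eq (CAdd (CMul (CGen v) (CGen w)) (CMul (CGen w) (CGen v)))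
                     (CScal (b v w)).

HB.instance Definition _ := gen_eqMixin cl_expr.
HB.instance Definition _ := gen_choiceMixin cl_expr.

Definition cl_eqb (x y : cl_expr) : bool := `[< cl_eq x y >].

Lemma cl_eqb_refl : reflexive cl_eqb.
Proof. by move=> x; apply/asboolP; constructor. Qed.
Lemma cl_eqb_sym : symmetric cl_eqb.
Proof. by move=> x y; apply/asboolP/asboolP; apply: cl_sym. Qed.
Lemma cl_eqb_trans : transitive cl_eqb.
Proof. by move=> y x z /asboolP xy /asboolP yz; apply/asboolP/(cl_trans xy yz). Qed.

Canonical cl_equiv := EquivRel cl_eqb cl_eqb_refl cl_eqb_sym cl_eqb_trans.

Definition clifford : Type := {eq_quot cl_equiv}%qT.
HB.instance Definition _ := Choice.on clifford.
HB.instance Definition _ := Quotient.on clifford.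

Definition cl_pi (x : cl_expr) : clifford := (\pi_clifford x)%qT.

Lemma cl_piP x y : cl_pi x = cl_pi y <-> cl_eq x y.
Proof.
split=> [/eqP|xy]; first by rewrite eqmodE => /asboolP.
by apply/eqP; rewrite eqmodE; apply/asboolP.
Qed.

Lemma cl_reprK (x : clifford) : cl_pi (repr x) = x.
Proof. exact: reprK. Qed.

Lemma cl_repr_pi x : cl_eq (repr (cl_pi x)) x.
Proof. by apply/cl_piP; rewrite cl_reprK. Qed.

Lemma cl_ind (P : clifford -> Prop) : (forall x, P (cl_pi x)) -> forall x, P x.
Proof. by move=> Ppi x; rewrite -(cl_reprK x). Qed.

Definition cl_add (x y : clifford) := cl_pi (CAdd (repr x) (repr y)).
Definition cl_mul (x y : clifford) := cl_pi (CMul (repr x) (repr y)).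
Definition cl_opp (x : clifford) := cl_pi (CMul (CScal (-1)) (repr x)).

Lemma cl_addE x y : cl_add (cl_pi x) (cl_pi y) = cl_pi (CAdd x y).
Proof. by apply/cl_piP; constructor; apply: cl_repr_pi. Qed.
Lemma cl_mulE x y : cl_mul (cl_pi x) (cl_pi y) = cl_pi (CMul x y).
Proof. by apply/cl_piP; constructor; apply: cl_repr_pi. Qed.
Lemma cl_oppE x : cl_opp (cl_pi x) = cl_pi (CMul (CScal (-1)) x).
Proof. by apply/cl_piP; constructor; [constructor | apply: cl_repr_pi]. Qed.

Fact cl_addrA : associative cl_add.
Proof. by do 3![elim/cl_ind => ?]; rewrite !cl_addE; apply/cl_piP; constructor. Qed.
Fact cl_addrC : commutative cl_add.
Proof. by do 2![elim/cl_ind => ?]; rewrite !cl_addE; apply/cl_piP; constructor. Qed.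
Fact cl_add0r : left_id (cl_pi (CScal 0)) cl_add.
Proof. by elim/cl_ind => ?; rewrite cl_addE; apply/cl_piP; constructor. Qed.
Fact cl_addNr : left_inverse (cl_pi (CScal 0)) cl_opp cl_add.
Proof. by elim/cl_ind => ?; rewrite cl_oppE cl_addE; apply/cl_piP; constructor. Qed.
Fact cl_mulrA : associative cl_mul.
Proof. by do 3![elim/cl_ind => ?]; rewrite !cl_mulE; apply/cl_piP; constructor. Qed.
Fact cl_mul1r : left_id (cl_pi (CScal 1)) cl_mul.
Proof. by elim/cl_ind => ?; rewrite cl_mulE; apply/cl_piP; constructor. Qed.
Fact cl_mulr1 : right_id (cl_pi (CScal 1)) cl_mul.
Proof. by elim/cl_ind => ?; rewrite cl_mulE; apply/cl_piP; constructor. Qed.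
Fact cl_mulrDl : left_distributive cl_mul cl_add.
Proof.
by do 3![elim/cl_ind => ?]; rewrite !(cl_mulE, cl_addE); apply/cl_piP; constructor.
Qed.
Fact cl_mulrDr : right_distributive cl_mul cl_add.
Proof.
by do 3![elim/cl_ind => ?]; rewrite !(cl_mulE, cl_addE); apply/cl_piP; constructor.
Qed.

HB.instance Definition _ := GRing.isPzRing.Build clifford
  cl_addrA cl_addrC cl_add0r cl_addNr cl_mulrA cl_mul1r cl_mulr1 cl_mulrDl cl_mulrDr.

Definition cl_gen (v : M) : clifford := cl_pi (CGen v).

(* The Z/2-grading of the tensor algebra: cl_homog true is the odd part. *)
Inductive cl_homog : bool -> cl_expr -> Prop :=
| homog_scal k : cl_homog false (CScal k)
| homog_gen v : cl_homog true (CGen v)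
| homog_add p x y : cl_homog p x -> cl_homog p y -> cl_homog p (CAdd x y)
| homog_mul p q x y : cl_homog p x -> cl_homog q y -> cl_homog (p (+) q) (CMul x y).

Definition cl_even (x : clifford) : Prop := exists2 t, cl_homog false t & x = cl_pi t.

(* The anti-automorphism x |-> x^* with v^* = - v for v in M. *)
Fixpoint cl_expr_star (t : cl_expr) : cl_expr :=
  match t with
  | CScal k => CScal k
  | CGen v => CGen (- v)
  | CAdd x y => CAdd (cl_expr_star x) (cl_expr_star y)
  | CMul x y => CMul (cl_expr_star y) (cl_expr_star x)
  end.

Definition cl_star (x : clifford) : clifford := cl_pi (cl_expr_star (repr x)).

Lemma cl_piD x y : cl_pi (CAdd x y) = cl_pi x + cl_pi y.
Proof. by rewrite -[RHS]/(cl_add _ _) cl_addE. Qed.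
Lemma cl_piM x y : cl_pi (CMul x y) = cl_pi x * cl_pi y.
Proof. by rewrite -[RHS]/(cl_mul _ _) cl_mulE. Qed.

Lemma cl_genN v : cl_gen (- v) = - cl_gen v.
Proof.
rewrite -[RHS]/(cl_opp _) cl_oppE -scaleN1r.
by apply/cl_piP; constructor.
Qed.

Lemma cl_genM v w : cl_gen v * cl_gen w + cl_gen w * cl_gen v = cl_pi (CScal (b v w)).
Proof. by rewrite -!cl_piM -cl_piD; apply/cl_piP; constructor. Qed.

Lemma cl_expr_star_eq t u : cl_eq t u -> cl_eq (cl_expr_star t) (cl_expr_star u).
Proof.
elim=> /=; try by [constructor].
- by move=> x y z _ xy _ yz; apply: cl_trans xy yz.
- move=> x; apply: cl_trans (cl_addN (cl_expr_star x)).
  by apply: cl_congD; [apply: cl_sym; constructor | constructor].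
- by move=> *; apply: cl_sym; constructor.
- by move=> k l; rewrite mulrC; constructor.
- by move=> *; apply: cl_sym; constructor.
- by move=> v w; rewrite opprD; constructor.
- by move=> k v; rewrite -scalerN; apply: cl_trans (cl_genZ _ _) (cl_scalC _ _).
- move=> v w; apply/cl_piP; rewrite cl_piD !cl_piM -!/(cl_gen _) !cl_genN !mulrNN.
  by rewrite addrC cl_genM.
Qed.

Lemma cl_starE t : cl_star (cl_pi t) = cl_pi (cl_expr_star t).
Proof. by apply/cl_piP/cl_expr_star_eq/cl_repr_pi. Qed.

Definition Spin (x : clifford) : Prop :=
  [/\ cl_even x, x * cl_star x = 1 &
      forall v, exists v', x * cl_gen v * cl_star x = cl_gen v'].

End Clifford.

(* V = H^1 + (H^1)^*, with coefficients in K, where H^1 has rank m: row_mx a theta is the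
   vector (a, theta), in the coordinates of a basis of H^1 and of the dual basis of (H^1)^*. *)
Section SpinModule.
Variables (K : comNzRingType) (m : nat).
Implicit Types (v w : 'rV[K]_(m + m)) (s : ext K m).

Definition V_form v w : K :=
  \sum_i rsubmx w 0 i * lsubmx v 0 i + \sum_i rsubmx v 0 i * lsubmx w 0 i.

Definition V_act v s : ext K m :=
  ext_mul (ext_vec (lsubmx v)) s + contraction (rsubmx v) s.

Local Notation expr := (@cl_expr K 'rV[K]_(m + m)).

Fixpoint expr_act (t : expr) s : ext K m :=
  match t with
  | CScal k => k *: s
  | CGen v => V_act v s
  | CAdd x y => expr_act x s + expr_act y s
  | CMul x y => expr_act x (expr_act y s)
  end.

(* The action of C(V) on the exterior algebra of H^1 (well defined by cl_actE). *)
Definition cl_act (x : clifford V_form) s : ext K m := expr_act (repr x) s.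

Let eps (i : 'I_m) (L : {set 'I_m}) : K := (-1) ^+ #|[set j in L | (j < i)%N]|.
Let toggle (i : 'I_m) (L : {set 'I_m}) := if i \in L then L :\ i else i |: L.
Let coef v (i : 'I_m) (e : bool) : K := if e then lsubmx v 0 i else rsubmx v 0 i.

Lemma ext_vec_mulE (a : 'rV[K]_m) s L :
  ext_mul (ext_vec a) s L = \sum_(i in L) eps i L * (a 0 i * s (L :\ i)).
Proof.
rewrite ffunE.
transitivity (\sum_(I in powerset L) \sum_(i : 'I_m)
   (I == [set i])%:R * ((-1) ^+ inversions I (L :\: I) * (a 0 i * s (L :\: I)))).
  apply: eq_bigr => I _; rewrite /ext_vec sum_ffunE mulr_suml mulr_sumr.
  apply: eq_bigr => i _; rewrite !ffunE /= -[_ *: _]/(_ * _).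
  by rewrite (mulrC (a 0 i)) -[in LHS]mulrA mulrCA.
rewrite exchange_big /= [RHS]big_mkcond /=; apply: eq_bigr => i _.
rewrite big_mkcond (bigD1 [set i]) //= big1 ?addr0 => [|I /negPf->]; last first.
  by rewrite mul0r if_same.
rewrite powersetE finset.sub1set eqxx mul1r; case: ifP => // iL.
rewrite /inversions big_set1; congr ((-1) ^+ _ * _).
by apply: eq_card => j; rewrite !inE; have [->|] := eqVneq j i; rewrite ?ltnn ?andbF.
Qed.

Let V_actE v s L :
  V_act v s L = \sum_i eps i L * (coef v i (i \in L) * s (toggle i L)).
Proof.
rewrite ffunE ext_vec_mulE ffunE [RHS](bigID (fun i => i \in L)) /=; congr (_ + _).
  by apply: eq_bigr => i iL; rewrite /coef /toggle iL.
by apply: eq_bigr => i /negPf iL; rewrite /coef /toggle iL.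
Qed.

Let in_toggle i j L : (j \in toggle i L) = (j == i) (+) (j \in L).
Proof. by rewrite /toggle; case: ifP => iL; rewrite !inE; case: eqP => // ->; rewrite iL. Qed.

Let toggleK i L : toggle i (toggle i L) = L.
Proof. by apply/finset.setP => j; rewrite !in_toggle addbA addbb. Qed.

Let toggleC i j L : toggle i (toggle j L) = toggle j (toggle i L).
Proof. by apply/finset.setP => k; rewrite !in_toggle addbCA. Qed.

Let eps_toggle i j L : eps i (toggle j L) = (-1) ^+ (j < i)%N * eps i L.
Proof.
rewrite /eps; have [ji|ij] := ltnP j i; last first.
  rewrite mul1r; congr (_ ^+ _); apply: eq_card => k; rewrite !inE in_toggle.
  by case: eqP => // ->; rewrite ltnNge ij !andbF.
have sw (I : {set 'I_m}) : j \in I ->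
    #|[set k in I | (k < i)%N]| = #|[set k in I :\ j | (k < i)%N]|.+1.
  move=> jI; rewrite (cardsD1 j) inE jI ji; congr _.+1.
  by apply: eq_card => k; rewrite !inE andbA.
rewrite /toggle; case: ifPn => jL; first by rewrite (sw L) // exprS mulrA mulrNN !mul1r.
rewrite (sw (j |: L)) ?finset.setU11 // exprS; congr (_ * (-1) ^+ _).
by apply: eq_card => k; rewrite !inE; case: eqP => // ->; rewrite (negPf jL).
Qed.

Lemma V_act_rel v w s : V_act v (V_act w s) + V_act w (V_act v s) = V_form v w *: s.
Proof.
pose T v w L (i j : 'I_m) : K := eps i L * (coef v i (i \in L) *
   (eps j (toggle i L) * (coef w j (j \in toggle i L) * s (toggle j (toggle i L))))).
have actE v' w' L : V_act v' (V_act w' s) L = \sum_i \sum_j T v' w' L i j.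
  rewrite V_actE; apply: eq_bigr => i _; rewrite V_actE !mulr_sumr.
  by apply: eq_bigr => j _.
apply/ffunP => L; rewrite [LHS]ffunE [RHS]ffunE !actE [X in _ + X = _]exchange_big -big_split /=.
rewrite -[RHS]/(_ * _) /V_form -big_split mulr_suml; apply: eq_bigr => i _ /=.
rewrite -big_split (bigD1 i) //= big1 ?addr0 => [|j ji].
  rewrite /T toggleK eps_toggle ltnn mul1r in_toggle eqxx addTb.
  have ee x y z : eps i L * (x * (eps i L * (y * z))) = x * y * z.
    by rewrite (mulrCA x) !mulrA -expr2 /eps sqrr_sign mul1r.
  rewrite !ee -mulrDl; congr (_ * _).
  rewrite /coef; case: (i \in L) => /=; last exact: addrC.
  by rewrite mulrC [X in _ + X]mulrC.
rewrite /T (toggleC i j) !in_toggle (negPf ji) eq_sym (negPf ji) !addFb !eps_toggle.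
have sg : (-1) ^+ (j < i)%N = - (-1) ^+ (i < j)%N :> K.
  by move: ji; rewrite -val_eqE; case: ltngtP; rewrite ?opprK.
rewrite sg; move: (s _ : K) => t; ring.
Qed.


Lemma V_act_linear v k s1 s2 : V_act v (k *: s1 + s2) = k *: V_act v s1 + V_act v s2.
Proof.
have scE (t1 t2 : ext K m) L : (k *: t1 + t2) L = k * t1 L + t2 L :> K.
  by rewrite ffunE; congr (_ + _); rewrite ffunE.
apply/ffunP => L; rewrite scE !V_actE mulr_sumr -big_split; apply: eq_bigr => i _ /=.
by rewrite scE; move: (s1 _ : K) (s2 _ : K) => t1 t2; ring.
Qed.

Let coefD u v i e : coef (u + v) i e = coef u i e + coef v i e.
Proof. by case: e; rewrite /coef !mxE. Qed.

Let coefZ k v i e : coef (k *: v) i e = k * coef v i e.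
Proof. by case: e; rewrite /coef !mxE. Qed.

Lemma V_actDl v w s : V_act (v + w) s = V_act v s + V_act w s.
Proof.
apply/ffunP => L; rewrite V_actE [RHS]ffunE !V_actE -big_split.
by apply: eq_bigr => i _ /=; rewrite coefD mulrDl mulrDr.
Qed.

Lemma V_actZl k v s : V_act (k *: v) s = k *: V_act v s.
Proof.
apply/ffunP => L; rewrite V_actE [RHS]ffunE !V_actE -[RHS]/(_ * _) mulr_sumr.
by apply: eq_bigr => i _ /=; rewrite coefZ -mulrA mulrCA.
Qed.

Lemma expr_act_linear t k s1 s2 :
  expr_act t (k *: s1 + s2) = k *: expr_act t s1 + expr_act t s2.
Proof.
elim: t s1 s2 => /= [l|v|x IHx y IHy|x IHx y IHy] s1 s2.
- by rewrite scalerDr !scalerA mulrC.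
- exact: V_act_linear.
- by rewrite IHx IHy scalerDr addrACA.
- by rewrite IHy IHx.
Qed.

Lemma expr_act_eq t u s : cl_eq V_form t u -> expr_act t s = expr_act u s.
Proof.
have lD t' s1 s2 : expr_act t' (s1 + s2) = expr_act t' s1 + expr_act t' s2.
  by rewrite -{1}(scale1r s1) expr_act_linear scale1r.
have l0 t' : expr_act t' 0 = 0 by apply: (addrI (expr_act t' 0)); rewrite -lD !addr0.
have lZ t' k s1 : expr_act t' (k *: s1) = k *: expr_act t' s1.
  by rewrite -{1}(addr0 (k *: s1)) expr_act_linear l0 addr0.
move=> tu; elim: tu s => //=.
- by move=> x y z _ xy _ yz s; rewrite xy.
- by move=> x x' y y' _ xx' _ yy' s; rewrite xx' yy'.
- by move=> x x' y y' _ xx' _ yy' s; rewrite yy' xx'.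
- by move=> x y z s; rewrite addrA.
- by move=> x y s; rewrite addrC.
- by move=> x s; rewrite scale0r add0r.
- by move=> x s; rewrite scaleN1r addNr scale0r.
- by move=> x s; rewrite scale1r.
- by move=> x s; rewrite scale1r.
- by move=> k l s; rewrite scalerDl.
- by move=> k l s; rewrite scalerA.
- by move=> u' v s; rewrite V_actDl.
- by move=> k v s; rewrite V_actZl.
- by move=> v w s; rewrite V_act_rel.
Qed.

Lemma cl_actE t s : cl_act (cl_pi V_form t) s = expr_act t s.
Proof. exact/expr_act_eq/cl_repr_pi. Qed.

(* x maps to the endomorphism v |-> v g of V; on Spin(V), x^* is the inverse of x. *)
Definition cl_induces (x : clifford V_form) (g : 'M[K]_(m + m)) : Prop :=
  forall v, x * cl_gen V_form v * cl_star x = cl_gen V_form (v *m g).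

End SpinModule.

Arguments V_form {K m}.

(* The quotient C^2 / Lambda, where Lambda is spanned by the rows of periods: it is a complex
   torus, and it is projective if and only if it carries a polarization, i.e., a positive
   definite Hermitian form on C^2 whose imaginary part is integral on Lambda. *)
Section AbelianSurface.
Variable R : realType.

(* C^2 is identified with R^4 through the real coordinates (x_1, y_1, x_2, y_2), which define
   its orientation as a complex vector space. *)
Definition real_periods (P : 'M[R[i]]_(4, 2)) : 'M[R]_4 :=
  \matrix_(i < 4, j < 4)
     (let z := P i (inord j./2) in if odd j then complex.Im z else complex.Re z).

Definition polarization (P : 'M[R[i]]_(4, 2)) (H : 'M[R[i]]_2) : Prop :=
  [/\ (map_mx conjc H)^T = H,
      forall z : 'rV[R[i]]_2, z != 0 -> 0 < (z *m H *m (map_mx conjc z)^T) 0 0 &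
      forall i j, complex.Im ((P *m H *m (map_mx conjc P)^T) i j) \is a Num.int].

Record abelian_surface := AbelianSurface {
  periods : 'M[R[i]]_(4, 2);
  periods_lattice : real_periods periods \in unitmx;
  periods_polarized : exists H, polarization periods H
}.

Variable X : abelian_surface.

(* H^1(X, Z) = Hom(Lambda, Z) is identified with Z^4 by the basis dual to the periods, and
   H^*(X, K) with the exterior algebra of K^4. *)

Definition orientation : int := sgz (\det (real_periods (periods X))).

Definition int_X (K : comNzRingType) (s : ext K 4) : K :=
  orientation%:~R * s [set: 'I_4].

Definition tau (K : comNzRingType) (s : ext K 4) : ext K 4 :=
  [ffun I : {set 'I_4} => (-1) ^+ ((#|I| * #|I|.-1) %/ 2) * s I].

Definition S_form (K : comNzRingType) (s t : ext K 4) : K := int_X (ext_mul (tau s) t).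

(* The generator of H^4(X, Z) whose integral is 1. *)
Definition point_class : ext int 4 := orientation *: ext_mono [set: 'I_4].

Definition w_class (n : nat) : ext int 4 := ext_one - (n.+1)%:R *: point_class.

Definition w_perp (K : comNzRingType) (n : nat) (s : ext K 4) : Prop :=
  ext_even s /\ S_form s (ext_int K (w_class n)) = 0.

(* The rows of e are the vectors e_1, ..., e_4. *)
Definition oriented_basis (e : 'M[int]_4) : Prop :=
  e \in unitmx /\ int_X (ext_prod [seq row i e | i <- enum 'I_4]) = 1.

Definition Spin_w (n : nat) (x : clifford (@V_form int 4)) : Prop :=
  Spin x /\ cl_act x (w_class n) = w_class n.

(* The action of Spin(V)_w on the exterior algebra of V, after extension of scalars to Q. *)
Definition Spin_w_invariant (n : nat) (c : ext rat (4 + 4)) : Prop :=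
  forall (x : clifford (@V_form int 4)) (g : 'M[int]_(4 + 4)),
    Spin_w n x -> cl_induces x g -> ext_map (map_mx intr g) c = c.

Local Notation S_C := (ext R[i] 4).

Definition ext_conj (s : S_C) : S_C := ext_apply conjc s.

(* A point of P(S_C) is a line in S_C. *)
Definition Omega (n : nat) : set {vspace S_C} :=
  [set l : {vspace S_C} |
     [/\ \dim l = 1%N, forall s, s \in l -> w_perp n s,
         forall s, s \in l -> S_form s s = 0 &
         forall s, s \in l -> s != 0 -> S_form s (ext_conj s) < 0]]%classic.

Definition Z_line (l : {vspace S_C}) : set 'rV[R[i]]_(4 + 4) :=
  [set v | forall s, s \in l -> V_act v s = 0]%classic.

Definition Z_conj_line (l : {vspace S_C}) : set 'rV[R[i]]_(4 + 4) :=
  [set v | forall s, s \in l -> V_act v (ext_conj s) = 0]%classic.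

End AbelianSurface.

(* J stands for the endomorphism v |-> v J of the row vectors V_R. *)
Section HodgeStructure.
Variable R : realType.
Implicit Type J : 'M[R]_(4 + 4).

Definition complex_structure J : Prop := J *m J = - 1%:M.

Definition V10 J : 'M[R[i]]_(4 + 4) := eigenspace (map_mx (real_complex R) J) ('i)%C.
Definition V01 J : 'M[R[i]]_(4 + 4) := eigenspace (map_mx (real_complex R) J) (- ('i)%C).

Definition isotropic (F : fieldType) (U : 'M[F]_(4 + 4)) : Prop :=
  forall u v : 'rV[F]_(4 + 4), (u <= U)%MS -> (v <= U)%MS -> V_form u v = 0.

Definition maximal_isotropic (F : fieldType) (U : 'M[F]_(4 + 4)) : Prop :=
  isotropic U /\
  forall W : 'M[F]_(4 + 4), isotropic W -> (U <= W)%MS -> (W <= U)%MS.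

Definition special_orthogonal J : Prop :=
  (forall u v : 'rV[R]_(4 + 4), V_form (u *m J) (v *m J) = V_form u v) /\ \det J = 1.

Definition Spin_lift J (x : clifford (@V_form R 4)) : Prop := Spin x /\ cl_induces x J.

(* The subspace of S^+_R on which x acts by k. *)
Definition is_eigenspace (x : clifford (@V_form R 4)) (k : R) (W : {vspace ext R 4}) : Prop :=
  forall s, s \in W <-> ext_even s /\ cl_act x s = k *: s.

Definition spinor_involution (x : clifford (@V_form R 4)) : Prop :=
  forall s, ext_even s -> ext_even (cl_act x s) /\ cl_act x (cl_act x s) = s.

Definition hodge_a J : Prop := maximal_isotropic (V10 J) /\ maximal_isotropic (V01 J).

Definition hodge_b (X : abelian_surface R) (n : nat) J : Prop :=
  [/\ special_orthogonal J,
      exists x, x <> - x /\ forall y, Spin_lift J y <-> y = x \/ y = - x &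
      forall x, Spin_lift J x ->
        spinor_involution x /\
        exists (k : R) (W : {vspace ext R 4}),
          [/\ is_eigenspace x k W, \dim W = 2%N, forall s, s \in W -> w_perp X n s &
              forall s, s \in W -> s != 0 -> S_form X s s < 0]].

(* The (p, q) part of the Hodge structure on the exterior algebra of V_C: the span of the
   u_1 /\ ... /\ u_p /\ v_1 /\ ... /\ v_q with u_i in V^{1,0} and v_j in V^{0,1}. *)
Definition hodge_type J (p q : nat) (c : ext R[i] (4 + 4)) : Prop :=
  exists (N : nat) (a : 'I_N -> R[i]) (u : 'I_N -> p.-tuple 'rV[R[i]]_(4 + 4))
         (v : 'I_N -> q.-tuple 'rV[R[i]]_(4 + 4)),
    [/\ forall i x, x \in u i -> (x <= V10 J)%MS,
        forall i x, x \in v i -> (x <= V01 J)%MS &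
        c = \sum_i a i *: ext_prod (u i ++ v i)].

End HodgeStructure.

Section InvariantClass.
Variable e : 'M[int]_4.

Definition V_e (i : 'I_4) : 'rV[int]_(4 + 4) := row_mx (row i e) 0.

(* The dual basis of e_1, ..., e_4 consists of the rows of the transpose of the inverse of e. *)
Definition V_e_dual (i : 'I_4) : 'rV[int]_(4 + 4) := row_mx 0 (row i (invmx e)^T).

Definition alpha : ext int (4 + 4) := \sum_i ext_prod [:: V_e i; V_e_dual i].
Definition beta : ext int (4 + 4) := ext_prod [seq V_e i | i <- enum 'I_4].
Definition gamma : ext int (4 + 4) := ext_prod [seq V_e_dual i | i <- enum 'I_4].

Definition c_class (n : nat) : ext int (4 + 4) :=
  - ((n.+1)%:R ^+ 2) *: ext_mul alpha alpha + (4 * (n.+1)%:R ^+ 3) *: beta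
  + (4 * (n.+1)%:R) *: gamma.

End InvariantClass.

Definition hodge_structures (R : realType) (X : abelian_surface R) (n : nat) (e : 'M[int]_4) :
    set 'M[R]_(4 + 4) :=
  [set J | [/\ complex_structure J, hodge_a J, hodge_b X n J &
               hodge_type J 2 2 (ext_int R[i] (c_class e n))]]%classic.

(* Main.v *)
(* The elements 1 + 2 p q, with p, q isotropic and orthogonal and p q w = 0, and one product of two
   elements 1 + 2 p q that fixes w, lie in Spin(V)_w; in coordinates, invariance under them leaves a
   line in degree 4. An invariant element is the tensor
   sum (b^4 b^3 b^2 b^1 w, w) b_1 /\ b_2 /\ b_3 /\ b_4; being nonzero, it spans this line, so c_w is
   proportional to it. Hence c_w is fixed by every isometry of V that lifts to the spinors fixing w.

   For l = xi + i eta in the period domain, the plane W of xi and eta is negative definite in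
   w^perp, and J is defined by (v J) eta = - v xi. The isometry a + b J, a^2 + b^2 = 1, lifts to
   the spinors as the rotation of W corresponding to (a - b i)^2. This gives (b), and, as the lift
   fixes w, the invariance of c_w under 3/5 + 4/5 J, hence its type (2, 2). Conversely, by Schur's
   lemma, J determines its lift up to a scalar, hence W; and the action of the lift on S^+ determines
   J up to sign, so J is attached to xi + i eta or to xi - i eta if W is the plane of (b). *)

(* The engine is triality in rank 4. The lattices V, S^+ and S^- all have rank 8, and for s in S^+
   with (s, s) nonzero the map v |-> v s from V to S^- multiplies the form by (s, s)/2 and is
   inverted by 2/(s, s) times its adjoint. So an equation such as (v J) eta = - v xi has an explicit
   solution, and vectors can be compared after acting on one spinor. Two obstacles shape the rest.
   First, C(V) is given by generators and relations, so equalities in it and the existence of lifts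
   become accessible only once it is known to act faithfully on S and to give all endomorphisms of
   S. Second, Spin(V)_w is an integral group, whereas (c) needs invariance of c_w under a rotation
   that is not integral. The invariant tensor bridges the gap: its equivariance is formal over any
   ring of coefficients considered, and it is proportional to c_w over the integers once
   denominators are cleared. The number 3/5 + 4/5 i lies on the unit circle and its fourth power is
   not 1; hence, in degree 4, the isometry 3/5 + 4/5 J has eigenvalue 1 on type (2, 2) only. *)
Require Import Defs.
From HB Require Import structures.
From mathcomp Require Import boolp classical_sets functions reals complex.
From mathcomp Require Import all_boot all_order all_algebra ring.
Set Implicit Arguments.
Unset Strict Implicit.
Unset Printing Implicit Defensive.
Import Order.TTheory GRing.Theory Num.Theory.
Local Open Scope ring_scope.

(** * Wedge and contraction on the exterior algebra *)

Section ExteriorRing.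
Variables (K : comNzRingType) (m : nat).
Implicit Types (a b th : 'rV[K]_m) (s t : ext K m) (I L : {set 'I_m}) (v u : 'rV[K]_(m + m)).

(* Opaque, like set4, plane_j and plane_rot below: unification must not unfold it. *)
Fact wedge_key : {f : 'rV[K]_m -> ext K m -> ext K m | forall a s, ext_mul (ext_vec a) s = f a s}.
Proof. by exists (fun a s => ext_mul (ext_vec a) s). Qed.

Definition wedge := sval wedge_key.

Lemma wedge_def a s : ext_mul (ext_vec a) s = wedge a s.
Proof. exact: (svalP wedge_key). Qed.

Definition ext_sign (i : 'I_m) L : K := (-1) ^+ #|[set j in L | (j < i)%N]|.

Lemma wedgeE a s L : wedge a s L = \sum_(i in L) ext_sign i L * (a 0 i * s (L :\ i)).
Proof. by rewrite -wedge_def; exact: ext_vec_mulE. Qed.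

Lemma contractionE th s L :
  contraction th s L = \sum_(i | i \notin L) ext_sign i L * (th 0 i * s (i |: L)).
Proof. by rewrite ffunE. Qed.

Lemma ext_addE s t L : (s + t) L = s L + t L :> K. Proof. by rewrite ffunE. Qed.
Lemma ext_oppE s L : (- s) L = - s L :> K. Proof. by rewrite ffunE. Qed.
Lemma ext_scaleE k s L : (k *: s) L = k * s L :> K. Proof. by rewrite ffunE. Qed.
Lemma ext_zeroE L : (0 : ext K m) L = 0 :> K. Proof. by rewrite ffunE. Qed.
Lemma ext_monoE I L : ext_mono I L = (L == I)%:R :> K. Proof. by rewrite ffunE. Qed.
Lemma ext_sumE (T : Type) (r : seq T) (P : pred T) (F : T -> ext K m) L :
  (\sum_(x <- r | P x) F x) L = \sum_(x <- r | P x) F x L :> K.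
Proof. by rewrite sum_ffunE. Qed.

Lemma wedge0l s : wedge 0 s = 0.
Proof. by apply/ffunP => L; rewrite wedgeE ext_zeroE big1 // => i _; rewrite mxE mul0r mulr0. Qed.

Lemma contraction0l s : contraction 0 s = 0.
Proof.
by apply/ffunP => L; rewrite contractionE ext_zeroE big1 // => i _; rewrite mxE mul0r mulr0.
Qed.

Lemma V_act_row a th s : V_act (row_mx a th) s = wedge a s + contraction th s.
Proof. by rewrite /V_act wedge_def row_mxKl row_mxKr. Qed.

Lemma V_act_l a s : V_act (row_mx a 0) s = wedge a s.
Proof. by rewrite V_act_row contraction0l addr0. Qed.

Lemma V_act_r th s : V_act (row_mx 0 th) s = contraction th s.
Proof. by rewrite V_act_row wedge0l add0r. Qed.

Lemma V_form_row a th b th' :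
  V_form (row_mx a th) (row_mx b th') = \sum_i th' 0 i * a 0 i + \sum_i th 0 i * b 0 i.
Proof. by rewrite /V_form !row_mxKl !row_mxKr. Qed.

Lemma V_form_ll a b : V_form (row_mx a 0) (row_mx b 0) = 0.
Proof. by rewrite V_form_row !big1 ?addr0 // => i _; rewrite [X in X * _]mxE mul0r. Qed.

Lemma V_form_rr a b : V_form (row_mx 0 a) (row_mx 0 b) = 0.
Proof. by rewrite V_form_row !big1 ?addr0 // => i _; rewrite [X in _ * X]mxE mulr0. Qed.

Lemma V_form_lr a b : V_form (row_mx a 0) (row_mx 0 b) = \sum_i b 0 i * a 0 i.
Proof. by rewrite V_form_row [X in _ + X]big1 ?addr0 // => i _; rewrite [X in X * _]mxE mul0r. Qed.

Lemma V_formC v u : V_form v u = V_form u v.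
Proof. by rewrite /V_form addrC. Qed.

Lemma V_formDl v u z : V_form (v + u) z = V_form v z + V_form u z.
Proof.
rewrite /V_form -!big_split /=.
by apply: eq_bigr => i _; rewrite !mxE; ring.
Qed.

Lemma V_formZl k v z : V_form (k *: v) z = k * V_form v z.
Proof.
rewrite /V_form -!big_split mulr_sumr /=.
by apply: eq_bigr => i _; rewrite !mxE; ring.
Qed.

Lemma V_formDr v u z : V_form z (v + u) = V_form z v + V_form z u.
Proof. by rewrite V_formC V_formDl !(V_formC z). Qed.

Lemma V_formZr k v z : V_form z (k *: v) = k * V_form z v.
Proof. by rewrite V_formC V_formZl (V_formC z). Qed.

Lemma V_formNl v u : V_form (- v) u = - V_form v u.
Proof. by rewrite -scaleN1r V_formZl mulN1r. Qed.

Lemma V_formNr v u : V_form u (- v) = - V_form u v.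
Proof. by rewrite -scaleN1r V_formZr mulN1r. Qed.

Lemma V_actD v s t : V_act v (s + t) = V_act v s + V_act v t.
Proof. by have := V_act_linear v 1 s t; rewrite !scale1r. Qed.

Lemma V_act0 v : V_act v 0 = 0.
Proof. by apply: (addrI (V_act v 0)); rewrite -V_actD !addr0. Qed.

Lemma V_actZ v k s : V_act v (k *: s) = k *: V_act v s.
Proof. by rewrite -[k *: s]addr0 V_act_linear V_act0 addr0. Qed.

Lemma V_actN v s : V_act v (- s) = - V_act v s.
Proof. by rewrite -scaleN1r V_actZ scaleN1r. Qed.

Lemma V_act0l s : V_act 0 s = 0.
Proof. by rewrite -(scale0r 0) V_actZl scale0r. Qed.

Lemma V_actNl v s : V_act (- v) s = - V_act v s.
Proof. by rewrite -scaleN1r V_actZl scaleN1r. Qed.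

Lemma V_act_suml (T : Type) (r : seq T) (P : pred T) (F : T -> 'rV[K]_(m + m)) s :
  V_act (\sum_(x <- r | P x) F x) s = \sum_(x <- r | P x) V_act (F x) s.
Proof. exact: (big_morph (fun v => V_act v s) (fun v u => V_actDl v u s) (V_act0l s)). Qed.

Lemma wedgeDr a s t : wedge a (s + t) = wedge a s + wedge a t.
Proof. by rewrite -!V_act_l V_actD. Qed.
Lemma wedgeZr a k s : wedge a (k *: s) = k *: wedge a s.
Proof. by rewrite -!V_act_l V_actZ. Qed.
Lemma wedge0r a : wedge a 0 = 0.
Proof. by rewrite -!V_act_l V_act0. Qed.
Lemma wedgeNr a s : wedge a (- s) = - wedge a s.
Proof. by rewrite -!V_act_l V_actN. Qed.
Lemma wedgeDl a b s : wedge (a + b) s = wedge a s + wedge b s.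
Proof. by rewrite -!V_act_l -V_actDl add_row_mx addr0. Qed.
Lemma wedgeZl k a s : wedge (k *: a) s = k *: wedge a s.
Proof. by rewrite -!V_act_l -V_actZl scale_row_mx scaler0. Qed.
Lemma wedge_sumr (T : Type) (r : seq T) (P : pred T) a (F : T -> ext K m) :
  wedge a (\sum_(x <- r | P x) F x) = \sum_(x <- r | P x) wedge a (F x).
Proof. exact: (big_morph (wedge a) (wedgeDr a) (wedge0r a)). Qed.
Lemma wedge_suml (T : Type) (r : seq T) (P : pred T) (F : T -> 'rV[K]_m) s :
  wedge (\sum_(x <- r | P x) F x) s = \sum_(x <- r | P x) wedge (F x) s.
Proof. exact: (big_morph (fun a => wedge a s) (fun a b => wedgeDl a b s) (wedge0l s)). Qed.
Lemma contractionDr a s t : contraction a (s + t) = contraction a s + contraction a t.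
Proof. by rewrite -!V_act_r V_actD. Qed.
Lemma contraction0r a : contraction a 0 = 0.
Proof. by rewrite -!V_act_r V_act0. Qed.
Lemma contractionZr a k s : contraction a (k *: s) = k *: contraction a s.
Proof. by rewrite -!V_act_r V_actZ. Qed.

Lemma wedgeC a b s : wedge a (wedge b s) = - wedge b (wedge a s).
Proof. by apply/eqP; rewrite -addr_eq0 -!V_act_l V_act_rel V_form_ll scale0r. Qed.

Lemma contraction_wedge th a s :
  contraction th (wedge a s) = (\sum_i th 0 i * a 0 i) *: s - wedge a (contraction th s).
Proof.
apply/eqP; rewrite eq_sym subr_eq -!V_act_l -!V_act_r V_act_rel V_form_row.
rewrite [X in X + _]big1 ?add0r // => i _; by rewrite mxE mul0r.
Qed.

Lemma contraction_one th : contraction th ext_one = 0.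
Proof.
apply/ffunP => L; rewrite contractionE ext_zeroE big1 // => i _.
rewrite /ext_one ext_monoE; case: eqP => [E|]; last by rewrite !mulr0.
by have := finset.setU11 i L; rewrite E inE.
Qed.

Definition basis_vec (i : 'I_m) : 'rV[K]_m := delta_mx 0 i.

Lemma basis_vecE i j : basis_vec i 0 j = (j == i)%:R.
Proof. by rewrite mxE eqxx. Qed.

Lemma row_basis a : a = \sum_i a 0 i *: basis_vec i.
Proof. by rewrite [LHS]row_sum_delta. Qed.

Lemma row_mx_basis v :
  v = \sum_i (lsubmx v 0 i *: row_mx (basis_vec i) 0 + rsubmx v 0 i *: row_mx 0 (basis_vec i)).
Proof.
rewrite -{1}(hsubmxK v) {1}(row_basis (lsubmx v)) {1}(row_basis (rsubmx v)).
elim/big_ind3: _ => [|x1 x2 x3 y1 y2 y3 E1 E2|i _]; first by rewrite row_mx0.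
  by rewrite -E1 -E2 add_row_mx.
by rewrite !scale_row_mx add_row_mx !scaler0 addr0 add0r.
Qed.

Lemma wedge_basisE i s L :
  wedge (basis_vec i) s L = (i \in L)%:R * (ext_sign i L * s (L :\ i)).
Proof.
rewrite wedgeE big_mkcond (bigD1 i) //= big1 ?addr0 => [|j /negPf ji].
  by rewrite basis_vecE eqxx mul1r; case: ifP; rewrite ?mul1r ?mul0r.
by rewrite basis_vecE ji mul0r mulr0 if_same.
Qed.

Lemma contraction_basisE i s L :
  contraction (basis_vec i) s L = (i \notin L)%:R * (ext_sign i L * s (i |: L)).
Proof.
rewrite contractionE big_mkcond (bigD1 i) //= big1 ?addr0 => [|j /negPf ji].
  by rewrite basis_vecE eqxx mul1r; case: ifP; rewrite ?mul1r ?mul0r.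
by rewrite basis_vecE ji mul0r mulr0 if_same.
Qed.

Lemma ext_sign_sqr i L : ext_sign i L * ext_sign i L = 1.
Proof. by rewrite -expr2 sqrr_sign. Qed.

Lemma ext_sign_U1 i I : ext_sign i (i |: I) = ext_sign i I.
Proof.
congr (_ ^+ _); apply: eq_card => j; rewrite !inE.
by case: eqP => // ->; rewrite ltnn !andbF.
Qed.

Lemma wedge_basis_mono i I : i \in I ->
  ext_mono I = ext_sign i I *: wedge (basis_vec i) (ext_mono (I :\ i)).
Proof.
move=> iI; apply/ffunP => L; rewrite ext_scaleE wedge_basisE !ext_monoE.
case: (L =P I) => [->|LI]; first by rewrite iI eqxx mulr1 mul1r ext_sign_sqr.
have [iL|] := boolP (i \in L); last by rewrite mul0r mulr0.
case: eqP => [E|]; last by rewrite !mulr0.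
by case: LI; rewrite -(finset.setD1K iL) E finset.setD1K.
Qed.

Lemma ext_mono_sum s : s = \sum_I s I *: ext_mono I.
Proof.
apply/ffunP => L; rewrite ext_sumE (bigD1 L) //= big1 ?addr0 => [|I /negPf LI].
  by rewrite ext_scaleE ext_monoE eqxx mulr1.
by rewrite ext_scaleE ext_monoE eq_sym LI mulr0.
Qed.

(** Every monomial is, up to sign, an iterated wedge on 1. Identities between linear operators on
    spinors are thereby reduced to their behaviour on 1 and under wedging. *)
Lemma ext_ind (P : ext K m -> Prop) :
  P ext_one -> (forall k s t, P s -> P t -> P (k *: s + t)) ->
  (forall a s, P s -> P (wedge a s)) -> forall s, P s.
Proof.
move=> P1 PD PW; have P0 : P 0 by rewrite -(addNr ext_one) -scaleN1r; apply: PD.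
have Pm I : P (ext_mono I).
  have [k] := ubnP #|I|; elim: k I => // k IHk I Ik.
  have [->|[i iI]] := set_0Vmem I; first exact: P1.
  rewrite (wedge_basis_mono iI) -[X in P X]addr0; apply: PD => //; apply/PW/IHk.
  by rewrite (cardsD1 i) iI in Ik.
move=> s; rewrite (ext_mono_sum s); elim/big_rec: _ => // I t _ Pt.
by apply: PD => //; apply: Pm.
Qed.

End ExteriorRing.

(** * Functoriality of the exterior algebra *)

Section ExteriorMap.
Variables (K : numDomainType) (m : nat).
Implicit Types (a b th : 'rV[K]_m) (s t : ext K m) (I L : {set 'I_m}) (g h : 'M[K]_m).

Lemma ext_double s : s + s = 0 -> s = 0.
Proof.
move=> /ffunP s0; apply/ffunP => L; have := s0 L; rewrite ext_addE ext_zeroE.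
by move/eqP; rewrite -mulr2n -mulr_natl mulf_eq0 pnatr_eq0 => /eqP.
Qed.

(** Anticommutation only gives that twice this element vanishes; the coefficients are now without
    2-torsion. *)
Lemma wedge_self a s : wedge a (wedge a s) = 0.
Proof. by apply: ext_double; rewrite {1}wedgeC addNr. Qed.

(** The recursion runs over a list of indices independent of I, so that the row of index i can be
    inserted in its place by induction on the list while I changes to i |: I. *)
Let row_prod g I (r : seq 'I_m) : ext K m :=
  foldr (fun j s => if j \in I then wedge (row j g) s else s) ext_one r.

Let wedge_row_prod g I i (r : seq 'I_m) : sorted ltn (map val r) -> i \in r ->
  wedge (row i g) (row_prod g I r) =
  if i \in I then 0 else
    (-1) ^+ count (fun j => (j \in I) && (j < i)%N) r *: row_prod g (i |: I) r.
Proof.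
elim: r => // j r IHr /=; rewrite path_sortedE; last exact: ltn_trans.
case/andP=> jr r_sorted; rewrite inE.
have {}jr k : k \in r -> (j < k)%N by move=> kr; apply: (allP jr); apply: map_f.
have notin : j \notin r by apply/negP => /jr; rewrite ltnn.
case: (eqVneq i j) => [-> _|ij /= ir]; last first.
  rewrite in_setU1 eq_sym (negPf ij) /= (jr _ ir) andbT.
  case: (boolP (j \in I)) => jI; last by rewrite add0n IHr.
  by rewrite wedgeC IHr //; case: ifP; rewrite ?wedge0r ?oppr0 // add1n exprS wedgeZr mulN1r scaleNr.
have E : row_prod g (j |: I) r = row_prod g I r.
  elim: r {IHr jr r_sorted} notin => //= k r IHr; rewrite inE negb_or => /andP[kj jr].
  by rewrite in_setU1 eq_sym (negPf kj) /= IHr.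
rewrite setU11 ltnn andbF add0n E.
case: ifP => // jI; first by rewrite wedge_self.
rewrite (@eq_in_count _ _ pred0) ?count_pred0 ?scale1r // => k /jr kj /=.
by rewrite ltnNge (ltnW kj) andbF.
Qed.

Let row_prodE g I : ext_prod [seq row i g | i <- enum I] = row_prod g I (enum 'I_m).
Proof.
have -> : enum I = [seq i <- enum 'I_m | i \in I] by rewrite enumT.
by elim: (enum 'I_m) => //= j r IHr; case: ifP => /= _; rewrite ?wedge_def IHr.
Qed.

Let enum_sorted : sorted ltn (map val (enum 'I_m)).
Proof. by rewrite val_enum_ord iota_ltn_sorted. Qed.

Let wedge_row g I i :
  wedge (row i g) (ext_prod [seq row j g | j <- enum I]) =
  if i \in I then 0 else ext_sign K i I *: ext_prod [seq row j g | j <- enum (i |: I)].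
Proof.
rewrite !row_prodE wedge_row_prod ?mem_enum //; case: ifP => // _.
congr ((-1) ^+ _ *: _); rewrite /= -size_filter /ext_sign cardE; congr (size _).
by rewrite /enum_mem -enumT filter_predT; apply: eq_filter => j; rewrite !inE.
Qed.

Lemma ext_map_linear g k s t : ext_map g (k *: s + t) = k *: ext_map g s + ext_map g t.
Proof.
rewrite /ext_map scaler_sumr -big_split; apply: eq_bigr => I _ /=.
by rewrite ext_addE ext_scaleE scalerDl scalerA.
Qed.

Lemma ext_map0 g : ext_map g 0 = 0.
Proof. by rewrite /ext_map big1 // => I _; rewrite ext_zeroE scale0r. Qed.

Lemma ext_mapZ g k s : ext_map g (k *: s) = k *: ext_map g s.
Proof. by rewrite -[k *: s]addr0 ext_map_linear ext_map0 addr0. Qed.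

Lemma ext_mapD g s t : ext_map g (s + t) = ext_map g s + ext_map g t.
Proof. by rewrite -[s]scale1r ext_map_linear !scale1r. Qed.

Lemma ext_map_sum (T : Type) (r : seq T) (P : pred T) g (F : T -> ext K m) :
  ext_map g (\sum_(x <- r | P x) F x) = \sum_(x <- r | P x) ext_map g (F x).
Proof. exact: (big_morph (ext_map g) (ext_mapD g) (ext_map0 g)). Qed.

Lemma ext_map_mono g I : ext_map g (ext_mono I) = ext_prod [seq row j g | j <- enum I].
Proof.
rewrite /ext_map (bigD1 I) //= big1 ?addr0 => [|J /negPf JI].
  by rewrite ext_monoE eqxx scale1r.
by rewrite ext_monoE JI scale0r.
Qed.

Lemma ext_map_one g : ext_map g ext_one = ext_one.
Proof. by rewrite ext_map_mono enum_set0. Qed.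

Lemma ext_map_wedge g a s : ext_map g (wedge a s) = wedge (a *m g) (ext_map g s).
Proof.
rewrite {1}(row_basis a) mulmx_sum_row !wedge_suml ext_map_sum; apply: eq_bigr => i _.
rewrite !wedgeZl ext_mapZ; congr (_ *: _).
rewrite (ext_mono_sum s) wedge_sumr !ext_map_sum wedge_sumr; apply: eq_bigr => I _.
rewrite wedgeZr !ext_mapZ wedgeZr; congr (_ *: _).
rewrite ext_map_mono wedge_row.
have -> : wedge (basis_vec K i) (ext_mono I) =
          if i \in I then 0 else ext_sign K i I *: ext_mono (i |: I).
  have [iI|iI] := boolP (i \in I).
    by rewrite (wedge_basis_mono _ iI) wedgeZr wedge_self scaler0.
  rewrite (wedge_basis_mono _ (setU11 i I)) scalerA setU1K //.
  by rewrite ext_sign_U1 ext_sign_sqr scale1r.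
by case: ifP => _; rewrite ?ext_map0 // ext_mapZ ext_map_mono.
Qed.

(** The universal property of the exterior algebra, used to recognize [ext_map] of a composite or of
    a rank-one perturbation. *)
Lemma ext_map_unique g (T : ext K m -> ext K m) :
  T ext_one = ext_one -> (forall k s t, T (k *: s + t) = k *: T s + T t) ->
  (forall a s, T (wedge a s) = wedge (a *m g) (T s)) -> forall s, ext_map g s = T s.
Proof.
move=> T1 TD TW s; elim/ext_ind: s => [|k s t IHs IHt|a s IHs].
- by rewrite ext_map_one T1.
- by rewrite ext_map_linear TD IHs IHt.
- by rewrite ext_map_wedge TW IHs.
Qed.

Lemma ext_map1 s : ext_map 1%:M s = s.
Proof. by apply: ext_map_unique => // a t; rewrite mulmx1. Qed.

Lemma ext_mapM g h s : ext_map (g *m h) s = ext_map h (ext_map g s).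
Proof.
apply: (ext_map_unique (T := fun s => ext_map h (ext_map g s))) => [|k t u|a t].
- by rewrite !ext_map_one.
- by rewrite !ext_map_linear.
- by rewrite !ext_map_wedge mulmxA.
Qed.

Lemma ext_map_prod g (vs : seq 'rV[K]_m) :
  ext_map g (ext_prod vs) = ext_prod [seq v *m g | v <- vs].
Proof. by elim: vs => [|v vs IHvs] /=; rewrite ?ext_map_one // !wedge_def ext_map_wedge IHvs. Qed.

(** The right side is multiplicative because a /\ a = 0 kills the quadratic terms; no condition on
    th(a) enters. The isometries induced by the elements 1 + 2 p q are products of two such maps. *)
Lemma ext_map_rank1 th a s :
  ext_map (1%:M + th^T *m a) s = s + wedge a (contraction th s).
Proof.
apply: (ext_map_unique (T := fun s => s + wedge a (contraction th s))) => [|k t u|b t].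
- by rewrite contraction_one wedge0r addr0.
- by rewrite contractionDr contractionZr wedgeDr wedgeZr scalerDr addrACA.
have -> : b *m (1%:M + th^T *m a) = b + (\sum_i th 0 i * b 0 i) *: a.
  rewrite mulmxDr mulmx1 mulmxA; congr (_ + _).
  rewrite [b *m _]mx11_scalar mul_scalar_mx; congr (_ *: _).
  by rewrite mxE; apply: eq_bigr => i _; rewrite mxE mulrC.
rewrite contraction_wedge wedgeDl !wedgeDr !wedgeZl wedge_self scaler0 addr0.
rewrite wedgeNr wedgeZr (wedgeC b a) -addrA; congr (_ + _); exact: addrC.
Qed.

End ExteriorMap.

(** * Boolean coordinates for subsets of four indices *)

Definition i0 : 'I_4 := @Ordinal 4 0 isT.
Definition i1 : 'I_4 := @Ordinal 4 1 isT.
Definition i2 : 'I_4 := @Ordinal 4 2 isT.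
Definition i3 : 'I_4 := @Ordinal 4 3 isT.

Lemma big_ord4 (T : Type) (x : T) (op : Monoid.law x) (F : 'I_4 -> T) :
  \big[op/x]_i F i = op (op (op (F i0) (F i1)) (F i2)) (F i3).
Proof.
rewrite !big_ord_recl big_ord0 Monoid.mulm1 !Monoid.mulmA.
by congr (op (op (op (F _) (F _)) (F _)) (F _)); apply: val_inj.
Qed.

Lemma ord4P (P : 'I_4 -> Prop) : P i0 -> P i1 -> P i2 -> P i3 -> forall i, P i.
Proof.
move=> P0 P1 P2 P3 [[|[|[|[|//]]]] ilt].
- by rewrite (_ : Ordinal ilt = i0) //; apply: val_inj.
- by rewrite (_ : Ordinal ilt = i1) //; apply: val_inj.
- by rewrite (_ : Ordinal ilt = i2) //; apply: val_inj.
- by rewrite (_ : Ordinal ilt = i3) //; apply: val_inj.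
Qed.

Fact set4_key : {f : bool -> bool -> bool -> bool -> {set 'I_4} | forall b0 b1 b2 b3,
  (i0 \in f b0 b1 b2 b3 = b0) * (i1 \in f b0 b1 b2 b3 = b1) *
  (i2 \in f b0 b1 b2 b3 = b2) * (i3 \in f b0 b1 b2 b3 = b3)}.
Proof.
exists (fun b0 b1 b2 b3 => [set i : 'I_4 | nth false [:: b0; b1; b2; b3] i]).
by move=> b0 b1 b2 b3; rewrite !inE.
Qed.

Definition set4 := sval set4_key.

Lemma in_set4 b0 b1 b2 b3 : ((i0 \in set4 b0 b1 b2 b3) = b0) * ((i1 \in set4 b0 b1 b2 b3) = b1) *
  ((i2 \in set4 b0 b1 b2 b3) = b2) * ((i3 \in set4 b0 b1 b2 b3) = b3).
Proof. exact: (svalP set4_key). Qed.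

Lemma set4E (I : {set 'I_4}) : I = set4 (i0 \in I) (i1 \in I) (i2 \in I) (i3 \in I).
Proof. by apply/finset.setP; apply: ord4P; rewrite in_set4. Qed.

Lemma set4_inj b0 b1 b2 b3 c0 c1 c2 c3 :
  (set4 b0 b1 b2 b3 == set4 c0 c1 c2 c3) = [&& b0 == c0, b1 == c1, b2 == c2 & b3 == c3].
Proof.
apply/eqP/and4P => [/finset.setP E|[/eqP-> /eqP-> /eqP-> /eqP->]] //.
by split; apply/eqP; [have := E i0|have := E i1|have := E i2|have := E i3]; rewrite !in_set4.
Qed.

Lemma card_set4 b0 b1 b2 b3 : #|set4 b0 b1 b2 b3| = (b0 + b1 + b2 + b3)%N.
Proof. by rewrite -sum1_card big_mkcond big_ord4 !in_set4 /=; case: b0 b1 b2 b3 => [] [] [] []. Qed.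

Lemma card_set_ord4 (P : pred 'I_4) : #|[set i | P i]| = (P i0 + P i1 + P i2 + P i3)%N.
Proof.
by rewrite -sum1_card big_mkcond big_ord4 !inE; do 4!case: (P _).
Qed.

Lemma sum_set4 (V : nmodType) (F : {set 'I_4} -> V) :
  \sum_I F I = \sum_(b0 : bool) \sum_(b1 : bool) \sum_(b2 : bool) \sum_(b3 : bool) F (set4 b0 b1 b2 b3).
Proof.
rewrite pair_big pair_big pair_big /=.
rewrite (reindex (fun p : bool * bool * bool * bool => set4 p.1.1.1 p.1.1.2 p.1.2 p.2)) //=.
exists (fun I : {set 'I_4} => (i0 \in I, i1 \in I, i2 \in I, i3 \in I)) => [[[[a b] c] d] _|I _] /=.
  by rewrite !in_set4.
by rewrite -set4E.
Qed.

Section Coordinates.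
Variable K : comNzRingType.
Implicit Types (s t : ext K 4) (v : 'rV[K]_(4 + 4)).

Definition V_coord v (i : 'I_4) (e : bool) : K := if e then lsubmx v 0 i else rsubmx v 0 i.

Lemma V_actE v s (L : {set 'I_4}) :
  V_act v s L = \sum_i ext_sign K i L *
    (if i \in L then lsubmx v 0 i * s (L :\ i) else rsubmx v 0 i * s (i |: L)).
Proof.
rewrite -{1}(hsubmxK v) V_act_row ext_addE wedgeE contractionE [RHS](bigID (fun i => i \in L)) /=.
by congr (_ + _); apply: eq_bigr => i; [move=> -> | move/negPf ->].
Qed.

Lemma V_act4 v s b0 b1 b2 b3 :
  V_act v s (set4 b0 b1 b2 b3) =
    V_coord v i0 b0 * s (set4 (~~ b0) b1 b2 b3)
    + (-1) ^+ b0 * (V_coord v i1 b1 * s (set4 b0 (~~ b1) b2 b3))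
    + (-1) ^+ (b0 + b1) * (V_coord v i2 b2 * s (set4 b0 b1 (~~ b2) b3))
    + (-1) ^+ (b0 + b1 + b2) * (V_coord v i3 b3 * s (set4 b0 b1 b2 (~~ b3))).
Proof.
rewrite V_actE big_ord4 /ext_sign !card_set_ord4 !(inE, in_set4) /= !andbF !andbT /= !addn0 expr0 mul1r.
have E i (e : bool) (L M : {set 'I_4}) : (e -> L :\ i = M) -> (~~ e -> i |: L = M) ->
    (if e then lsubmx v 0 i * s (L :\ i) else rsubmx v 0 i * s (i |: L)) = V_coord v i e * s M.
  by rewrite /V_coord; case: e => [->|_ ->].
congr (_ + _ + _ + _); try congr (_ * _); apply: E => //.
all: move=> b_eq; apply/finset.setP; apply: ord4P; rewrite !(inE, in_set4) //=.
all: by case: b0 b1 b2 b3 b_eq => [] [] [] [].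
Qed.

End Coordinates.

(** * The pairing on spinors *)

Section MukaiPairing.
Variables (R : realType) (X : abelian_surface R) (K : comNzRingType).
Implicit Types (s t r : ext K 4) (v u : 'rV[K]_(4 + 4)).

Local Notation o := ((orientation X)%:~R : K).
Local Notation c s b0 b1 b2 b3 := (s (set4 b0 b1 b2 b3)).

Lemma orientation_sqr : orientation X * orientation X = 1.
Proof.
have := periods_lattice X; rewrite unitmxE unitfE -sgz_eq0 -/(orientation X) /orientation.
by case: sgzP.
Qed.

Lemma orientation_sqrr : o * o = 1.
Proof. by rewrite -intrM orientation_sqr. Qed.

(** Only complementary subsets pair; the sign is that of tau times that of the shuffle. *)
Lemma S_form4 s t :
  S_form X s t = o * (
      c s false false false false * c t true true true true
    + c s true true true true * c t false false false false
    + c s true false false false * c t false true true true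
    + c s false true true true * c t true false false false
    - c s false true false false * c t true false true true
    - c s true false true true * c t false true false false
    + c s false false true false * c t true true false true
    + c s true true false true * c t false false true false
    - c s false false false true * c t true true true false
    - c s true true true false * c t false false false true
    - c s true true false false * c t false false true true
    - c s false false true true * c t true true false false
    + c s true false true false * c t false true false true
    + c s false true false true * c t true false true false
    - c s true false false true * c t false true true false
    - c s false true true false * c t true false false true).
Proof.
rewrite /S_form /int_X; congr (_ * _); rewrite ffunE.
rewrite (eq_bigl xpredT) => [|I]; last by rewrite powersetE subsetT.
have setC4 b0 b1 b2 b3 : [set: 'I_4] :\: set4 b0 b1 b2 b3 = set4 (~~ b0) (~~ b1) (~~ b2) (~~ b3).
  by apply/finset.setP; apply: ord4P; rewrite !(inE, in_set4) andbT.
have invE b0 b1 b2 b3 c0 c1 c2 c3 : inversions (set4 b0 b1 b2 b3) (set4 c0 c1 c2 c3) =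
    (b1 * c0 + b2 * (c0 + c1) + b3 * (c0 + c1 + c2))%N.
  rewrite /inversions big_mkcond big_ord4 !(inE, in_set4) /= !card_set_ord4 !(inE, in_set4) /=.
  by case: b0 b1 b2 b3 c0 c1 c2 c3 => [] [] [] [] [] [] [] [].
rewrite sum_set4 !big_bool /= !setC4 !ffunE !card_set4 !invE /=.
rewrite ?(exprS, expr0).
ring.
Qed.

Lemma S_formC s t : S_form X s t = S_form X t s.
Proof. rewrite !S_form4; congr (_ * _); ring. Qed.

Lemma S_formDl s t r : S_form X (s + t) r = S_form X s r + S_form X t r.
Proof. rewrite !S_form4 !ffunE -mulrDr; congr (_ * _); ring. Qed.

Lemma S_formZl k s r : S_form X (k *: s) r = k * S_form X s r.
Proof. rewrite !S_form4 !ext_scaleE; ring. Qed.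

(** The sign in tau is what makes each vector self-adjoint. With the Clifford relation this yields
    [S_form_act], that is, v |-> v s is a similitude. *)
Lemma S_form_adj v s t : S_form X (V_act v s) t = S_form X s (V_act v t).
Proof.
rewrite !S_form4 !V_act4 /= /V_coord.
congr (_ * _); ring.
Qed.

Lemma S_formDr s t r : S_form X r (s + t) = S_form X r s + S_form X r t.
Proof. by rewrite S_formC S_formDl !(S_formC r). Qed.
Lemma S_formZr k s r : S_form X r (k *: s) = k * S_form X r s.
Proof. by rewrite S_formC S_formZl (S_formC r). Qed.
Lemma S_formNl s r : S_form X (- s) r = - S_form X s r.
Proof. by rewrite -scaleN1r S_formZl mulN1r. Qed.
Lemma S_formNr s r : S_form X r (- s) = - S_form X r s.
Proof. by rewrite -scaleN1r S_formZr mulN1r. Qed.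
Lemma S_form0l r : S_form X 0 r = 0.
Proof. by rewrite -(scale0r 0) S_formZl mul0r. Qed.

Definition ext_odd s : Prop := forall I : {set 'I_4}, ~~ odd #|I| -> s I = 0.

Lemma ext_even4 s : ext_even s -> (
   (s (set4 true true true false) = 0 :> K) * (s (set4 true true false true) = 0 :> K) *
    (s (set4 true false true true) = 0 :> K) * (s (set4 true false false false) = 0 :> K) *
    (s (set4 false true true true) = 0 :> K) * (s (set4 false true false false) = 0 :> K) *
    (s (set4 false false true false) = 0 :> K) * (s (set4 false false false true) = 0 :> K))%type.
Proof. by move=> s_even; do !split; rewrite s_even // card_set4. Qed.

Lemma ext_odd4 s : ext_odd s -> (
   (s (set4 true true true true) = 0 :> K) * (s (set4 true true false false) = 0 :> K) *
    (s (set4 true false true false) = 0 :> K) * (s (set4 true false false true) = 0 :> K) *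
    (s (set4 false true true false) = 0 :> K) * (s (set4 false true false true) = 0 :> K) *
    (s (set4 false false true true) = 0 :> K) * (s (set4 false false false false) = 0 :> K))%type.
Proof. by move=> s_odd; do !split; rewrite s_odd // card_set4. Qed.

Lemma S_form_even_odd s t : ext_even s -> ext_odd t -> S_form X s t = 0.
Proof. by move=> s_even t_odd; rewrite S_form4 !(ext_even4 s_even, ext_odd4 t_odd); ring. Qed.

Lemma V_act_even v s : ext_even s -> ext_odd (V_act v s).
Proof.
move=> s_even L; rewrite (set4E L) card_set4 V_act4.
by case: (i0 \in L) (i1 \in L) (i2 \in L) (i3 \in L) => [] [] [] [] //= _;
  rewrite /= !(ext_even4 s_even) !mulr0 !addr0; exact: erefl.
Qed.

Lemma V_act_odd v s : ext_odd s -> ext_even (V_act v s).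
Proof.
move=> s_odd L; rewrite (set4E L) card_set4 V_act4.
by case: (i0 \in L) (i1 \in L) (i2 \in L) (i3 \in L) => [] [] [] [] //= _;
  rewrite /= !(ext_odd4 s_odd) !mulr0 !addr0; exact: erefl.
Qed.

(** Up to sign, a coordinate of s is its pairing with the complementary monomial. *)
Lemma S_form_nondeg s : (forall t, S_form X s t = 0) -> s = 0.
Proof.
move=> s0; apply/ffunP => I; rewrite ext_zeroE (set4E I) -[LHS]/(s _ : K).
have oE x : o * x = 0 -> x = 0.
  by move=> ox; rewrite -[x]mul1r -orientation_sqrr -mulrA ox mulr0.
have := s0 (ext_mono (~: I)); rewrite (set4E (~: I)) !(inE, in_set4) S_form4 !ext_monoE !set4_inj.
case: (i0 \in I) (i1 \in I) (i2 \in I) (i3 \in I) => [] [] [] [] /= /oE;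
  rewrite !(mulr0, mulr1, oppr0, addr0, add0r) => E;
  by [exact: E | apply: oppr_inj; rewrite oppr0; exact: E].
Qed.

End MukaiPairing.

(** * Triality between V, S^+ and S^- *)

Section DualAction.
Variables (R : realType) (X : abelian_surface R) (K : comNzRingType).
Implicit Types (s t r : ext K 4) (v u : 'rV[K]_(4 + 4)).
Local Notation o := ((orientation X)%:~R : K).

Lemma sum_basis m (a : 'rV[K]_m) i : \sum_j basis_vec K i 0 j * a 0 j = a 0 i.
Proof.
rewrite (bigD1 i) //= big1 ?addr0 => [|j /negPf ji]; rewrite basis_vecE ?eqxx ?mul1r //.
by rewrite ji mul0r.
Qed.

Lemma V_form_basis_r v i : V_form v (row_mx 0 (basis_vec K i)) = lsubmx v 0 i.
Proof.
rewrite /V_form row_mxKl row_mxKr sum_basis [X in _ + X]big1 ?addr0 // => j _.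
by rewrite [X in _ * X]mxE mulr0.
Qed.

Lemma V_form_basis_l v i : V_form v (row_mx (basis_vec K i) 0) = rsubmx v 0 i.
Proof.
rewrite /V_form row_mxKl row_mxKr [X in X + _]big1 ?add0r => [|j _].
  by rewrite -[RHS]sum_basis; apply: eq_bigr => j _; rewrite mulrC.
by rewrite [X in X * _]mxE mul0r.
Qed.

Lemma V_form_nondeg v : (forall u, V_form v u = 0) -> v = 0.
Proof.
move=> v0; rewrite -(hsubmxK v) -(row_mx0 _ 1 4 4).
congr row_mx; apply/rowP => i; rewrite [RHS]mxE.
  by rewrite -V_form_basis_r v0.
by rewrite -V_form_basis_l v0.
Qed.

(** The adjoint of v |-> v s: the vector of V that represents the linear form v |-> (v s, t). On S^+
    x S^- it is the third triality product. The two blocks are exchanged because [V_form] pairs H^1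
    with its dual. *)
Definition dual_act s t : 'rV[K]_(4 + 4) :=
  row_mx (\row_i S_form X (V_act (row_mx 0 (basis_vec K i)) s) t)
         (\row_i S_form X (V_act (row_mx (basis_vec K i) 0) s) t).

Lemma lsubmx_dual_act s t i :
  lsubmx (dual_act s t) 0 i = S_form X (V_act (row_mx 0 (basis_vec K i)) s) t.
Proof. by rewrite row_mxKl mxE. Qed.

Lemma rsubmx_dual_act s t i :
  rsubmx (dual_act s t) 0 i = S_form X (V_act (row_mx (basis_vec K i) 0) s) t.
Proof. by rewrite row_mxKr mxE. Qed.

Lemma S_form_suml (T : Type) (q : seq T) (P : pred T) (F : T -> ext K 4) r :
  S_form X (\sum_(x <- q | P x) F x) r = \sum_(x <- q | P x) S_form X (F x) r.
Proof.
exact: (big_morph (fun s => S_form X s r) (fun s t => S_formDl X s t r) (S_form0l X r)).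
Qed.

Lemma dual_actP s t v : V_form (dual_act s t) v = S_form X (V_act v s) t.
Proof.
rewrite {2}(row_mx_basis v) V_act_suml S_form_suml /V_form row_mxKl row_mxKr -big_split /=.
apply: eq_bigr => i _; rewrite V_actDl !V_actZl S_formDl !S_formZl !mxE addrC.
by congr (_ + _); rewrite mulrC.
Qed.

Lemma dual_act4 s t : ext_even s -> ext_odd t ->
  ((lsubmx (dual_act s t) 0 i0 = o * (- (s (set4 true false false true) * t (set4 true true true false))
      + s (set4 true false true false) * t (set4 true true false true)
      - s (set4 true true false false) * t (set4 true false true true)
      + s (set4 true true true true) * t (set4 true false false false)))%R *
   (lsubmx (dual_act s t) 0 i1 = o * (- (s (set4 false true false true) * t (set4 true true true false))
      + s (set4 false true true false) * t (set4 true true false true)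
      - s (set4 true true false false) * t (set4 false true true true)
      + s (set4 true true true true) * t (set4 false true false false)))%R *
   (lsubmx (dual_act s t) 0 i2 = o * (- (s (set4 false false true true) * t (set4 true true true false))
      + s (set4 false true true false) * t (set4 true false true true)
      - s (set4 true false true false) * t (set4 false true true true)
      + s (set4 true true true true) * t (set4 false false true false)))%R *
   (lsubmx (dual_act s t) 0 i3 = o * (- (s (set4 false false true true) * t (set4 true true false true))
      + s (set4 false true false true) * t (set4 true false true true)
      - s (set4 true false false true) * t (set4 false true true true)
      + s (set4 true true true true) * t (set4 false false false true)))%R *
   (rsubmx (dual_act s t) 0 i0 = o * (s (set4 false false false false) * t (set4 false true true true)
      - s (set4 false false true true) * t (set4 false true false false)
      + s (set4 false true false true) * t (set4 false false true false)
      - s (set4 false true true false) * t (set4 false false false true)))%R *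
   (rsubmx (dual_act s t) 0 i1 = o * (- (s (set4 false false false false) * t (set4 true false true true))
      + s (set4 false false true true) * t (set4 true false false false)
      - s (set4 true false false true) * t (set4 false false true false)
      + s (set4 true false true false) * t (set4 false false false true)))%R *
   (rsubmx (dual_act s t) 0 i2 = o * (s (set4 false false false false) * t (set4 true true false true)
      - s (set4 false true false true) * t (set4 true false false false)
      + s (set4 true false false true) * t (set4 false true false false)
      - s (set4 true true false false) * t (set4 false false false true)))%R *
   (rsubmx (dual_act s t) 0 i3 = o * (- (s (set4 false false false false) * t (set4 true true true false))
      + s (set4 false true true false) * t (set4 true false false false)
      - s (set4 true false true false) * t (set4 false true false false)
      + s (set4 true true false false) * t (set4 false false true false)))
%R)%type.
Proof.
move=> s_even t_odd.
by do !split; rewrite ?lsubmx_dual_act ?rsubmx_dual_act S_form4 !(ext_odd4 t_odd) !V_act4 /V_coord /=;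
  rewrite !(ext_even4 s_even) !row_mxKl !row_mxKr !basis_vecE ![(0 : 'rV[K]_4) _ _]mxE /=; ring.
Qed.

(** A Clifford relation in which S^+ plays the role of V. It is particular to rank 4 and does not
    follow from the relations of C(V) alone, so it is verified coordinate by coordinate. *)
Lemma dual_act_even s t r : ext_even s -> ext_even r -> ext_odd t ->
  V_act (dual_act s t) r + V_act (dual_act r t) s = S_form X s r *: t.
Proof.
move=> s_even r_even t_odd; apply/ffunP => L.
rewrite (set4E L); move: (i0 \in L) (i1 \in L) (i2 \in L) (i3 \in L) => b0 b1 b2 b3.
have [e|e] := boolP (odd (b0 + b1 + b2 + b3)); last first.
  rewrite ext_addE ext_scaleE !(V_act_even, t_odd) ?card_set4 //.
  by rewrite mulr0 addr0.
case: b0 b1 b2 b3 e => [] [] [] [] //= _; rewrite ext_addE ext_scaleE !V_act4 /V_coord /=;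
  rewrite !(dual_act4 s_even t_odd, dual_act4 r_even t_odd) S_form4 !(ext_even4 s_even, ext_even4 r_even).
all: ring.
Qed.
End DualAction.

Section Triality.
Variables (R : realType) (X : abelian_surface R) (K : numFieldType).
Implicit Types (s t r : ext K 4) (v u : 'rV[K]_(4 + 4)).
Local Notation form := (S_form X).
Local Notation dual := (dual_act X).

Lemma S_form_act u v s t :
  form (V_act u s) (V_act v t) + form (V_act v s) (V_act u t) = V_form u v * form s t.
Proof. by rewrite !S_form_adj -S_formDr V_act_rel S_formZr. Qed.

Lemma S_form_act_diag u v s :
  2 * form (V_act u s) (V_act v s) = V_form u v * form s s.
Proof. by rewrite -S_form_act [X in _ + X]S_formC mulr_natl mulr2n. Qed.

Lemma dual_actZr s k t : dual s (k *: t) = k *: dual s t.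
Proof.
apply/eqP; rewrite -subr_eq0; apply/eqP/V_form_nondeg => u.
by rewrite V_formDl V_formNl V_formZl !dual_actP S_formZr subrr.
Qed.

Lemma dual_actDr s t r : dual s (t + r) = dual s t + dual s r.
Proof.
apply/eqP; rewrite -subr_eq0; apply/eqP/V_form_nondeg => u.
by rewrite V_formDl V_formNl V_formDl !dual_actP S_formDr subrr.
Qed.

Lemma dual_act0r s : dual s 0 = 0.
Proof. by rewrite -(scale0r 0) dual_actZr scale0r. Qed.

(** Unlike [dual_act_even], this is formal: pairing with u turns it into [S_form_act]. *)
Lemma dual_act_vec s r v :
  dual s (V_act v r) + dual r (V_act v s) = form s r *: v.
Proof.
apply/eqP; rewrite -subr_eq0; apply/eqP/V_form_nondeg => u.
rewrite V_formDl V_formNl V_formZl V_formDl !dual_actP.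
rewrite [X in _ + X - _]S_formC S_form_act V_formC.
by rewrite mulrC subrr.
Qed.

Lemma dual_act_self s v : 2 *: dual s (V_act v s) = form s s *: v.
Proof. by rewrite -dual_act_vec scaler_nat mulr2n. Qed.

Lemma V_act_dual_self s t : ext_even s -> ext_odd t ->
  2 *: V_act (dual s t) s = form s s *: t.
Proof. by move=> s_even t_odd; rewrite -dual_act_even // scaler_nat mulr2n. Qed.

(** By [dual_act_self], the map [dual s] inverts v |-> v s up to the factor (s, s)/2. This is how
    equalities in V are proved below: by acting on a spinor of nonzero norm. *)
Lemma V_act_inj s v : form s s != 0 -> V_act v s = 0 -> v = 0.
Proof.
move=> s_neq0 vs0; have := dual_act_self s v; rewrite vs0 dual_act0r scaler0.
by move/esym/eqP; rewrite scaler_eq0 (negPf s_neq0) => /eqP.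
Qed.

Lemma ext_evenD s t : ext_even s -> ext_even t -> ext_even (s + t).
Proof. by move=> s_even t_even I oI; rewrite ext_addE s_even ?t_even ?addr0. Qed.
Lemma ext_evenZ k s : ext_even s -> ext_even (k *: s).
Proof. by move=> s_even I oI; rewrite ext_scaleE s_even ?mulr0. Qed.
Lemma ext_oddD s t : ext_odd s -> ext_odd t -> ext_odd (s + t).
Proof. by move=> s_even t_even I oI; rewrite ext_addE s_even ?t_even ?addr0. Qed.
Lemma ext_oddZ k s : ext_odd s -> ext_odd (k *: s).
Proof. by move=> s_even I oI; rewrite ext_scaleE s_even ?mulr0. Qed.

Definition even_part s : ext K 4 := [ffun I : {set 'I_4} => if odd #|I| then 0 else s I].
Definition odd_part s : ext K 4 := [ffun I : {set 'I_4} => if odd #|I| then s I else 0].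

Lemma even_part_even s : ext_even (even_part s).
Proof. by move=> I oI; rewrite ffunE oI. Qed.
Lemma odd_part_odd s : ext_odd (odd_part s).
Proof. by move=> I /negPf oI; rewrite ffunE oI. Qed.
Lemma partsK s : even_part s + odd_part s = s.
Proof. by apply/ffunP => I; rewrite ext_addE !ffunE; case: ifP; rewrite ?addr0 ?add0r. Qed.
Lemma even_part_id s : ext_even s -> even_part s = s.
Proof. by move=> se; apply/ffunP => I; rewrite ffunE; case: ifP => // /se. Qed.
Lemma odd_part_id s : ext_odd s -> odd_part s = s.
Proof. by move=> se; apply/ffunP => I; rewrite ffunE; case: ifPn => // /se. Qed.
Lemma even_part_odd s : ext_odd s -> even_part s = 0.
Proof. by move=> so; rewrite -[LHS]addr0 -[X in _ + X](subrr s) addrA -{2}(odd_part_id so) partsK subrr. Qed.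
Lemma odd_part_even s : ext_even s -> odd_part s = 0.
Proof. by move=> so; apply: (addrI s); rewrite -{1}(even_part_id so) partsK addr0. Qed.
Lemma even_part_linear k s t : even_part (k *: s + t) = k *: even_part s + even_part t.
Proof.
apply/ffunP => I; rewrite ext_addE ext_scaleE !ffunE; case: ifP => _ //.
by rewrite mulr0 addr0.
Qed.
Lemma odd_part_linear k s t : odd_part (k *: s + t) = k *: odd_part s + odd_part t.
Proof.
apply/ffunP => I; rewrite ext_addE ext_scaleE !ffunE; case: ifP => _ //.
by rewrite mulr0 addr0.
Qed.

Lemma ext_parts (P : ext K 4 -> Prop) : (forall s t, P s -> P t -> P (s + t)) ->
  (forall s, ext_even s -> P s) -> (forall s, ext_odd s -> P s) -> forall s, P s.
Proof.
by move=> PD Pe Po s; rewrite -(partsK s); apply: PD; [apply/Pe/even_part_even | apply/Po/odd_part_odd].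
Qed.

End Triality.

Lemma mul_rows_linear (K : comNzRingType) m p (f : 'rV[K]_m -> 'rV[K]_p) :
  (forall k u v, f (k *: u + v) = k *: f u + f v) ->
  forall v, v *m (\matrix_i f (delta_mx 0 i)) = f v.
Proof.
move=> f_lin v; have f0 : f 0 = 0.
  by apply: (addrI (f 0)); rewrite -{1}[f 0]scale1r -f_lin scale1r !addr0.
rewrite [in RHS](row_sum_delta v) mulmx_sum_row.
elim/big_rec2: _ => [|i y z _ ->]; first by rewrite f0.
by rewrite f_lin rowK.
Qed.

(** * The complex structure and the rotations attached to an orthogonal pair *)

Section PlaneStructure.
Variables (R : realType) (X : abelian_surface R) (K : numFieldType).
Implicit Types (s t r : ext K 4) (v u : 'rV[K]_(4 + 4)).
Local Notation form := (S_form X).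
Local Notation dual := (dual_act X).

Section Defs.
Variables xi eta : ext K 4.
Let N := form xi xi.

(** When eta has norm N, (2/N) [dual eta] inverts v |-> v eta, so this solves (v J) eta = - v xi. *)
Let J_fun v := (- (2 / N)) *: dual eta (V_act v xi).

Definition plane_J : 'M[K]_(4 + 4) := \matrix_i J_fun (delta_mx 0 i).

Lemma plane_JE v : v *m plane_J = (- (2 / N)) *: dual eta (V_act v xi).
Proof.
apply: (mul_rows_linear (f := J_fun)) => k u {}v.
by rewrite /J_fun V_actDl V_actZl dual_actDr dual_actZr scalerDr !scalerA mulrC.
Qed.

(** For an orthogonal pair this sends v eta to v xi; it is the action on S^- of the lift of J that
    fixes the spinors orthogonal to the plane. *)
Fact plane_j_key : {f : ext K 4 -> ext K 4 | forall t, f t = (2 / N) *: V_act (dual eta t) xi}.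
Proof. by eexists. Qed.

Definition plane_j := sval plane_j_key.

Lemma plane_jE t : plane_j t = (2 / N) *: V_act (dual eta t) xi.
Proof. exact: (svalP plane_j_key). Qed.

(* A lift of a + b J to the spin group if a^2 + b^2 = 1: the rotation of the plane of xi and eta
   corresponding to (a - b i)^2 on the even part, and a + b j on the odd part. *)
Fact plane_rot_key : {f : K -> K -> ext K 4 -> ext K 4 | forall a b s, f a b s =
  even_part s
  + ((a ^+ 2 - b ^+ 2 - 1) * (form s xi / N) + 2 * a * b * (form s eta / N)) *: xi
  + ((a ^+ 2 - b ^+ 2 - 1) * (form s eta / N) - 2 * a * b * (form s xi / N)) *: eta
  + a *: odd_part s + b *: plane_j (odd_part s)}.
Proof. by eexists. Qed.

Definition plane_rot := sval plane_rot_key.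

Lemma plane_rotE a b s : plane_rot a b s =
  even_part s
  + ((a ^+ 2 - b ^+ 2 - 1) * (form s xi / N) + 2 * a * b * (form s eta / N)) *: xi
  + ((a ^+ 2 - b ^+ 2 - 1) * (form s eta / N) - 2 * a * b * (form s xi / N)) *: eta
  + a *: odd_part s + b *: plane_j (odd_part s).
Proof. exact: (svalP plane_rot_key). Qed.
End Defs.

Definition orthogonal_pair (xi eta : ext K 4) : Prop :=
  [/\ ext_even xi, ext_even eta, form xi xi != 0, form eta eta = form xi xi & form xi eta = 0].

Section Pair.
Variables xi eta : ext K 4.
Hypothesis pair_orth : orthogonal_pair xi eta.
Let N := form xi xi.
Local Notation J := (plane_J xi eta).
Local Notation j := (plane_j xi eta).

Let xi_even : ext_even xi. Proof. by case: pair_orth. Qed.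
Let eta_even : ext_even eta. Proof. by case: pair_orth. Qed.
Let N_neq0 : N != 0. Proof. by case: pair_orth. Qed.
Let form_eta : form eta eta = N. Proof. by case: pair_orth. Qed.
Let form_xe : form xi eta = 0. Proof. by case: pair_orth. Qed.
Let form_ex : form eta xi = 0. Proof. by rewrite S_formC. Qed.
Let two_neq0 : 2 != 0 :> K. Proof. by rewrite pnatr_eq0. Qed.

Lemma dual_self v : (2 / N) *: dual xi (V_act v xi) = v.
Proof. by rewrite mulrC -scalerA dual_act_self scalerA mulVf ?scale1r. Qed.
Lemma dual_self' v : (2 / N) *: dual eta (V_act v eta) = v.
Proof. by rewrite mulrC -scalerA dual_act_self scalerA form_eta mulVf ?scale1r. Qed.

Lemma act_dual_eta t : ext_odd t -> (2 / N) *: V_act (dual eta t) eta = t.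
Proof.
by move=> t_odd; rewrite mulrC -scalerA V_act_dual_self // scalerA form_eta mulVf ?scale1r.
Qed.

Lemma plane_J_eta v : V_act (v *m J) eta = - V_act v xi.
Proof.
rewrite plane_JE scaleNr V_actNl V_actZl act_dual_eta //; exact: V_act_even.
Qed.

(** Since (eta, xi) = 0, triality lets xi and eta change places in ([dual eta] t) xi at the cost of
    a sign; then [dual xi] undoes the action on xi. *)
Lemma plane_J_xi v : V_act (v *m J) xi = V_act v eta.
Proof.
rewrite plane_JE V_actZl scaleNr -scalerN.
have := dual_act_even X eta_even xi_even (V_act_even v xi_even).
rewrite form_ex scale0r => /eqP; rewrite addr_eq0 => /eqP->.
by rewrite opprK -V_actZl dual_self.
Qed.

Lemma plane_J_sqr : J *m J = - 1%:M.
Proof.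
apply/row_matrixP => i; rewrite -[J *m J]mul1mx !row_mul row1 rowE mulmxN mulmx1 mulmxA.
set v := delta_mx _ _; apply/eqP; rewrite -subr_eq0; apply/eqP/(V_act_inj (X := X) (s := eta)).
  by rewrite form_eta.
by rewrite V_actDl opprK plane_J_eta plane_J_xi addNr.
Qed.

(** Acting on xi and acting on eta are similitudes from V to S^- with the same factor N/2, and J
    compares them. *)
Lemma plane_J_orth u v : V_form (u *m J) (v *m J) = V_form u v.
Proof.
apply: (mulIf N_neq0); rewrite -[in LHS]form_eta -S_form_act_diag !plane_J_eta.
by rewrite S_formNl S_formNr opprK S_form_act_diag.
Qed.

Lemma plane_j_eta v : j (V_act v eta) = V_act v xi.
Proof. by rewrite plane_jE -V_actZl dual_self'. Qed.

Lemma plane_j_xi v : j (V_act v xi) = - V_act v eta.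
Proof.
have -> : V_act v xi = V_act (- v *m J) eta by rewrite plane_J_eta V_actNl opprK.
by rewrite plane_j_eta plane_J_xi V_actNl.
Qed.

(** The spinors s, xi and eta are pairwise orthogonal, so each exchange of two of them in a triality
    product changes the sign. Three exchanges lead from one side to the other, and the resulting
    sign is the one in the definition of J. *)
Lemma plane_j_perp v s : ext_even s -> form s xi = 0 -> form s eta = 0 ->
  j (V_act v s) = V_act (v *m J) s.
Proof.
move=> s_even sxi seta; rewrite plane_jE plane_JE.
have swap r r' (z : 'rV[K]_(4 + 4)) : form r r' = 0 -> dual r (V_act z r') = - dual r' (V_act z r).
  by move=> rr'; apply/eqP; rewrite -addr_eq0 dual_act_vec rr' scale0r.
have swap' r r' t : ext_even r -> ext_even r' -> ext_odd t -> form r r' = 0 ->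
    V_act (dual r t) r' = - V_act (dual r' t) r.
  by move=> re r'e t_odd rr'; apply/eqP; rewrite -addr_eq0 dual_act_even // rr' scale0r.
rewrite swap ?(S_formC _ eta) // V_actNl swap' //; last exact: V_act_even.
by rewrite opprK swap // scaleNr !V_actNl V_actZl scalerN.
Qed.

Lemma plane_jD s t : j (s + t) = j s + j t.
Proof. by rewrite !plane_jE dual_actDr V_actDl scalerDr. Qed.
Lemma plane_jZ k t : j (k *: t) = k *: j t.
Proof. by rewrite !plane_jE dual_actZr V_actZl !scalerA mulrC. Qed.

Lemma plane_j0 : j 0 = 0.
Proof. by rewrite -{1}(scale0r 0) plane_jZ scale0r. Qed.

Lemma plane_j_odd t : ext_odd (j t).
Proof. by rewrite plane_jE; apply/ext_oddZ/V_act_even. Qed.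

Lemma plane_j_sqr t : ext_odd t -> j (j t) = - t.
Proof.
move=> t_odd; rewrite -{1 2}(act_dual_eta t_odd) -V_actZl plane_j_eta plane_j_xi.
by rewrite V_actZl act_dual_eta.
Qed.

Lemma plane_j_isom s t : ext_odd s -> ext_odd t -> form (j s) (j t) = form s t.
Proof.
move=> s_odd t_odd; rewrite -{1}(act_dual_eta s_odd) -{1}(act_dual_eta t_odd) -!V_actZl !plane_j_eta.
rewrite -{2}(act_dual_eta s_odd) -{2}(act_dual_eta t_odd) -!V_actZl.
by apply: (mulfI two_neq0); rewrite !S_form_act_diag form_eta.
Qed.

Lemma plane_j_skew s t : ext_odd s -> ext_odd t -> form (j s) t = - form s (j t).
Proof.
move=> s_odd t_odd; rewrite -[X in form _ X]opprK -(plane_j_sqr t_odd) S_formNr.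
by rewrite plane_j_isom //; apply: plane_j_odd.
Qed.

Section Rotation.
Variables a b : K.
Local Notation rot := (plane_rot xi eta).
Local Notation g := (a%:M + b *: J).

Lemma plane_rot_linear k s t : rot a b (k *: s + t) = k *: rot a b s + rot a b t.
Proof.
rewrite !plane_rotE even_part_linear odd_part_linear !S_formDl !S_formZl plane_jD plane_jZ.
apply/ffunP => I; rewrite !(ext_addE, ext_scaleE).
by move: (even_part s I : K) (even_part t I : K) (odd_part s I : K) (odd_part t I : K)
  (j (odd_part s) I : K) (j (odd_part t) I : K) (xi I : K) (eta I : K) => *; ring.
Qed.

Lemma plane_rot0 : rot a b 0 = 0.
Proof.
apply: (addrI (rot a b 0)); rewrite -{1}[rot a b 0]scale1r -plane_rot_linear.
by rewrite scale1r !addr0.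
Qed.
Lemma plane_rotZ k s : rot a b (k *: s) = k *: rot a b s.
Proof. by rewrite -[k *: s]addr0 plane_rot_linear plane_rot0 addr0. Qed.
Lemma plane_rotD s t : rot a b (s + t) = rot a b s + rot a b t.
Proof. by rewrite -[s]scale1r plane_rot_linear !scale1r. Qed.

Lemma plane_rot_xi : rot a b xi = (a ^+ 2 - b ^+ 2) *: xi + (- (2 * a * b)) *: eta.
Proof.
rewrite plane_rotE even_part_id // odd_part_even // form_xe -/N divff // mul0r.
rewrite plane_j0 !scaler0 !addr0 !mulr0 addr0 sub0r !mulr1.
apply/ffunP => I; rewrite !(ext_addE, ext_scaleE, ext_oppE).
by move: (xi I : K) (eta I : K) => *; ring.
Qed.

Lemma plane_rot_eta : rot a b eta = (2 * a * b) *: xi + (a ^+ 2 - b ^+ 2) *: eta.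
Proof.
rewrite plane_rotE even_part_id // odd_part_even // form_ex form_eta -/N divff // mul0r.
rewrite plane_j0 !scaler0 !addr0 !mulr0 subr0 add0r !mulr1.
apply/ffunP => I; rewrite !(ext_addE, ext_scaleE).
by move: (xi I : K) (eta I : K) => *; ring.
Qed.

Lemma plane_rot_perp s : ext_even s -> form s xi = 0 -> form s eta = 0 -> rot a b s = s.
Proof.
move=> s_even sxi seta; rewrite plane_rotE even_part_id // odd_part_even // sxi seta.
by rewrite plane_j0 !(scaler0, mul0r, mulr0, subr0, addr0, scale0r).
Qed.

Lemma plane_rot_odd t : ext_odd t -> rot a b t = a *: t + b *: j t.
Proof.
move=> t_odd; rewrite plane_rotE even_part_odd // odd_part_id //.
rewrite (S_formC _ t xi) (S_formC _ t eta) (S_form_even_odd X xi_even t_odd).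
by rewrite (S_form_even_odd X eta_even t_odd) !(mul0r, mulr0, subr0, addr0, scale0r, add0r).
Qed.

Lemma plane_rot_even_parity s : ext_even s -> ext_even (rot a b s).
Proof.
move=> s_even; rewrite plane_rotE odd_part_even // plane_j0 !scaler0 !addr0.
by do 2?apply: ext_evenD; first exact: even_part_even; exact: ext_evenZ.
Qed.

Lemma plane_rot_odd_parity t : ext_odd t -> ext_odd (rot a b t).
Proof.
move=> t_odd; rewrite plane_rot_odd //; apply: ext_oddD; apply: ext_oddZ => //.
exact: plane_j_odd.
Qed.

End Rotation.

(** As N is nonzero, S^+ splits into the plane of xi and eta and its orthogonal complement; a linear
    identity is checked on these pieces and on S^-. *)
Lemma plane_ind (P : ext K 4 -> Prop) :
  (forall k s t, P s -> P t -> P (k *: s + t)) -> P xi -> P eta ->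
  (forall s, ext_even s -> form s xi = 0 -> form s eta = 0 -> P s) ->
  (forall t, ext_odd t -> P t) -> forall s, P s.
Proof.
move=> PD Pxi Peta Pperp; apply: ext_parts => [s t Ps Pt|s s_even].
  by rewrite -[s]scale1r; apply: PD.
have [x [y [s0 [s0_even s0xi s0eta ->]]]] : exists x y s0,
    [/\ ext_even s0, form s0 xi = 0, form s0 eta = 0 & s = x *: xi + (y *: eta + s0)].
  exists (form s xi / N), (form s eta / N),
    (s + (- (form s xi / N)) *: xi + (- (form s eta / N)) *: eta); split.
  - by do 2?apply: ext_evenD => //; apply: ext_evenZ.
  - by rewrite !S_formDl !S_formZl form_ex -/N mulr0 addr0 mulNr divfK // subrr.
  - by rewrite !S_formDl !S_formZl form_xe form_eta mulr0 addr0 mulNr divfK // subrr.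
  by rewrite !scaleNr addrCA addrAC [X in _ + X]addrC subrK addrC subrK.
by apply: (PD) => //; apply: PD => //; apply: Pperp.
Qed.

Section Unit.
Variables a b : K.
Hypothesis ab1 : a ^+ 2 + b ^+ 2 = 1.
Local Notation rot := (plane_rot xi eta).

Lemma plane_rotK s : rot a (- b) (rot a b s) = s.
Proof.
have ab1' : a ^+ 2 = 1 - b ^+ 2 by rewrite -ab1 addrK.
elim/plane_ind: s => [k s t IHs IHt||||].
- by rewrite !plane_rot_linear IHs IHt.
- rewrite plane_rot_xi plane_rotD !plane_rotZ plane_rot_xi plane_rot_eta.
  apply/ffunP => I; rewrite !(ext_addE, ext_scaleE).
  by move: (xi I : K) (eta I : K) => x y; ring: ab1'.
- rewrite plane_rot_eta plane_rotD !plane_rotZ plane_rot_xi plane_rot_eta.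
  apply/ffunP => I; rewrite !(ext_addE, ext_scaleE).
  by move: (xi I : K) (eta I : K) => x y; ring: ab1'.
- by move=> s s_even sxi seta; rewrite !plane_rot_perp.
- move=> t t_odd; rewrite (plane_rot_odd a b t_odd) plane_rotD (plane_rotZ _ _ a) (plane_rotZ _ _ b).
  rewrite (plane_rot_odd _ _ t_odd) (plane_rot_odd _ _ (plane_j_odd t)).
  rewrite plane_j_sqr //.
  apply/ffunP => I; rewrite !(ext_addE, ext_scaleE, ext_oppE).
  by move: (t I : K) (j t I : K) => x y; ring: ab1'.
Qed.

Lemma plane_rot_isom s t : form (rot a b s) (rot a b t) = form s t.
Proof.
have ab1' : a ^+ 2 = 1 - b ^+ 2 by rewrite -ab1 addrK.
have even_rot := plane_rot_even_parity a b.
have odd_rot := plane_rot_odd_parity a b.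
elim/plane_ind: s t => [k s r IHs IHr t|t|t|s s_even sxi seta t|s s_odd].
- by rewrite !plane_rot_linear !S_formDl !S_formZl IHs IHr.
- elim/plane_ind: t => [k s r IHs IHr|||s s_even sxi seta|t t_odd].
  + by rewrite !plane_rot_linear !S_formDr !S_formZr IHs IHr.
  + rewrite plane_rot_xi !(S_formDl, S_formDr, S_formZl, S_formZr) form_ex form_xe form_eta -/N.
    by ring: ab1'.
  + rewrite plane_rot_xi plane_rot_eta !(S_formDl, S_formDr, S_formZl, S_formZr).
    rewrite form_ex form_xe form_eta -/N.
    by ring.
  + rewrite plane_rot_xi plane_rot_perp // !(S_formDl, S_formZl) !(S_formC _ _ s) sxi seta.
    by ring.
  + by rewrite !S_form_even_odd //; first [apply: odd_rot | apply: even_rot].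
- elim/plane_ind: t => [k s r IHs IHr|||s s_even sxi seta|t t_odd].
  + by rewrite !plane_rot_linear !S_formDr !S_formZr IHs IHr.
  + rewrite plane_rot_xi plane_rot_eta !(S_formDl, S_formDr, S_formZl, S_formZr).
    rewrite form_ex form_xe form_eta -/N.
    by ring.
  + rewrite plane_rot_eta !(S_formDl, S_formDr, S_formZl, S_formZr) form_ex form_xe form_eta -/N.
    by ring: ab1'.
  + rewrite plane_rot_eta plane_rot_perp // !(S_formDl, S_formZl) !(S_formC _ _ s) sxi seta.
    by ring.
  + by rewrite !S_form_even_odd //; first [apply: odd_rot | apply: even_rot].
- rewrite (plane_rot_perp _ _ s_even) //; elim/plane_ind: t => [k r t IHs IHr|||r r_even rxi reta|t t_odd].
  + by rewrite !plane_rot_linear !S_formDr !S_formZr IHs IHr.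
  + by rewrite plane_rot_xi !(S_formDr, S_formZr) sxi seta; ring.
  + by rewrite plane_rot_eta !(S_formDr, S_formZr) sxi seta; ring.
  + by rewrite plane_rot_perp.
  + by rewrite !S_form_even_odd //; apply: odd_rot.
- apply: ext_parts => [r t IHr IHt|r r_even|t t_odd].
  + by rewrite plane_rotD !S_formDr IHr IHt.
  + by rewrite S_formC (S_formC _ s) !S_form_even_odd //; first [apply: odd_rot | apply: even_rot].
  + rewrite !plane_rot_odd // !(S_formDl, S_formDr, S_formZl, S_formZr).
    rewrite plane_j_isom // plane_j_skew //.
    by ring: ab1'.
Qed.

Lemma plane_rot_act_even v s : ext_even s ->
  rot a b (V_act v s) = V_act (v *m (a%:M + b *: J)) (rot a b s).
Proof.
have ab1' : a ^+ 2 = 1 - b ^+ 2 by rewrite -ab1 addrK.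
(* Written with the even part of s, the claim is linear in an arbitrary spinor, as [plane_ind]
   requires. *)
move=> s_even; rewrite -(even_part_id s_even) mulmxDr mul_mx_scalar -scalemxAr.
elim/plane_ind: {s_even} s => [k s t IHs IHt|||s s_even sxi seta|t t_odd].
- rewrite even_part_linear V_actD V_actZ !plane_rot_linear IHs IHt.
  by rewrite V_actD V_actZ.
- rewrite even_part_id // plane_rot_odd; last exact: V_act_even.
  rewrite plane_j_xi plane_rot_xi V_actDl !V_actZl !V_actD !V_actZ plane_J_xi plane_J_eta.
  apply/ffunP => I; rewrite !(ext_addE, ext_scaleE, ext_oppE).
  by move: (V_act v xi I : K) (V_act v eta I : K) => x y; ring: ab1'.
- rewrite even_part_id // plane_rot_odd; last exact: V_act_even.
  rewrite plane_j_eta plane_rot_eta V_actDl !V_actZl !V_actD !V_actZ plane_J_xi plane_J_eta.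
  apply/ffunP => I; rewrite !(ext_addE, ext_scaleE, ext_oppE).
  by move: (V_act v xi I : K) (V_act v eta I : K) => x y; ring: ab1'.
- rewrite even_part_id // plane_rot_odd; last exact: V_act_even.
  by rewrite plane_j_perp // plane_rot_perp // V_actDl !V_actZl.
- by rewrite even_part_odd // V_act0 !plane_rot0 V_act0.
Qed.

End Unit.

(** The odd case is dual to the even one: both sides are paired with an even spinor, itself a
    rotated one, and v is moved across by self-adjointness. *)
Lemma plane_rot_act a b (ab1 : a ^+ 2 + b ^+ 2 = 1) v s :
  plane_rot xi eta a b (V_act v s) = V_act (v *m (a%:M + b *: J)) (plane_rot xi eta a b s).
Proof.
have ab1' : a ^+ 2 + (- b) ^+ 2 = 1 by rewrite sqrrN.
elim/ext_parts: s => [s t IHs IHt|s s_even|t t_odd].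
- by rewrite V_actD (plane_rotD _ _ (V_act v s)) (plane_rotD _ _ s) IHs IHt V_actD.
- exact: plane_rot_act_even.
apply/eqP; rewrite -subr_eq0; apply/eqP/(S_form_nondeg (X := X)) => r.
rewrite S_formDl S_formNl; apply/eqP; rewrite subr_eq0; apply/eqP.
elim/ext_parts: r => [r r' IHr IHr'|r r_even|r r_odd]; first by rewrite !S_formDr IHr IHr'.
  set r' := plane_rot xi eta a (- b) r.
  have rE : r = plane_rot xi eta a b r' by rewrite -[in RHS](opprK b) plane_rotK.
  have r'_even : ext_even r' by apply: plane_rot_even_parity.
  rewrite {1}rE (plane_rot_isom ab1) !S_form_adj.
  have vgE : V_act (v *m (a%:M + b *: J)) r = plane_rot xi eta a b (V_act v r').
    by rewrite plane_rot_act_even // -rE.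
  by rewrite vgE (plane_rot_isom ab1).
rewrite !S_form_even_odd //; first exact/V_act_odd/plane_rot_odd_parity.
exact/plane_rot_even_parity/V_act_odd.
Qed.

End Pair.
End PlaneStructure.

(** * The invariant tensor of a spinor *)

Section FormMatrix.
Variables (K : comNzRingType).
Implicit Types (v u : 'rV[K]_(4 + 4)).

Definition form_mx : 'M[K]_(4 + 4) := block_mx 0 1%:M 1%:M 0.

Lemma form_mx_sqr : form_mx *m form_mx = 1%:M.
Proof.
rewrite /form_mx mulmx_block !mulmx0 !mul0mx !mulmx1 !addr0 !add0r.
by rewrite -scalar_mx_block.
Qed.

Lemma mul_form_mx v : v *m form_mx = row_mx (rsubmx v) (lsubmx v).
Proof.
by rewrite -{1}(hsubmxK v) mul_row_block !mulmx0 !mulmx1 addr0 add0r.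
Qed.

Lemma mul_form_mx_l (a : 'rV[K]_4) : row_mx a 0 *m form_mx = row_mx 0 a.
Proof. by rewrite mul_form_mx row_mxKl row_mxKr. Qed.
Lemma mul_form_mx_r (a : 'rV[K]_4) : row_mx 0 a *m form_mx = row_mx a 0.
Proof. by rewrite mul_form_mx row_mxKl row_mxKr. Qed.

Lemma V_form_mx u v : V_form u v = (u *m form_mx *m v^T) 0 0.
Proof.
rewrite mul_form_mx -{2}(hsubmxK v) tr_row_mx mul_row_col !mxE /V_form addrC.
by congr (_ + _); apply: eq_bigr => i _; rewrite !mxE // mulrC.
Qed.

Definition V_isometry (g : 'M[K]_(4 + 4)) : Prop :=
  forall u v, V_form (u *m g) (v *m g) = V_form u v.

(** An isometry satisfies g B g^T = B for the Gram matrix B. The transposed identity, which says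
    that g preserves the sum of the b_k (x) b^k, follows from B^2 = 1 and from one-sided inverses
    being two-sided. *)
Lemma V_isometry_tr g : V_isometry g -> g^T *m form_mx *m g = form_mx.
Proof.
move=> g_isom; have E : g *m form_mx *m g^T = form_mx.
  apply/matrixP => i j; have := g_isom (delta_mx 0 i) (delta_mx 0 j).
  rewrite !V_form_mx trmx_mul mulmxA -!(mulmxA (delta_mx 0 i)).
  by rewrite -!rowE trmx_delta -!colE !mxE.
have : g *m (form_mx *m g^T *m form_mx) = 1%:M by rewrite !mulmxA E form_mx_sqr.
by move/mulmx1C/(congr1 (mulmx form_mx)); rewrite mulmx1 !mulmxA form_mx_sqr mul1mx.
Qed.

End FormMatrix.
Arguments form_mx {K}.

Section InvariantTensor.
Variables (R : realType) (X : abelian_surface R) (K : numDomainType).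
Implicit Types (s t r : ext K 4) (v u : 'rV[K]_(4 + 4)).

(* The sum over k_1, ..., k_n of (b^(k_n) ... b^(k_1) s, t) b_(k_1) /\ ... /\ b_(k_n),
   where b_k is the standard basis of V and b^k is the dual basis with respect to V_form. *)
Fixpoint spinor_tensor n s t : ext K (4 + 4) :=
  if n is n'.+1 then
    \sum_k wedge (basis_vec K k) (spinor_tensor n' (V_act (row k form_mx) s) t)
  else S_form X s t *: ext_one.

Lemma spinor_tensor_linear n k s r t :
  spinor_tensor n (k *: s + r) t = k *: spinor_tensor n s t + spinor_tensor n r t.
Proof.
elim: n s r => [|n IHn] s r /=; first by rewrite S_formDl S_formZl scalerDl scalerA.
rewrite scaler_sumr -big_split; apply: eq_bigr => l _ /=.
by rewrite V_act_linear IHn wedgeDr wedgeZr.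
Qed.

Lemma spinor_tensor0 n t : spinor_tensor n 0 t = 0.
Proof.
apply: (addrI (spinor_tensor n 0 t)); rewrite -{1}[spinor_tensor n 0 t]scale1r.
by rewrite -spinor_tensor_linear scale1r !addr0.
Qed.

(** Each stage of the recursion contracts with the sum of the b_k (x) b^k, which an isometry
    preserves, while T carries the action of v to that of v g. *)
Lemma spinor_tensor_map n (g : 'M[K]_(4 + 4)) (T : ext K 4 -> ext K 4) s t :
  V_isometry g -> (forall v r, T (V_act v r) = V_act (v *m g) (T r)) ->
  (forall r r', S_form X (T r) (T r') = S_form X r r') ->
  ext_map g (spinor_tensor n s t) = spinor_tensor n (T s) (T t).
Proof.
move=> g_isom T_act T_isom; elim: n s => [|n IHn] s /=.
  by rewrite ext_mapZ ext_map_one T_isom.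
rewrite ext_map_sum.
transitivity (\sum_k wedge (basis_vec K k *m g)
    (spinor_tensor n (V_act (row k form_mx *m g) (T s)) (T t))).
  apply: eq_bigr => k _; rewrite ext_map_wedge IHn T_act //.
pose f v := spinor_tensor n (V_act v (T s)) (T t).
have f_lin k u v : f (k *: u + v) = k *: f u + f v.
  by rewrite /f V_actDl V_actZl spinor_tensor_linear.
have f0 : f 0 = 0 by rewrite /f V_act0l spinor_tensor0.
rewrite -[LHS]/(\sum_k wedge (basis_vec K k *m g) (f (row k form_mx *m g))).
transitivity (\sum_l wedge (basis_vec K l) (\sum_k g k l *: f (row k form_mx *m g))).
  under eq_bigr => k _ do rewrite [basis_vec K k *m g]row_basis wedge_suml.
  rewrite exchange_big; apply: eq_bigr => l _ /=; rewrite wedge_sumr; apply: eq_bigr => k _.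
  by rewrite -rowE mxE wedgeZl wedgeZr.
apply: eq_bigr => l _; congr wedge.
rewrite -[RHS]/(f (row l form_mx)) -[X in _ = f (row l X)](V_isometry_tr g_isom).
rewrite !row_mul [row l _ *m _]mulmx_sum_row.
rewrite mulmx_suml; elim/big_rec2: _ => [|k y z _ ->]; first by rewrite f0.
by rewrite -scalemxAl f_lin !mxE.
Qed.

End InvariantTensor.

(** * Coordinates of c_w *)

Section ExteriorProduct.
Variables (K : comNzRingType) (m : nat).
Implicit Types (a : 'rV[K]_m) (s t : ext K m) (I J L : {set 'I_m}).

Lemma ext_mulE s t L : ext_mul s t L =
  \sum_(I in powerset L) (-1) ^+ inversions I (L :\: I) * (s I * t (L :\: I)).
Proof. by rewrite ffunE. Qed.

Lemma ext_mul_linear k s r t : ext_mul (k *: s + r) t = k *: ext_mul s t + ext_mul r t.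
Proof.
apply/ffunP => L; rewrite ext_addE ext_scaleE !ext_mulE mulr_sumr -big_split.
apply: eq_bigr => I _ /=; rewrite ext_addE ext_scaleE.
by move: (s I : K) (r I : K) (t _ : K) => x y z; ring.
Qed.

Lemma ext_mul0 t : ext_mul 0 t = 0.
Proof.
by apply/ffunP => L; rewrite ext_mulE ext_zeroE big1 // => I _; rewrite ext_zeroE mul0r mulr0.
Qed.

Lemma ext_mul_suml (T : Type) (r : seq T) (P : pred T) (F : T -> ext K m) t :
  ext_mul (\sum_(x <- r | P x) F x) t = \sum_(x <- r | P x) ext_mul (F x) t.
Proof.
apply: (big_morph (fun s => ext_mul s t)) => [s s'|]; last exact: ext_mul0.
by rewrite -[s]scale1r ext_mul_linear !scale1r.
Qed.

Lemma ext_mul1 t : ext_mul ext_one t = t.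
Proof.
apply/ffunP => L; rewrite ext_mulE (bigD1 finset.set0) ?powersetE ?finset.sub0set //= big1 => [|I].
  by rewrite /inversions big_set0 finset.setD0 /ext_one ext_monoE eqxx !mul1r addr0.
by case/andP=> _ /negPf I0; rewrite /ext_one ext_monoE I0 mul0r mulr0.
Qed.

(** The one case of associativity that is needed: it turns multiplication by alpha into iterated
    wedges. *)
Lemma ext_mul_wedge a s t : ext_mul (wedge a s) t = wedge a (ext_mul s t).
Proof.
rewrite (row_basis a) !wedge_suml ext_mul_suml; apply: eq_bigr => i _.
rewrite !wedgeZl -[_ *: wedge _ _]addr0 ext_mul_linear ext_mul0 addr0; congr (_ *: _).
apply/ffunP => L; rewrite wedge_basisE !ext_mulE.
under eq_bigr => I _ do rewrite wedge_basisE.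
have [iL|iL] := boolP (i \in L); last first.
  rewrite mul0r big1 // => I; rewrite powersetE => /subsetP IL.
  by rewrite (contraNF (IL i)) // !mul0r mulr0.
rewrite mul1r mulr_sumr (bigID (fun I : {set 'I_m} => i \in I)) /= [X in _ + X]big1 ?addr0; last first.
  by move=> I /andP[_ /negPf->]; rewrite !mul0r mulr0.
rewrite (reindex_onto (fun I => i |: I) (fun I => I :\ i)) /=; last first.
  by move=> I /andP[_ iI]; rewrite finset.setD1K.
apply: eq_big => [I|I]; rewrite !powersetE finset.setU11 ?andbT.
  rewrite finset.subUset finset.sub1set iL finset.subsetD1 /=; congr (_ && _).
  apply/eqP/idP => [<-|iI]; first by rewrite !inE eqxx.
  by rewrite finset.setU1K.
case/andP=> /fintype.subsetP IL /eqP IE; have iI : i \notin I by rewrite -IE !inE eqxx.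
have LI : L :\: (i |: I) = L :\ i :\: I by rewrite finset.setDDl.
rewrite mul1r IE LI; set M := _ :\: I.
rewrite /inversions big_setU1 //= exprD -/(inversions I M) -/(ext_sign K i M).
rewrite ext_sign_U1.
(* Apart from i itself, L is the disjoint union of I and M. *)
have -> : ext_sign K i L = ext_sign K i I * ext_sign K i M.
  rewrite -exprD -cardsUI -[LHS]mulr1 -[1]/((-1) ^+ 0 : K) -exprD; congr (_ ^+ _).
  congr (#|pred_of_set _| + _)%N; last first.
    by symmetry; apply: eq_card0 => j; rewrite !inE; case: (j \in I); rewrite ?andbF.
  apply/finset.setP => j; rewrite /M !inE; case: (eqVneq j i) => [->|ji] /=.
    by rewrite ltnn !andbF.
  have := IL j; rewrite !inE (negPf ji) /=; case: (j \in I) => [/(_ isT) ->|_] //=.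
  by rewrite orbF.
move: (ext_sign K i I) (ext_sign K i M) (s I : K) (t M : K) => x y z w; ring.
Qed.

End ExteriorProduct.

Definition set8 (A B : {set 'I_4}) : {set 'I_(4 + 4)} :=
  [set k | match split k with inl i => i \in A | inr i => i \in B end].

Lemma split_lshift m n (i : 'I_m) : split (lshift n i) = inl i.
Proof. exact: (unsplitK (inl i)). Qed.
Lemma split_rshift m n (i : 'I_n) : split (rshift m i) = inr i.
Proof. exact: (unsplitK (inr i)). Qed.

Lemma in_set8l A B i : (lshift 4 i \in set8 A B) = (i \in A).
Proof. by rewrite inE split_lshift. Qed.
Lemma in_set8r A B i : (rshift 4 i \in set8 A B) = (i \in B).
Proof. by rewrite inE split_rshift. Qed.

Lemma ord8P (P : 'I_(4 + 4) -> Prop) :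
  (forall i, P (lshift 4 i)) -> (forall i, P (rshift 4 i)) -> forall k, P k.
Proof. by move=> Pl Pr k; rewrite -(splitK k); case: split. Qed.

Lemma set8P (L L' : {set 'I_(4 + 4)}) : (forall i, (lshift 4 i \in L) = (lshift 4 i \in L')) ->
  (forall i, (rshift 4 i \in L) = (rshift 4 i \in L')) -> L = L'.
Proof. by move=> El Er; apply/finset.setP; apply: ord8P. Qed.

Lemma set8E (L : {set 'I_(4 + 4)}) : L = set8 [set i | lshift 4 i \in L] [set i | rshift 4 i \in L].
Proof. by apply: set8P => i; rewrite ?in_set8l ?in_set8r inE. Qed.

Lemma set8_inj A B A' B' : (set8 A B == set8 A' B') = (A == A') && (B == B').
Proof.
apply/eqP/andP => [/finset.setP E|[/eqP-> /eqP->]] //; split; apply/eqP/finset.setP => i.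
  by rewrite -(in_set8l A B) E in_set8l.
by rewrite -(in_set8r A B) E in_set8r.
Qed.

Lemma card_set8 (A B : {set 'I_4}) : #|set8 A B| = (#|A| + #|B|)%N.
Proof.
rewrite -!sum1_card big_mkcond big_split_ord /= [in RHS]big_mkcond [X in _ = (_ + X)%N]big_mkcond.
by congr (_ + _)%N; apply: eq_bigr => i _; rewrite ?in_set8l ?in_set8r.
Qed.

Lemma set8_D1l A B i : set8 A B :\ lshift 4 i = set8 (A :\ i) B.
Proof.
apply: set8P => j; rewrite ?(in_set8l, in_set8r, inE) ?split_lshift ?split_rshift.
  by rewrite (inj_eq (@lshift_inj _ _)).
by rewrite eq_rlshift.
Qed.
Lemma set8_D1r A B i : set8 A B :\ rshift 4 i = set8 A (B :\ i).
Proof.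
apply: set8P => j; rewrite ?(in_set8l, in_set8r, inE) ?split_lshift ?split_rshift.
  by rewrite eq_lrshift.
by rewrite (inj_eq (@rshift_inj _ _)).
Qed.
Lemma set8_U1l A B i : lshift 4 i |: set8 A B = set8 (i |: A) B.
Proof.
apply: set8P => j; rewrite ?(in_set8l, in_set8r, inE) ?split_lshift ?split_rshift.
  by rewrite (inj_eq (@lshift_inj _ _)).
by rewrite eq_rlshift.
Qed.
Lemma set8_U1r A B i : rshift 4 i |: set8 A B = set8 A (i |: B).
Proof.
apply: set8P => j; rewrite ?(in_set8l, in_set8r, inE) ?split_lshift ?split_rshift.
  by rewrite eq_lrshift.
by rewrite (inj_eq (@rshift_inj _ _)).
Qed.

Section Signs.
Variable K : comNzRingType.
Implicit Types (s : ext K (4 + 4)) (A B : {set 'I_4}).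

Lemma ext_sign8l A B i : ext_sign K (lshift 4 i) (set8 A B) = ext_sign K i A.
Proof.
rewrite /ext_sign; congr (_ ^+ _).
rewrite (_ : [set j in _ | _] = set8 [set j in A | (j < i)%N] finset.set0) ?card_set8 ?cards0 ?addn0 //.
apply: set8P => j; rewrite ?in_set8l ?in_set8r !inE ?split_lshift ?split_rshift //=.
by rewrite ltnNge (leq_trans (ltnW (ltn_ord i))) ?leq_addr // andbF.
Qed.

(** All indices of H^1 precede those of its dual, hence the factor (-1)^|A|. *)
Lemma ext_sign8r A B i : ext_sign K (rshift 4 i) (set8 A B) = (-1) ^+ #|A| * ext_sign K i B.
Proof.
rewrite /ext_sign -exprD; congr (_ ^+ _); rewrite -card_set8; congr #|pred_of_set _|.
apply: set8P => j; rewrite ?in_set8l ?in_set8r !inE ?split_lshift ?split_rshift /=.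
  by rewrite (leq_trans (ltn_ord j)) ?leq_addr // andbT.
by rewrite ltn_add2l.
Qed.

Lemma wedge8l a s A B : wedge (row_mx a 0) s (set8 A B) =
  \sum_(i in A) ext_sign K i A * (a 0 i * s (set8 (A :\ i) B)).
Proof.
rewrite wedgeE big_mkcond big_split_ord /= [X in _ + X]big1 ?addr0 => [|i _]; last first.
  by rewrite row_mxEr mxE mul0r mulr0 if_same.
rewrite [RHS]big_mkcond; apply: eq_bigr => i _.
by rewrite in_set8l row_mxEl set8_D1l ext_sign8l.
Qed.

Lemma wedge8r a s A B : wedge (row_mx 0 a) s (set8 A B) =
  \sum_(i in B) (-1) ^+ #|A| * ext_sign K i B * (a 0 i * s (set8 A (B :\ i))).
Proof.
rewrite wedgeE big_mkcond big_split_ord /= [X in X + _]big1 ?add0r => [|i _]; last first.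
  by rewrite row_mxEl mxE mul0r mulr0 if_same.
rewrite [RHS]big_mkcond; apply: eq_bigr => i _.
by rewrite in_set8r row_mxEr set8_D1r ext_sign8r.
Qed.

Lemma ext_one8 A B : ext_one (set8 A B) = ((A == finset.set0) && (B == finset.set0))%:R :> K.
Proof.
have E : finset.set0 = set8 finset.set0 finset.set0.
  by apply: set8P => i; rewrite ?in_set8l ?in_set8r !inE.
by rewrite /ext_one ext_monoE [X in _ == X]E set8_inj.
Qed.

Lemma ext_prod8l (vs : seq 'rV[K]_4) A B :
  ext_prod [seq row_mx v 0 | v <- vs] (set8 A B) = ext_prod vs A * (B == finset.set0)%:R.
Proof.
elim: vs A => [|v vs IHvs] A /=; first by rewrite ext_one8 /ext_one ext_monoE; do 2!case: (_ == _); rewrite ?mul1r ?mul0r.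
rewrite !wedge_def wedge8l wedgeE mulr_suml; apply: eq_bigr => i _.
by rewrite IHvs !mulrA.
Qed.

Lemma ext_prod8r (vs : seq 'rV[K]_4) A B :
  ext_prod [seq row_mx 0 v | v <- vs] (set8 A B) = ext_prod vs B * (A == finset.set0)%:R.
Proof.
elim: vs B => [|v vs IHvs] B /=; first by rewrite ext_one8 /ext_one ext_monoE; do 2!case: (_ == _); rewrite ?mul1r ?mul0r.
rewrite !wedge_def wedge8r wedgeE mulr_suml; apply: eq_bigr => i _.
rewrite IHvs; case: eqP => [->|]; last by rewrite !mulr0.
by rewrite cards0 mul1r !mulrA.
Qed.

End Signs.

Section Degree.
Variables (K : comNzRingType) (m : nat).

Lemma ext_deg_prod (vs : seq 'rV[K]_m) : ext_deg (size vs) (ext_prod vs).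
Proof.
elim: vs => [|v vs IHvs] L /= sL.
  by rewrite /ext_one ext_monoE -cards_eq0 (negPf sL).
rewrite wedge_def wedgeE big1 // => i iL; rewrite IHvs ?mulr0 //.
by move: sL; rewrite (cardsD1 i L) iL eqSS.
Qed.

End Degree.

Lemma set4T : set4 true true true true = [set: 'I_4].
Proof. by apply/finset.setP; apply: ord4P; rewrite !(inE, in_set4). Qed.
Lemma set4_0 : set4 false false false false = finset.set0.
Proof. by apply/finset.setP; apply: ord4P; rewrite !(inE, in_set4). Qed.
Lemma set4_D1 b0 b1 b2 b3 : (set4 b0 b1 b2 b3 :\ i0 = set4 false b1 b2 b3) *
  (set4 b0 b1 b2 b3 :\ i1 = set4 b0 false b2 b3) * (set4 b0 b1 b2 b3 :\ i2 = set4 b0 b1 false b3) *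
  (set4 b0 b1 b2 b3 :\ i3 = set4 b0 b1 b2 false).
Proof. by do !split; apply/finset.setP; apply: ord4P; rewrite !(inE, in_set4). Qed.
Lemma enum_ord4 : enum 'I_4 = [:: i0; i1; i2; i3].
Proof. by apply: (inj_map val_inj); rewrite val_enum_ord. Qed.

Section Determinant.
Variables (K : numDomainType).
Implicit Types (a : 'rV[K]_4) (s : ext K 4) (g h : 'M[K]_4).

Lemma wedge4 a s b0 b1 b2 b3 : wedge a s (set4 b0 b1 b2 b3) =
    b0%:R * (a 0 i0 * s (set4 false b1 b2 b3))
    + b1%:R * ((-1) ^+ b0 * (a 0 i1 * s (set4 b0 false b2 b3)))
    + b2%:R * ((-1) ^+ (b0 + b1) * (a 0 i2 * s (set4 b0 b1 false b3)))
    + b3%:R * ((-1) ^+ (b0 + b1 + b2) * (a 0 i3 * s (set4 b0 b1 b2 false))).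
Proof.
rewrite -V_act_l V_act4 /V_coord row_mxKl row_mxKr ![(0 : 'rV[K]_4) _ _]mxE.
by case: b0 b1 b2 b3 => [] [] [] [] /=; ring.
Qed.

(** The determinant of g, in the form in which [oriented_basis] contains it. *)
Definition top_scale g : K := ext_prod [seq row i g | i <- enum 'I_4] [set: 'I_4].

Lemma top_scaleE g : ext_map g (ext_mono [set: 'I_4]) = top_scale g *: ext_mono [set: 'I_4].
Proof.
rewrite ext_map_mono; have -> : enum [set: 'I_4] = enum 'I_4 by apply: eq_enum => i; rewrite inE.
apply/ffunP => I; rewrite ext_scaleE ext_monoE; case: eqP => [->|IT]; first by rewrite mulr1.
rewrite mulr0 ext_deg_prod // size_map size_enum_ord.
by apply/eqP => I4; apply: IT; apply/eqP; rewrite eqEcard finset.subsetT cardsT card_ord I4.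
Qed.

Lemma top_scale1 : top_scale 1%:M = 1.
Proof.
have /ffunP/(_ [set: 'I_4]) := top_scaleE 1%:M.
by rewrite ext_map1 ext_scaleE ext_monoE eqxx mulr1.
Qed.

Lemma top_scaleM g h : top_scale (g *m h) = top_scale g * top_scale h.
Proof.
have /ffunP/(_ [set: 'I_4]) := top_scaleE (g *m h).
by rewrite ext_mapM top_scaleE ext_mapZ top_scaleE !ext_scaleE ext_monoE eqxx !mulr1.
Qed.

Lemma top_scale_tr g : top_scale g^T = top_scale g.
Proof.
rewrite /top_scale enum_ord4 /= !wedge_def -set4T.
repeat (rewrite wedge4 /= ?mul0r ?add0r ?addr0 ?mul1r).
rewrite /ext_one ext_monoE -set4_0 eqxx !mxE.
ring.
Qed.

End Determinant.

Section Coordinates.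
Variables (R : realType) (X : abelian_surface R) (n : nat) (e : 'M[int]_4).
Hypothesis e_basis : oriented_basis X e.
Local Notation o := (orientation X).
Local Notation N := (n.+1%:R : int).

Lemma top_scale_basis : top_scale e = o.
Proof.
case: e_basis => _; rewrite /int_X -/(top_scale e) intz => oe.
by rewrite -[LHS]mul1r -(orientation_sqr X) -mulrA oe mulr1.
Qed.

Lemma top_scale_dual_basis : top_scale (invmx e)^T = o.
Proof.
rewrite top_scale_tr; have e_unit : e \in unitmx by case: e_basis.
have := top_scaleM e (invmx e); rewrite mulmxV // top_scale1 top_scale_basis => E.
by rewrite -[LHS]mul1r -(orientation_sqr X) -mulrA -E mulr1.
Qed.

Lemma beta_coord A B : beta e (set8 A B) = o * ((A == [set: 'I_4]) && (B == finset.set0))%:R.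
Proof.
have -> : beta e = ext_prod [seq row_mx v 0 | v <- [seq row i e | i <- enum 'I_4]].
  by rewrite -map_comp; congr ext_prod; apply: eq_map => i.
rewrite ext_prod8l; case: (A =P [set: 'I_4]) => [->|AT] /=.
  by rewrite -/(top_scale e) top_scale_basis.
rewrite mulr0 ext_deg_prod ?mul0r // size_map size_enum_ord.
by apply/eqP => A4; apply: AT; apply/eqP; rewrite eqEcard finset.subsetT cardsT card_ord A4.
Qed.

Lemma gamma_coord A B : gamma e (set8 A B) = o * ((A == finset.set0) && (B == [set: 'I_4]))%:R.
Proof.
have -> : gamma e = ext_prod [seq row_mx 0 v | v <- [seq row i (invmx e)^T | i <- enum 'I_4]].
  by rewrite -map_comp; congr ext_prod; apply: eq_map => i.
rewrite ext_prod8r; case: (B =P [set: 'I_4]) => [->|AT] /=.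
  by rewrite -/(top_scale _) top_scale_dual_basis andbT.
rewrite andbF mulr0 ext_deg_prod ?mul0r // size_map size_enum_ord.
by apply/eqP => A4; apply: AT; apply/eqP; rewrite eqEcard finset.subsetT cardsT card_ord A4.
Qed.

Definition alpha_op (s : ext int (4 + 4)) : ext int (4 + 4) :=
  \sum_k wedge (row_mx (basis_vec int k) 0) (wedge (row_mx 0 (basis_vec int k)) s).

(** Since alpha is the canonical element of the tensor product of H^1 with its dual, it is the same
    for the basis e and for the standard one. *)
Lemma alpha_mul s : ext_mul (alpha e) s = alpha_op s.
Proof.
have e_unit : e \in unitmx by case: e_basis.
rewrite /alpha ext_mul_suml /alpha_op.
under eq_bigr => i _ do rewrite /= !wedge_def !ext_mul_wedge ext_mul1.
transitivity (\sum_i \sum_k \sum_l (e i k * invmx e l i) *: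
   wedge (row_mx (basis_vec int k) 0) (wedge (row_mx 0 (basis_vec int l)) s)).
  have rowl (a : 'rV[int]_4) : row_mx a 0 = \sum_k a 0 k *: row_mx (basis_vec int k) (0 : 'rV[int]_4).
    rewrite {1}(row_basis a); elim/big_rec2: _ => [|i x y _ <-]; first by rewrite row_mx0.
    by rewrite scale_row_mx scaler0 add_row_mx addr0.
  have rowr (a : 'rV[int]_4) : row_mx 0 a = \sum_k a 0 k *: row_mx (0 : 'rV[int]_4) (basis_vec int k).
    rewrite {1}(row_basis a); elim/big_rec2: _ => [|i x y _ <-]; first by rewrite row_mx0.
    by rewrite scale_row_mx scaler0 add_row_mx addr0.
  apply: eq_bigr => i _; rewrite /V_e /V_e_dual rowl wedge_suml; apply: eq_bigr => k _.
  rewrite rowr wedge_suml wedge_sumr; apply: eq_bigr => l _.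
  by rewrite !wedgeZl wedgeZr scalerA !mxE.
rewrite exchange_big; apply: eq_bigr => k _ /=; rewrite exchange_big /= (bigD1 k) //=.
have sumE l : \sum_i (e i k * invmx e l i) = (l == k)%:R.
  have := congr1 (fun M : 'M[int]_4 => M l k) (mulVmx e_unit); rewrite !mxE => <-.
  by apply: eq_bigr => i _; rewrite mulrC.
rewrite -[X in X + _]scaler_suml sumE eqxx scale1r big1 ?addr0 // => l /negPf lk.
by rewrite -scaler_suml sumE lk scale0r.
Qed.

Lemma alpha_op8 s a0 a1 a2 a3 b0 b1 b2 b3 :
  alpha_op s (set8 (set4 a0 a1 a2 a3) (set4 b0 b1 b2 b3)) =
    (a0 && b0)%:R * ((-1) ^+ (a1 + a2 + a3) * s (set8 (set4 false a1 a2 a3) (set4 false b1 b2 b3)))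
  + (a1 && b1)%:R * ((-1) ^+ (b0 + a2 + a3) * s (set8 (set4 a0 false a2 a3) (set4 b0 false b2 b3)))
  + (a2 && b2)%:R * ((-1) ^+ (b0 + b1 + a3) * s (set8 (set4 a0 a1 false a3) (set4 b0 b1 false b3)))
  + (a3 && b3)%:R * ((-1) ^+ (b0 + b1 + b2) * s (set8 (set4 a0 a1 a2 false) (set4 b0 b1 b2 false))).
Proof.
have term k A B : wedge (row_mx (basis_vec int k) 0) (wedge (row_mx 0 (basis_vec int k)) s) (set8 A B) =
    ((k \in A) && (k \in B))%:R *
    (ext_sign int k A * (-1) ^+ #|A :\ k| * ext_sign int k B * s (set8 (A :\ k) (B :\ k))).
  have sel (C : {set 'I_4}) (F : 'I_4 -> int) :
      \sum_(i in C) F i * (basis_vec int k 0 i) = (k \in C)%:R * F k.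
    rewrite big_mkcond (bigD1 k) //= big1 => [|i /negPf ik].
      by rewrite basis_vecE eqxx mulr1 addr0; case: ifP; rewrite ?mul1r ?mul0r.
    by rewrite basis_vecE ik mulr0 if_same.
  rewrite wedge8l.
  under eq_bigr => i _ do rewrite mulrCA mulrC.
  rewrite sel wedge8r; under eq_bigr => i _ do rewrite mulrCA mulrC.
  rewrite sel; case: (k \in A); case: (k \in B); rewrite /= ?(mul0r, mulr0) //; ring.
rewrite /alpha_op ext_sumE (eq_bigr _ (fun k _ => term k _ _)) big_ord4 /ext_sign.
rewrite !set4_D1 !card_set4 !card_set_ord4 !(inE, in_set4) /= !andbT !andbF !addn0 !add0n.
rewrite !exprD !expr0 !mul1r !mulr1.
by congr (_ + _ + _ + _); congr (_ * _); case: a0 a1 a2 => [] [] [] /=; ring.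
Qed.

Lemma ext_mulr1 (K : comNzRingType) m (s : ext K m) : ext_mul s ext_one = s.
Proof.
elim/ext_ind: s => [|k s t IHs IHt|a s IHs]; first exact: ext_mul1.
  by rewrite ext_mul_linear IHs IHt.
by rewrite ext_mul_wedge IHs.
Qed.

(** Indeed alpha /\ alpha is twice the sum over i < j of e_i e_i^* e_j e_j^*, and moving e_j to the
    left of e_i^* changes the sign. *)
Lemma alpha_sqr_coord A B :
  ext_mul (alpha e) (alpha e) (set8 A B) = - 2 * ((A == B) && (#|A| == 2%N))%:R.
Proof.
rewrite -{2}[alpha e]ext_mulr1 !alpha_mul (set4E A) (set4E B).
move: (i0 \in A) (i1 \in A) (i2 \in A) (i3 \in A) (i0 \in B) (i1 \in B) (i2 \in B) (i3 \in B).
move=> a0 a1 a2 a3 b0 b1 b2 b3; rewrite !alpha_op8 !ext_one8 -set4_0 !set4_inj card_set4.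
by case: a0 a1 a2 a3 b0 b1 b2 b3 => [] [] [] [] [] [] [] [] /=; rewrite ?mul0r ?mulr0.
Qed.

Lemma c_coord A B : c_class e n (set8 A B) =
   2 * N ^+ 2 * ((A == B) && (#|A| == 2%N))%:R
   + 4 * N ^+ 3 * (o * ((A == [set: 'I_4]) && (B == finset.set0))%:R)
   + 4 * N * (o * ((A == finset.set0) && (B == [set: 'I_4]))%:R).
Proof.
rewrite /c_class !ext_addE !ext_scaleE beta_coord gamma_coord alpha_sqr_coord; ring.
Qed.

End Coordinates.

(** * Integral elements of the spin group *)

Section CliffordModule.
Variables (K : comNzRingType) (m : nat).
Local Notation Cl := (clifford (@V_form K m)).
Local Notation gen := (cl_gen (@V_form K m)).
Implicit Types (x y : Cl) (v u p r : 'rV[K]_(m + m)) (s t : ext K m).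

Definition cl_scal (k : K) : Cl := cl_pi _ (CScal _ k).

Lemma cl_genD v u : gen (v + u) = gen v + gen u.
Proof. by rewrite -cl_piD; apply/cl_piP; constructor. Qed.

Lemma cl_genZ k v : gen (k *: v) = cl_scal k * gen v.
Proof. by rewrite -cl_piM; apply/cl_piP; constructor. Qed.

Lemma cl_scalD k l : cl_scal (k + l) = cl_scal k + cl_scal l.
Proof. by rewrite -cl_piD; apply/cl_piP; constructor. Qed.

Lemma cl_scalM k l : cl_scal (k * l) = cl_scal k * cl_scal l.
Proof. by rewrite -cl_piM; apply/cl_piP; constructor. Qed.

Lemma cl_scalC k x : cl_scal k * x = x * cl_scal k.
Proof. by elim/cl_ind: x => x; rewrite -!cl_piM; apply/cl_piP; constructor. Qed.

Lemma cl_scal1 : cl_scal 1 = 1. Proof. by []. Qed.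
Lemma cl_scal0 : cl_scal 0 = 0. Proof. by []. Qed.

Lemma cl_actM x y s : cl_act (x * y) s = cl_act x (cl_act y s).
Proof. by elim/cl_ind: x => x; elim/cl_ind: y => y; rewrite -cl_piM !cl_actE. Qed.

Lemma cl_actD x y s : cl_act (x + y) s = cl_act x s + cl_act y s.
Proof. by elim/cl_ind: x => x; elim/cl_ind: y => y; rewrite -cl_piD !cl_actE. Qed.

Lemma cl_act_scal k s : cl_act (cl_scal k) s = k *: s.
Proof. by rewrite cl_actE. Qed.

Lemma cl_act1 s : cl_act 1 s = s.
Proof. by rewrite -cl_scal1 cl_act_scal scale1r. Qed.

Lemma cl_act0l s : cl_act 0 s = 0.
Proof. by rewrite -cl_scal0 cl_act_scal scale0r. Qed.

Lemma cl_actNl x s : cl_act (- x) s = - cl_act x s.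
Proof. by apply/eqP; rewrite -addr_eq0 -cl_actD addNr cl_act0l. Qed.

Lemma cl_act_gen v s : cl_act (gen v) s = V_act v s.
Proof. by rewrite cl_actE. Qed.

Lemma cl_act_linear x k s t : cl_act x (k *: s + t) = k *: cl_act x s + cl_act x t.
Proof. by elim/cl_ind: x => x; rewrite !cl_actE expr_act_linear. Qed.

Lemma cl_starD x y : cl_star (x + y) = cl_star x + cl_star y.
Proof. by elim/cl_ind: x => x; elim/cl_ind: y => y; rewrite -cl_piD !cl_starE cl_piD. Qed.

Lemma cl_starM x y : cl_star (x * y) = cl_star y * cl_star x.
Proof. by elim/cl_ind: x => x; elim/cl_ind: y => y; rewrite -cl_piM !cl_starE cl_piM. Qed.

Lemma cl_star_scal k : cl_star (cl_scal k) = cl_scal k.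
Proof. by rewrite cl_starE. Qed.

Lemma cl_star1 : cl_star 1 = 1 :> Cl.
Proof. exact: cl_star_scal. Qed.

Lemma cl_star_gen v : cl_star (gen v) = - gen v.
Proof. by rewrite cl_starE -cl_genN. Qed.

Lemma cl_even_scal k : cl_even (cl_scal k).
Proof. by exists (CScal _ k) => //; constructor. Qed.

Lemma cl_evenD x y : cl_even x -> cl_even y -> cl_even (x + y).
Proof.
by move=> [t tP ->] [u uP ->]; exists (CAdd t u); rewrite ?cl_piD //; constructor.
Qed.

Lemma cl_evenM x y : cl_even x -> cl_even y -> cl_even (x * y).
Proof.
move=> [t tP ->] [u uP ->]; exists (CMul t u); rewrite ?cl_piM //.
exact: (homog_mul tP uP).
Qed.

Lemma cl_even_gen2 v u : cl_even (gen v * gen u).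
Proof.
exists (CMul (CGen v) (CGen u)); last by rewrite cl_piM.
by apply: (homog_mul (p := true) (q := true)); constructor.
Qed.

Lemma SpinM x y g h : Spin x -> Spin y -> cl_induces x g -> cl_induces y h ->
  Spin (x * y) /\ cl_induces (x * y) (h *m g).
Proof.
move=> [x_even xx _] [y_even yy _] xg yh.
have xy : cl_induces (x * y) (h *m g).
  move=> v; rewrite cl_starM mulmxA -xg -yh !mulrA; congr (_ * _); by rewrite -!mulrA.
split=> //; split; first exact: cl_evenM.
  by rewrite cl_starM mulrA -[x * y * _]mulrA yy mulr1.
by move=> v; eexists; apply: xy.
Qed.

Lemma cl_gen_isotropic v : V_form v v = 0 -> gen v * gen v *+ 2 = 0.
Proof. by move=> vv; rewrite mulr2n cl_genM vv. Qed.

Lemma cl_gen_anticomm v u : V_form v u = 0 -> gen v * gen u = - (gen u * gen v).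
Proof. by move=> vu; apply/eqP; rewrite -addr_eq0 cl_genM vu. Qed.

End CliffordModule.

Section Eichler.
Variable (K : comNzRingType).
Local Notation Cl := (clifford (@V_form K 4)).
Local Notation gen := (cl_gen (@V_form K 4)).
Variables p r : 'rV[K]_(4 + 4).
Hypotheses (pp : V_form p p = 0) (rr : V_form r r = 0) (pr : V_form p r = 0).

(* The presentation of C(V) over K only yields 2 p^2 = 0 for p isotropic, hence the factor 2. *)
Definition eichler : Cl := 1 + gen p * gen r *+ 2.

(** The isometry is factored into two rank-one perturbations of the identity, so that
    [ext_map_rank1] computes its action on the exterior algebra of V. *)
Definition eichler_mx : 'M[K]_(4 + 4) :=
  (1%:M + (2 *: (r *m form_mx))^T *m p) *m (1%:M + (- 2 *: (p *m form_mx))^T *m r).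

Lemma mul_eichler_mx v :
  v *m eichler_mx = v + (2 * V_form r v) *: p - (2 * V_form p v) *: r.
Proof.
have E (q : 'rV[K]_(4 + 4)) u k : u *m (k *: (q *m form_mx))^T = (k * V_form q u)%:M.
  rewrite [LHS]mx11_scalar V_form_mx; congr (_%:M).
  rewrite linearZ /= -scalemxAr mxE; congr (_ * _).
  have -> : u *m (q *m form_mx)^T = (q *m form_mx *m u^T)^T by rewrite [RHS]trmx_mul trmxK.
  by rewrite [LHS]mxE.
rewrite /eichler_mx mulmxA mulmxDr mulmx1 mulmxA E mul_scalar_mx mulmxDr mulmx1 mulmxA E.
rewrite mul_scalar_mx; congr (_ + _).
by rewrite V_formDr V_formZr pp mulr0 addr0 mulNr scaleNr.
Qed.

(** With d = 2 p r one has p d = r d = 0, hence d^2 = 0, and the star of 1 + d is 1 - d, its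
    inverse. Conjugating v by 1 + d leaves only the commutator of d with v, which the Clifford
    relation evaluates. *)
Lemma eichler_spin : Spin eichler /\ cl_induces eichler eichler_mx.
Proof.
set P := gen p; set Q := gen r.
have PP : P * P *+ 2 = 0 by apply: cl_gen_isotropic.
have QQ : Q * Q *+ 2 = 0 by apply: cl_gen_isotropic.
have PQ : P * Q = - (Q * P) by apply: cl_gen_anticomm.
have starE : cl_star eichler = 1 - P * Q *+ 2.
  rewrite /eichler cl_starD cl_star1 mulr2n cl_starD !cl_starM !cl_star_gen -/P -/Q.
  by rewrite mulrNN -mulr2n; congr (_ + _); rewrite PQ mulNrn opprK.
set d := P * Q *+ 2.
have QP : Q * P = - (P * Q) by rewrite PQ opprK.
have Pd : P * d = 0 by rewrite /d mulrnAr mulrA -mulrnAl PP mul0r.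
have Qd : Q * d = 0 by rewrite /d mulrnAr mulrA QP mulNr -mulrA mulNrn -mulrnAr QQ mulr0 oppr0.
have dd : d * d = 0 by rewrite {1}/d mulrnAl -mulrA Qd mulr0 mul0rn.
have xE : eichler = 1 + d by [].
have dV v : d * gen v =
    gen v * d + (cl_scal 4 (V_form r v) * P - cl_scal 4 (V_form p v) * Q) *+ 2.
  set V := gen v; set a : Cl := cl_scal 4 (V_form r v); set b : Cl := cl_scal 4 (V_form p v).
  have QV : Q * V = a - V * Q by rewrite -[a]cl_genM addrK.
  have PV : P * V = b - V * P by rewrite -[b]cl_genM addrK.
  rewrite /d mulrnAl mulrnAr -mulrnDl; congr (_ *+ _).
  rewrite -mulrA QV mulrBr (mulrA P V) PV mulrBl opprB -(mulrA V) addrCA; congr (_ + (_ - _)).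
  by rewrite /a -cl_scalC.
rewrite -/d in starE; clearbody d.
have ind : cl_induces eichler eichler_mx.
  have gE k q : gen ((2 * k) *: q) = (cl_scal 4 k * gen q) *+ 2.
    have -> : 2 * k = k + k by rewrite mulr_natl mulr2n.
    by rewrite cl_genZ cl_scalD mulrDl mulr2n.
  move=> v; rewrite starE xE mul_eichler_mx !cl_genD cl_genN !gE.
  have dVd : d * gen v * d = 0.
    by rewrite dV mulrDl -mulrA dd mulr0 add0r mulrnAl mulrBl -!mulrA Pd Qd !mulr0 subrr mul0rn.
  rewrite mulrBr mulr1 !mulrDl !mul1r dVd addr0 dV [gen v * d + _]addrC addrA addrK.
  by rewrite mulrnBl addrA.
have xx : eichler * cl_star eichler = 1.
  by rewrite starE xE mulrBr mulr1 mulrDl mul1r dd addr0 addrK.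
split=> //; split=> //; last by move=> v; eexists; apply: ind.
by apply: cl_evenD; [exact: cl_even_scal | rewrite mulr2n; apply: cl_evenD; apply: cl_even_gen2].
Qed.

End Eichler.

Section Coordinates8.
Variable K : comNzRingType.
Implicit Types (s : ext K (4 + 4)) (A B : {set 'I_4}) (i : 'I_4).

Lemma basis_vecl i : row_mx (basis_vec K i) 0 = basis_vec K (lshift 4 i).
Proof.
apply/rowP; apply: ord8P => j; rewrite ?row_mxEl ?row_mxEr !basis_vecE ?mxE.
  by rewrite (inj_eq (@lshift_inj 4 4)).
by rewrite eq_rlshift.
Qed.

Lemma basis_vecr i : row_mx 0 (basis_vec K i) = basis_vec K (rshift 4 i).
Proof.
apply/rowP; apply: ord8P => j; rewrite ?row_mxEl ?row_mxEr !basis_vecE ?mxE.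
  by rewrite eq_lrshift.
by rewrite (inj_eq (@rshift_inj 4 4)).
Qed.

Lemma wedge_basis8l i s A B : wedge (row_mx (basis_vec K i) 0) s (set8 A B) =
  (i \in A)%:R * (ext_sign K i A * s (set8 (A :\ i) B)).
Proof. by rewrite basis_vecl wedge_basisE in_set8l ext_sign8l set8_D1l. Qed.

Lemma wedge_basis8r i s A B : wedge (row_mx 0 (basis_vec K i)) s (set8 A B) =
  (i \in B)%:R * ((-1) ^+ #|A| * ext_sign K i B * s (set8 A (B :\ i))).
Proof. by rewrite basis_vecr wedge_basisE in_set8r ext_sign8r set8_D1r. Qed.

Lemma contraction_basis8l i s A B : contraction (row_mx (basis_vec K i) 0) s (set8 A B) =
  (i \notin A)%:R * (ext_sign K i A * s (set8 (i |: A) B)).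
Proof. by rewrite basis_vecl contraction_basisE in_set8l ext_sign8l set8_U1l. Qed.

Lemma contraction_basis8r i s A B : contraction (row_mx 0 (basis_vec K i)) s (set8 A B) =
  (i \notin B)%:R * ((-1) ^+ #|A| * ext_sign K i B * s (set8 A (i |: B))).
Proof. by rewrite basis_vecr contraction_basisE in_set8r ext_sign8r set8_U1r. Qed.

Lemma contraction_Zl m k (th : 'rV[K]_m) (s : ext K m) :
  contraction (k *: th) s = k *: contraction th s.
Proof. by rewrite -!V_act_r -V_actZl scale_row_mx scaler0. Qed.

End Coordinates8.

Lemma map_form_mx (K L : comNzRingType) (f : {rmorphism K -> L}) :
  map_mx f form_mx = form_mx.
Proof. by rewrite /form_mx map_block_mx !map_mx1 !map_mx0. Qed.

Lemma map_eichler_mx (K L : comNzRingType) (f : {rmorphism K -> L}) (p r : 'rV[K]_(4 + 4)) :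
  map_mx f (eichler_mx p r) = eichler_mx (map_mx f p) (map_mx f r).
Proof.
rewrite /eichler_mx !(map_mxM, map_mxD, map_mx1).
by rewrite -!map_trmx !(map_mxZ, map_mxM) map_form_mx rmorphN rmorph_nat.
Qed.

Lemma ext_map_eichler (K : numDomainType) (p r : 'rV[K]_(4 + 4)) (s : ext K (4 + 4)) :
  let s' := s + 2 *: wedge p (contraction (r *m form_mx) s) in
  ext_map (eichler_mx p r) s = s' - 2 *: wedge r (contraction (p *m form_mx) s').
Proof.
by rewrite /= /eichler_mx ext_mapM !ext_map_rank1 !contraction_Zl !wedgeZr scaleNr.
Qed.

Lemma set4_U1 b0 b1 b2 b3 : (i0 |: set4 b0 b1 b2 b3 = set4 true b1 b2 b3) *
  (i1 |: set4 b0 b1 b2 b3 = set4 b0 true b2 b3) * (i2 |: set4 b0 b1 b2 b3 = set4 b0 b1 true b3) *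
  (i3 |: set4 b0 b1 b2 b3 = set4 b0 b1 b2 true).
Proof. by do !split; apply/finset.setP; apply: ord4P; rewrite !(inE, in_set4). Qed.

Lemma ext_sign4 (K : comNzRingType) b0 b1 b2 b3 : (ext_sign K i0 (set4 b0 b1 b2 b3) = 1) *
  (ext_sign K i1 (set4 b0 b1 b2 b3) = (-1) ^+ b0) *
  (ext_sign K i2 (set4 b0 b1 b2 b3) = (-1) ^+ (b0 + b1)) *
  (ext_sign K i3 (set4 b0 b1 b2 b3) = (-1) ^+ (b0 + b1 + b2)).
Proof. by do !split; rewrite /ext_sign card_set_ord4 !(inE, in_set4) /= ?andbT ?andbF ?addn0 ?add0n. Qed.

Definition set4S K := (in_set4, set4_D1, set4_U1, ext_sign4 K, card_set4).

(** * The invariants of Spin(V)_w in degree 4 *)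

Section Invariants.
Variables (R : realType) (X : abelian_surface R) (n : nat) (e : 'M[int]_4).
Hypothesis e_basis : oriented_basis X e.
Local Notation o := (orientation X).
Local Notation l i := (row_mx (basis_vec int i) (0 : 'rV[int]_4)).
Local Notation r i := (row_mx (0 : 'rV[int]_4) (basis_vec int i)).

Variable c : ext rat (4 + 4).
Hypotheses (c_deg : ext_deg 4 c) (c_inv : Spin_w_invariant X n c).

Local Notation lq i := (row_mx (basis_vec rat i) (0 : 'rV[rat]_4)).
Local Notation rq i := (row_mx (0 : 'rV[rat]_4) (basis_vec rat i)).

Lemma w_classE : w_class X n = ext_one - ((n.+1)%:R * o) *: ext_mono [set: 'I_4].
Proof. by rewrite /w_class /point_class scalerA. Qed.

Lemma eichler_inv (p q : 'rV[int]_(4 + 4)) :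
  V_form p p = 0 -> V_form q q = 0 -> V_form p q = 0 ->
  V_act p (V_act q (w_class X n)) = 0 ->
  ext_map (eichler_mx (map_mx intr p) (map_mx intr q)) c = c.
Proof.
move=> pp qq pq pqw; have [spin ind] := eichler_spin pp qq pq.
rewrite -map_eichler_mx; apply: (c_inv _ ind); split=> //.
by rewrite cl_actD cl_act1 mulr2n cl_actD cl_actM !cl_act_gen pqw !addr0.
Qed.

Lemma map_l i : map_mx intr (l i) = lq i :> 'rV[rat]_(4 + 4).
Proof. by rewrite map_row_mx map_mx0 map_delta_mx. Qed.
Lemma map_r i : map_mx intr (r i) = rq i :> 'rV[rat]_(4 + 4).
Proof. by rewrite map_row_mx map_mx0 map_delta_mx. Qed.

(** On H^1 these are the transvections e_j |-> e_j + 2 e_i, and they act contragrediently on the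
    dual. They fix w because e_j^* kills 1, while e_i kills the top class and anticommutes with
    e_j^*. *)
Lemma transvection_inv i j : i != j ->
  ext_map (eichler_mx (lq i) (rq j)) c = c.
Proof.
move=> ij; rewrite -map_l -map_r; apply: eichler_inv; rewrite ?V_form_ll ?V_form_rr //.
  by rewrite V_form_lr sum_basis basis_vecE eq_sym (negPf ij).
rewrite V_act_l V_act_r w_classE -scaleNr addrC contractionDr contraction_one addr0.
rewrite contractionZr wedgeZr.
have -> : wedge (basis_vec int i) (contraction (basis_vec int j) (ext_mono [set: 'I_4])) = 0.
  have := contraction_wedge (basis_vec int j) (basis_vec int i) (ext_mono [set: 'I_4]).
  rewrite sum_basis basis_vecE eq_sym (negPf ij) scale0r sub0r => /eqP; rewrite eq_sym eqr_oppLR => /eqP->.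
  have -> : wedge (basis_vec int i) (ext_mono [set: 'I_4]) = 0.
    apply/ffunP => L; rewrite wedge_basisE ext_monoE ext_zeroE.
    have /negPf-> : L :\ i != [set: 'I_4].
      by apply/eqP => /finset.setP/(_ i); rewrite !inE eqxx.
    by rewrite !mulr0.
  by rewrite contraction0r oppr0.
by rewrite scaler0.
Qed.

Local Notation u A B := (c (set8 A B)).

(** The coordinate of the invariance at A, B, with the common term and a factor 2 cancelled. *)
Lemma transvection_eq (i j : 'I_4) (A B : {set 'I_4}) : i != j ->
  ((i \in A) && (j \notin A))%:R * (ext_sign rat i A * ext_sign rat j (A :\ i) * u (j |: (A :\ i)) B)
  - ((j \in B) && (i \notin B))%:R * (ext_sign rat j B * ext_sign rat i (B :\ j) *
      (u A (i |: (B :\ j)) + 2 * ((i \in A) && (j \notin A))%:R *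
        (ext_sign rat i A * ext_sign rat j (A :\ i) * u (j |: (A :\ i)) (i |: (B :\ j))))) = 0.
Proof.
move=> ij; have := transvection_inv ij; rewrite ext_map_eichler /=.
rewrite mul_form_mx_l mul_form_mx_r => /ffunP/(_ (set8 A B)).
rewrite !contractionDr !contractionZr !wedgeDr !wedgeZr.
rewrite !(ext_addE, ext_oppE, ext_scaleE) wedge_basis8l contraction_basis8l.
rewrite !wedge_basis8r !contraction_basis8r.
rewrite wedge_basis8l contraction_basis8l.
have -> : (j \notin A :\ i) = (j \notin A) by rewrite !inE eq_sym ij.
have -> : (i \notin B :\ j) = (i \notin B) by rewrite !inE ij.
rewrite -!mulnb !natrM -signr_odd.
move: (i \in A)%:R (j \notin A)%:R (j \in B)%:R (i \notin B)%:R => a1 a2 b1 b2.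
move: (ext_sign _ i A) (ext_sign _ j (A :\ i)) (ext_sign _ j B) (ext_sign _ i (B :\ j)) => s1 s2 s3 s4.
move: (u A B : rat) (u (j |: A :\ i) B : rat) (u A (i |: B :\ j) : rat) (u (j |: A :\ i) (i |: B :\ j) : rat).
move=> x y z t E; apply: (mulfI (_ : (2 : rat) != 0)) => //; apply: (addrI x).
by rewrite mulr0 addr0 -[RHS]E; case: (odd _) => /=; ring.
Qed.

(** If only one of the two conditions held, the relation [transvection_eq] at the neighbouring
    coordinate, where j is traded for i in A or in B, would reduce to the single term u A B. *)
Lemma support_transvection i j A B : i != j -> u A B != 0 ->
  (j \in A) && (i \notin A) = (j \in B) && (i \notin B).
Proof.
move=> ij uAB; have ji : (j == i) = false by rewrite eq_sym (negPf ij).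
have sgn k (L : {set 'I_4}) : ext_sign rat k L != 0 by rewrite signr_eq0.
apply/idP/idP => [/andP[jA iA]|/andP[jB iB]]; apply: contraNT uAB => nAB.
  have := transvection_eq (i |: (A :\ j)) B ij.
  have -> : (i \in i |: A :\ j) && (j \notin i |: A :\ j) by rewrite !inE !eqxx ?ji.
  rewrite (negPf nAB) mul0r subr0 mul1r finset.setU1K ?inE ?(negPf iA) ?andbF // finset.setD1K //.
  by move/eqP; rewrite !mulf_eq0 !(negPf (sgn _ _)).
have jji : j != i by rewrite eq_sym.
have := transvection_eq A (i |: (B :\ j)) jji.
have -> : (i \in i |: B :\ j) && (j \notin i |: B :\ j) by rewrite !inE !eqxx ?ji.
rewrite [(j \in A) && _](negPf nAB) mul0r sub0r mul1r.
rewrite finset.setU1K ?inE ?(negPf iB) ?andbF // finset.setD1K //.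
by rewrite mulr0 mul0r addr0 => /eqP; rewrite oppr_eq0 !mulf_eq0 !(negPf (sgn _ _)).
Qed.

(** In the relation at ({i, k}, {j, k}) the quadratic term vanishes by [support_transvection], and
    the two others carry the same sign. *)
Lemma invariant_pair i j k : i != j -> i != k -> j != k ->
  u [set j; k] [set j; k] = u [set i; k] [set i; k].
Proof.
move=> ij ik jk; have sgn h (L : {set 'I_4}) : ext_sign rat h L != 0 by rewrite signr_eq0.
have u0 : u [set j; k] [set i; k] = 0.
  apply/eqP; apply: contraTT isT => /(support_transvection ij).
  by rewrite !inE !eqxx (negPf ij) (negPf ik) [j == i]eq_sym (negPf ij) (negPf jk).
have := transvection_eq [set i; k] [set j; k] ij.
have -> : (i \in [set i; k]) && (j \notin [set i; k]).
  by rewrite !inE !eqxx [j == i]eq_sym (negPf ij) (negPf jk).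
have -> : (j \in [set j; k]) && (i \notin [set j; k]).
  by rewrite !inE !eqxx (negPf ij) (negPf ik).
rewrite !finset.setU1K ?inE // u0 !ext_sign_U1 !mulr0 addr0 !mul1r [X in _ - X * _]mulrC -mulrBr.
by move/eqP; rewrite !mulf_eq0 !(negPf (sgn _ _)) /= subr_eq0 => /eqP.
Qed.

(** What the transvections leave is spanned by alpha^2, beta and gamma: the invariants of SL(H^1) in
    degree 4. The remaining coordinates vanish by the degree and by the support conditions for all
    pairs i, j. *)
Lemma invariant_shape A B :
  u A B = u (set4 true true false false) (set4 true true false false) *
            ((A == B) && (#|A| == 2%N))%:R
        + u [set: 'I_4] finset.set0 * ((A == [set: 'I_4]) && (B == finset.set0))%:R
        + u finset.set0 [set: 'I_4] * ((A == finset.set0) && (B == [set: 'I_4]))%:R.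
Proof.
have s2 : [/\ [set i0; i1] = set4 true true false false, [set i0; i2] = set4 true false true false,
  [set i0; i3] = set4 true false false true, [set i1; i2] = set4 false true true false
  & [set i1; i3] = set4 false true false true /\ [set i2; i3] = set4 false false true true].
  by do !split; apply/finset.setP; apply: ord4P; rewrite !(inE, in_set4).
case: s2 => s01 s02 s03 s12 [s13 s23].
have sC (x y : 'I_4) : [set x; y] = [set y; x] by rewrite finset.setUC.
have p02 : u [set i0; i2] [set i0; i2] = u [set i0; i1] [set i0; i1].
  by rewrite !(sC i0); apply: invariant_pair.
have p12 : u [set i1; i2] [set i1; i2] = u [set i0; i1] [set i0; i1].
  by rewrite -p02; apply: invariant_pair.
have p13 : u [set i1; i3] [set i1; i3] = u [set i0; i1] [set i0; i1].
  by rewrite -p12 !(sC i1); apply: invariant_pair.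
have p03 : u [set i0; i3] [set i0; i3] = u [set i0; i1] [set i0; i1].
  by rewrite -p13; apply: invariant_pair.
have p23 : u [set i2; i3] [set i2; i3] = u [set i0; i1] [set i0; i1].
  by rewrite -p03; apply: invariant_pair.
rewrite s01 s02 s03 s12 s13 s23 in p02 p12 p13 p03 p23.
have pairE (a0 a1 a2 a3 : bool) : (a0 + a1 + a2 + a3 == 2)%N ->
    u (set4 a0 a1 a2 a3) (set4 a0 a1 a2 a3) = u (set4 true true false false) (set4 true true false false).
  by case: a0 a1 a2 a3 => [] [] [] [].
rewrite (set4E A) (set4E B).
move: (i0 \in A) (i1 \in A) (i2 \in A) (i3 \in A) (i0 \in B) (i1 \in B) (i2 \in B) (i3 \in B).
move=> a0 a1 a2 a3 b0 b1 b2 b3; rewrite -set4T -set4_0.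
case: (set4 a0 a1 a2 a3 =P set4 b0 b1 b2 b3) => [<-|AB].
  have AT0 : (set4 a0 a1 a2 a3 == set4 true true true true) && (set4 a0 a1 a2 a3 == set4 false false false false) = false.
    by case: eqP => [->|]; rewrite ?set4_inj.
  rewrite AT0 (andbC (_ == set4 false false false false)) AT0 !mulr0 !addr0 card_set4.
  case: eqP => [/eqP/pairE ->|a2']; first by rewrite mulr1.
  rewrite mulr0 c_deg // card_set8 !card_set4; apply/eqP => E; apply: a2'.
  by case: a0 a1 a2 a3 E {AT0} => [] [] [] [].
rewrite mulr0 add0r.
case: (altP andP) => [[/eqP-> /eqP->]|T0]; first by rewrite !set4_inj /= mulr1 mulr0 addr0.
rewrite mulr0 add0r.
case: (altP andP) => [[/eqP-> /eqP->]|T1]; first by rewrite mulr1.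
rewrite mulr0; apply/eqP; apply: contraTT isT => u0.
have sup i j ij := @support_transvection i j (set4 a0 a1 a2 a3) (set4 b0 b1 b2 b3) ij u0.
move: (sup i0 i1 isT) (sup i1 i0 isT) (sup i0 i2 isT) (sup i2 i0 isT) (sup i0 i3 isT) (sup i3 i0 isT)
 (sup i1 i2 isT) (sup i2 i1 isT) (sup i1 i3 isT) (sup i3 i1 isT) (sup i2 i3 isT) (sup i3 i2 isT).
move: AB T0 T1; rewrite !in_set4 !set4_inj => AB.
have {}AB : ~~ [&& a0 == b0, a1 == b1, a2 == b2 & a3 == b3].
  by apply/negP => /and4P[/eqP E0 /eqP E1 /eqP E2 /eqP E3]; apply: AB; rewrite E0 E1 E2 E3.
have udeg : (a0 + a1 + a2 + a3 + (b0 + b1 + b2 + b3) == 4)%N.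
  by apply: contraNT u0 => u4; rewrite c_deg // card_set8 !card_set4.
by case: a0 a1 a2 a3 b0 b1 b2 b3 {sup u0} AB udeg => [] [] [] [] [] [] [] [].
Qed.

End Invariants.

Section Relations.
Variables (R : realType) (X : abelian_surface R) (n : nat) (c : ext rat (4 + 4)).
Hypotheses (c_deg : ext_deg 4 c) (c_inv : Spin_w_invariant X n c).
Local Notation o := (orientation X).
Local Notation l K i := (row_mx (basis_vec K i) (0 : 'rV[K]_4)).
Local Notation r K i := (row_mx (0 : 'rV[K]_4) (basis_vec K i)).
Local Notation N := (n.+1%:R : int).
Local Notation Nq := (n.+1%:R : rat).
Local Notation oq := (o%:~R : rat).

Lemma orientationE : o = 1 \/ o = - 1.
Proof.
by have /eqP := orientation_sqr X; rewrite -expr2 sqrf_eq1 => /orP[]/eqP; [left | right].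
Qed.

(** The transvections fix 1 and the top class separately, so an element mixing the two is needed.
    Writing o for the orientation and e_0, ..., e_3 for the standard basis, the factor 1 - 2 o e_2^*
    e_3^* subtracts 2 (n+1) e_0 /\ e_1 from w, and 1 + 2 (n+1) e_0 e_1 adds it back. *)
Lemma mixed_inv :
  ext_map (eichler_mx (Nq *: l rat i0) (l rat i1)) (ext_map (eichler_mx ((- oq) *: r rat i2) (r rat i3)) c) = c.
Proof.
have f1 : V_form (N *: l int i0) (N *: l int i0) = 0 by rewrite V_formZl V_formZr V_form_ll !mulr0.
have f2 : V_form (l int i1) (l int i1) = 0 by rewrite V_form_ll.
have f3 : V_form (N *: l int i0) (l int i1) = 0 by rewrite V_formZl V_form_ll !mulr0.
have f4 : V_form ((- o) *: r int i2) ((- o) *: r int i2) = 0 by rewrite V_formZl V_formZr V_form_rr !mulr0.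
have f5 : V_form (r int i3) (r int i3) = 0 by rewrite V_form_rr.
have f6 : V_form ((- o) *: r int i2) (r int i3) = 0 by rewrite V_formZl V_form_rr !mulr0.
have [spin1 ind1] := eichler_spin f1 f2 f3; have [spin2 ind2] := eichler_spin f4 f5 f6.
have [spin ind] := SpinM spin1 spin2 ind1 ind2.
have mapl i : map_mx intr (l int i) = l rat i by rewrite map_row_mx map_mx0 map_delta_mx.
have mapr i : map_mx intr (r int i) = r rat i by rewrite map_row_mx map_mx0 map_delta_mx.
rewrite -ext_mapM -!mapl -!mapr.
have -> : Nq *: map_mx intr (l int i0) = map_mx intr (N *: l int i0).
  by rewrite map_mxZ rmorph_nat.
have -> : - oq *: map_mx intr (r int i2) = map_mx intr ((- o) *: r int i2).
  by rewrite map_mxZ rmorphN.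
rewrite -!map_eichler_mx -map_mxM; apply: (c_inv _ ind); split=> //.
have actE (p q : 'rV[int]_(4 + 4)) s : cl_act (eichler p q) s = s + 2 *: V_act p (V_act q s).
  by rewrite cl_actD cl_act1 mulr2n cl_actD cl_actM !cl_act_gen scaler_nat mulr2n.
rewrite cl_actM !actE !V_actZl !V_act_l !V_act_r w_classE.
have ext4 (s t : ext int 4) : (forall b0 b1 b2 b3, s (set4 b0 b1 b2 b3) = t (set4 b0 b1 b2 b3)) -> s = t.
  by move=> st; apply/ffunP => L; rewrite (set4E L).
apply: ext4 => b0 b1 b2 b3.
rewrite !(ext_addE, ext_oppE, ext_scaleE, wedgeDr, wedgeZr, contractionDr, contractionZr).
rewrite !(wedge_basisE, contraction_basisE, set4S int, ext_oppE, ext_scaleE, ext_monoE).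
rewrite -set4T -set4_0 !set4_inj.
have [->|->] := orientationE; case: b0 b1 b2 b3 => [] [] [] [] /=; ring.
Qed.

(** The mixed invariance is read at ({0, 1, 2}, {2}) and at ({0}, {0, 2, 3}). There c itself
    vanishes by [invariant_shape], and what remains relates the coefficient of alpha^2 to that of
    beta, respectively gamma. *)
Lemma mixed_relations :
  c (set8 [set: 'I_4] finset.set0) =
    2 * oq * Nq * c (set8 (set4 true true false false) (set4 true true false false)) /\
  Nq * c (set8 finset.set0 [set: 'I_4]) =
    2 * oq * c (set8 (set4 true true false false) (set4 true true false false)).
Proof.
have shape := invariant_shape c_deg c_inv.
pose a := c (set8 (set4 true true false false) (set4 true true false false)) : rat.
pose b := c (set8 [set: 'I_4] finset.set0) : rat.
pose d := c (set8 finset.set0 [set: 'I_4]) : rat.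
have c8 (a0 a1 a2 a3 b0 b1 b2 b3 : bool) : c (set8 (set4 a0 a1 a2 a3) (set4 b0 b1 b2 b3)) =
    a * ([&& a0 == b0, a1 == b1, a2 == b2 & a3 == b3] && (a0 + a1 + a2 + a3 == 2)%N)%:R
    + b * [&& a0, a1, a2, a3, ~~ b0, ~~ b1, ~~ b2 & ~~ b3]%:R
    + d * [&& ~~ a0, ~~ a1, ~~ a2, ~~ a3, b0, b1, b2 & b3]%:R :> rat.
  rewrite shape -set4T -set4_0 !set4_inj card_set4 /a /b /d -set4T -set4_0 !eqb_id -!andbA.
  by rewrite !eqbF_neg.
rewrite -/a -/b -/d; move: c8; clearbody a b d => c8.
have := mixed_inv; set c1 := ext_map _ c; rewrite ext_map_eichler /= => E.
have c1E A B : c1 (set8 A B) = c (set8 A B)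
   - 2 * oq * wedge (r rat i2) (contraction (l rat i3) c) (set8 A B)
   + 2 * oq * (wedge (r rat i3) (contraction (l rat i2) c) (set8 A B)
   - 2 * oq * wedge (r rat i3) (contraction (l rat i2) (wedge (r rat i2) (contraction (l rat i3) c))) (set8 A B)) :> rat.
  rewrite /c1 ext_map_eichler /= -scalemxAl mul_form_mx_r.
  rewrite !(contraction_Zl, contractionDr, contractionZr, wedgeDr, wedgeZr, wedgeZl).
  rewrite !(ext_addE, ext_oppE, ext_scaleE) mul_form_mx_r.
  move: (c _ : rat) (wedge _ _ _ : rat) (wedge _ _ _ : rat) (wedge _ _ _ : rat) => *; ring.
clearbody c1.
have {}E A B : c (set8 A B) = c1 (set8 A B)
   + 2 * Nq * wedge (l rat i0) (contraction (r rat i1) c1) (set8 A B)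
   - 2 * Nq * (wedge (l rat i1) (contraction (r rat i0) c1) (set8 A B)
   + 2 * Nq * wedge (l rat i1) (contraction (r rat i0) (wedge (l rat i0) (contraction (r rat i1) c1))) (set8 A B)) :> rat.
  rewrite -{1}E -scalemxAl !mul_form_mx_l.
  rewrite !(contraction_Zl, contractionDr, contractionZr, wedgeDr, wedgeZr, wedgeZl).
  rewrite !(ext_addE, ext_oppE, ext_scaleE).
  move: (c1 _ : rat) (wedge _ _ _ : rat) (wedge _ _ _ : rat) (wedge _ _ _ : rat) => *; ring.
have oo : oq = 1 \/ oq = - 1 by have [->|->] := orientationE; [left | right; rewrite rmorphN].
split.
  have := E (set4 true true true false) (set4 false false true false).
  rewrite !(wedge_basis8l, contraction_basis8r, set4S rat) !c1E.
  rewrite !(wedge_basis8r, contraction_basis8l, set4S rat) !c8 /=.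
  move/eqP; rewrite -subr_eq0 => /eqP E1.
  have E2 : 2 * (oq * b - 2 * Nq * a) = 0 by rewrite -[RHS]E1; ring.
  move/eqP: E2; rewrite mulf_eq0 /= subr_eq0 => /eqP E2.
  have -> : b = oq * (oq * b) by rewrite mulrA orientation_sqrr mul1r.
  by rewrite E2; ring.
have := E (set4 true false false false) (set4 true false true true).
rewrite !(wedge_basis8l, contraction_basis8r, set4S rat) !c1E.
rewrite !(wedge_basis8r, contraction_basis8l, set4S rat) !c8 /=.
move/eqP; rewrite -subr_eq0 => /eqP E1.
have E2 : 2 * (Nq * d - 2 * oq * a) = 0 by rewrite -[RHS]E1; ring.
by move/eqP: E2; rewrite mulf_eq0 /= subr_eq0 => /eqP.
Qed.

Lemma invariant_line (e : 'M[int]_4) : oriented_basis X e ->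
  exists k, c = k *: ext_int rat (c_class e n).
Proof.
move=> e_basis; have [bE dE] := mixed_relations.
set a := c (set8 (set4 true true false false) (set4 true true false false)) in bE dE.
have N0 : Nq != 0 by rewrite pnatr_eq0.
have intrE (x y z : bool) : (2 * N ^+ 2 * x%:R + 4 * N ^+ 3 * (o * y%:R) + 4 * N * (o * z%:R))%:~R =
    2 * Nq ^+ 2 * x%:R + 4 * Nq ^+ 3 * (oq * y%:R) + 4 * Nq * (oq * z%:R) :> rat.
  by rewrite !(intrD, intrM) !(rmorphXn, rmorph_nat) /= ?intrM; ring.
(* The divisor 2 (n+1)^2 is the coordinate of c_w at ({0, 1}, {0, 1}), where c has the coordinate
   a. *)
exists (a / (2 * Nq ^+ 2)); apply/ffunP => L; rewrite ext_scaleE ffunE (set8E L) (c_coord n e_basis).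
rewrite (invariant_shape c_deg c_inv) -/a bE.
have -> : c (set8 finset.set0 [set: 'I_4]) = 2 * oq * a / Nq by rewrite -dE mulrC mulKf.
rewrite intrE.
move: ((_ && _)%:R : rat) ((_ && _)%:R : rat) ((_ && _)%:R : rat) => x y z.
by field; rewrite addrC natr1.
Qed.

End Relations.

(** * Extension of scalars *)

Section ScalarExtension.
Variables (K L : comNzRingType) (f : {rmorphism K -> L}) (m : nat).
Implicit Types (s t : ext K m).

Lemma ext_applyE s (I : {set 'I_m}) : ext_apply f s I = f (s I) :> L.
Proof. by rewrite ffunE. Qed.

Lemma ext_apply_linear k s t : ext_apply f (k *: s + t) = f k *: ext_apply f s + ext_apply f t.
Proof.
apply/ffunP => I; rewrite ext_addE ext_scaleE !ext_applyE ext_addE ext_scaleE.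
by rewrite rmorphD rmorphM.
Qed.

Lemma ext_apply0 : ext_apply f (0 : ext K m) = 0.
Proof. by apply/ffunP => I; rewrite ext_applyE !ext_zeroE rmorph0. Qed.

Lemma ext_applyZ k s : ext_apply f (k *: s) = f k *: ext_apply f s.
Proof. by rewrite -[k *: s]addr0 ext_apply_linear ext_apply0 addr0. Qed.

Lemma ext_applyD s t : ext_apply f (s + t) = ext_apply f s + ext_apply f t.
Proof. by rewrite -[s]scale1r ext_apply_linear rmorph1 !scale1r. Qed.

Lemma ext_applyN s : ext_apply f (- s) = - ext_apply f s.
Proof. by rewrite -scaleN1r ext_applyZ rmorphN1 scaleN1r. Qed.

Lemma ext_apply_sum (T : Type) (r : seq T) (P : pred T) (F : T -> ext K m) :
  ext_apply f (\sum_(x <- r | P x) F x) = \sum_(x <- r | P x) ext_apply f (F x).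
Proof. by elim/big_ind2: _ => [|s s' t t' <- <-|//]; rewrite ?ext_apply0 ?ext_applyD. Qed.

Lemma ext_apply_mono (I : {set 'I_m}) : ext_apply f (ext_mono I) = ext_mono I.
Proof. by apply/ffunP => J; rewrite ext_applyE !ext_monoE rmorph_nat. Qed.

Lemma ext_apply_wedge (a : 'rV[K]_m) s :
  ext_apply f (wedge a s) = wedge (map_mx f a) (ext_apply f s).
Proof.
apply/ffunP => I; rewrite ext_applyE !wedgeE rmorph_sum; apply: eq_bigr => i _.
by rewrite !rmorphM rmorph_sign ext_applyE mxE.
Qed.

Lemma ext_apply_contraction (a : 'rV[K]_m) s :
  ext_apply f (contraction a s) = contraction (map_mx f a) (ext_apply f s).
Proof.
apply/ffunP => I; rewrite ext_applyE !contractionE rmorph_sum; apply: eq_bigr => i _.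
by rewrite !rmorphM rmorph_sign ext_applyE mxE.
Qed.

Lemma ext_apply_V_act (v : 'rV[K]_(m + m)) s :
  ext_apply f (V_act v s) = V_act (map_mx f v) (ext_apply f s).
Proof.
rewrite -{1}(hsubmxK v) V_act_row ext_applyD ext_apply_wedge ext_apply_contraction.
by rewrite -V_act_row -map_row_mx hsubmxK.
Qed.

Lemma ext_apply_prod (vs : seq 'rV[K]_m) :
  ext_apply f (ext_prod vs) = ext_prod [seq map_mx f v | v <- vs].
Proof.
elim: vs => [|v vs IHvs] /=; first exact: ext_apply_mono.
by rewrite !wedge_def ext_apply_wedge IHvs.
Qed.

Lemma ext_apply_map (g : 'M[K]_m) s :
  ext_apply f (ext_map g s) = ext_map (map_mx f g) (ext_apply f s).
Proof.
rewrite /ext_map ext_apply_sum; apply: eq_bigr => I _.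
rewrite ext_applyZ ext_apply_prod ext_applyE -map_comp; congr (_ *: ext_prod _).
by apply: eq_map => i /=; rewrite map_row.
Qed.

Lemma ext_apply_inj : injective f -> injective (fun s : ext K m => ext_apply f s).
Proof.
by move=> f_inj s t /ffunP st; apply/ffunP => I; apply: f_inj; rewrite -!ext_applyE st.
Qed.

End ScalarExtension.

Section TensorExtension.
Variables (R : realType) (X : abelian_surface R).

Lemma S_form_apply (K L : comNzRingType) (f : {rmorphism K -> L}) (s t : ext K 4) :
  S_form X (ext_apply f s) (ext_apply f t) = f (S_form X s t).
Proof.
rewrite /S_form /int_X rmorphM rmorph_int !ext_mulE rmorph_sum; congr (_ * _).
apply: eq_bigr => I _; rewrite !rmorphM rmorph_sign !ext_applyE !ffunE.
by rewrite rmorphM rmorphXn rmorphN1.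
Qed.

Lemma spinor_tensor_apply (K L : numDomainType) (f : {rmorphism K -> L}) k (s t : ext K 4) :
  ext_apply f (spinor_tensor X k s t) = spinor_tensor X k (ext_apply f s) (ext_apply f t).
Proof.
elim: k s => [|k IHk] s /=; first by rewrite ext_applyZ S_form_apply ext_apply_mono.
rewrite ext_apply_sum; apply: eq_bigr => i _.
rewrite ext_apply_wedge IHk ext_apply_V_act map_row map_form_mx; congr (wedge _ _).
by rewrite map_delta_mx.
Qed.

End TensorExtension.

Section LinearInverse.
Variables (K : comNzRingType) (m : nat).
Implicit Types (s : ext K m) (T : ext K m -> ext K m).

(** The exterior algebra is free of finite rank, and a one-sided inverse of a square matrix over a
    commutative ring is two-sided. This turns x x^* = 1 into x^* x = 1 on spinors, over the integers
    as well. *)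
Lemma linear_inverse T T' :
  (forall k s t, T (k *: s + t) = k *: T s + T t) ->
  (forall k s t, T' (k *: s + t) = k *: T' s + T' t) ->
  (forall s, T (T' s) = s) -> forall s, T' (T s) = s.
Proof.
move=> T_lin T'_lin TT'.
pose vec s : 'rV[K]_#|{set 'I_m}| := \row_i s (enum_val i).
pose mx (U : ext K m -> ext K m) : 'M[K]_#|{set 'I_m}| := \matrix_(i, j) U (ext_mono (enum_val i)) (enum_val j).
have vec_inj : injective vec.
  move=> s t /rowP st; apply/ffunP => I.
  by have := st (enum_rank I); rewrite !mxE enum_rankK.
have vecE (U : ext K m -> ext K m) s : (forall k s t, U (k *: s + t) = k *: U s + U t) ->
    vec (U s) = vec s *m mx U.
  move=> U_lin; have U0 : U 0 = 0.
    by apply: (addrI (U 0)); rewrite -{1}[U 0]scale1r -U_lin scale1r !addr0.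
  apply/rowP => j; rewrite !mxE.
  transitivity (\sum_I s I * U (ext_mono I) (enum_val j)).
    rewrite {1}(ext_mono_sum s); elim/big_rec2: _ => [|I y z _ IH]; first by rewrite U0 ext_zeroE.
    by rewrite U_lin ext_addE ext_scaleE IH.
  rewrite (reindex (fun i : 'I_#|{set 'I_m}| => enum_val i)) /=; last first.
    by exists enum_rank => I _; rewrite ?enum_valK ?enum_rankK.
  by apply: eq_bigr => i _; rewrite !mxE.
have M1 : mx T' *m mx T = 1%:M.
  apply/row_matrixP => i; rewrite row1 rowE mulmxA.
  pose s := ext_mono (enum_val i) : ext K m.
  have vs : delta_mx 0 i = vec s.
    by apply/rowP => j; rewrite !mxE eqxx ext_monoE (inj_eq enum_val_inj).
  by rewrite vs -!vecE // TT'.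
move=> s; apply: vec_inj; rewrite !vecE // -mulmxA (mulmx1C M1) mulmx1 //.
Qed.

End LinearInverse.

(** * The spin group on spinors and the invariance of c_w *)

Section SpinAction.
Variables (R : realType) (X : abelian_surface R) (K : comNzRingType).
Local Notation Cl := (clifford (@V_form K 4)).
Implicit Types (x : Cl) (s t : ext K 4).

(** Vectors are self-adjoint but the star negates them, so a homogeneous element of parity p has its
    star as adjoint up to (-1)^p. *)
Lemma cl_act_adj x s t : cl_even x -> S_form X (cl_act x s) t = S_form X s (cl_act (cl_star x) t).
Proof.
case=> u u_even ->; rewrite cl_starE !cl_actE.
have adj p y : cl_homog p y -> forall s t,
    S_form X (expr_act y s) t = (-1) ^+ p * S_form X s (expr_act (cl_expr_star y) t).
  elim=> {p y} [k|v|p y z _ IHy _ IHz|p q y z _ IHy _ IHz] {}s {}t /=.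
  - by rewrite mul1r S_formZl S_formZr.
  - by rewrite V_actNl S_formNr mulN1r opprK S_form_adj.
  - by rewrite S_formDl S_formDr IHy IHz mulrDr.
  - by rewrite IHy IHz mulrA signr_addb.
by rewrite (adj _ _ u_even) mul1r.
Qed.

Lemma Spin_starK x s : Spin x -> cl_act (cl_star x) (cl_act x s) = s.
Proof.
case=> _ xx _; apply: (linear_inverse (T := cl_act x) (T' := cl_act (cl_star x))) => *.
- exact: cl_act_linear.
- exact: cl_act_linear.
- by rewrite -cl_actM xx cl_act1.
Qed.

Lemma Spin_isom x s t : Spin x -> S_form X (cl_act x s) (cl_act x t) = S_form X s t.
Proof. by move=> x_spin; rewrite cl_act_adj ?Spin_starK //; case: x_spin. Qed.

Lemma Spin_act x g v s : Spin x -> cl_induces x g ->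
  cl_act x (V_act v s) = V_act (v *m g) (cl_act x s).
Proof.
move=> x_spin xg; rewrite -[RHS]cl_act_gen -xg !cl_actM cl_act_gen.
by rewrite Spin_starK.
Qed.

End SpinAction.

(** The constant 24 is 4!: whatever the order in which the four indices are removed, the sign of
    that order is compensated by the anticommutation of the d_i. *)
Lemma alternating_sum4 (K : comNzRingType) (V : zmodType) (d0 d1 d2 d3 : V -> V) (f : V -> K)
    (F : nat -> V -> bool -> bool -> bool -> bool -> K) s :
  (forall r, d0 (d1 r) = - d1 (d0 r)) -> (forall r, d0 (d2 r) = - d2 (d0 r)) ->
  (forall r, d0 (d3 r) = - d3 (d0 r)) -> (forall r, d1 (d2 r) = - d2 (d1 r)) ->
  (forall r, d1 (d3 r) = - d3 (d1 r)) -> (forall r, d2 (d3 r) = - d3 (d2 r)) ->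
  (forall r, d1 (- r) = - d1 r) -> (forall r, d2 (- r) = - d2 r) -> (forall r, d3 (- r) = - d3 r) ->
  (forall r, f (- r) = - f r) -> (forall r, F 0%N r false false false false = f r) ->
  (forall k r b0 b1 b2 b3, F k.+1 r b0 b1 b2 b3 =
      b0%:R * F k (d0 r) false b1 b2 b3
    + b1%:R * ((-1) ^+ b0 * F k (d1 r) b0 false b2 b3)
    + b2%:R * ((-1) ^+ (b0 + b1) * F k (d2 r) b0 b1 false b3)
    + b3%:R * ((-1) ^+ (b0 + b1 + b2) * F k (d3 r) b0 b1 b2 false)) ->
  F 4%N s true true true true = 24 * f (d3 (d2 (d1 (d0 s)))).
Proof.
move=> d01 d02 d03 d12 d13 d23 N1 N2 N3 fN F0 FS.
repeat (rewrite FS /= ?mul0r ?add0r ?addr0 ?mul1r).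
by rewrite !F0 !(d01, d02, d03, d12, d13, d23, N1, N2, N3, fN); ring.
Qed.

Section TensorCoordinates.
Variables (R : realType) (X : abelian_surface R).

Lemma ext_deg_spinor_tensor (K : numDomainType) k (s t : ext K 4) : ext_deg k (spinor_tensor X k s t).
Proof.
elim: k s => [|k IHk] s L kL /=.
  by rewrite ext_scaleE /ext_one ext_monoE -cards_eq0 (negPf kL) mulr0.
rewrite ext_sumE big1 // => i _; rewrite wedge_basisE.
have [iL|] := boolP (i \in L); last by rewrite mul0r.
by rewrite IHk ?mulr0 //; move: kL; rewrite (cardsD1 i L) iL eqSS.
Qed.

Variable K : numDomainType.
Implicit Types (s t : ext K 4).
Local Notation D i := (contraction (basis_vec K i)).

Lemma spinor_tensor_coord k s t b0 b1 b2 b3 :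
  spinor_tensor X k.+1 s t (set8 (set4 b0 b1 b2 b3) finset.set0) =
    b0%:R * spinor_tensor X k (D i0 s) t (set8 (set4 false b1 b2 b3) finset.set0)
  + b1%:R * ((-1) ^+ b0 * spinor_tensor X k (D i1 s) t (set8 (set4 b0 false b2 b3) finset.set0))
  + b2%:R * ((-1) ^+ (b0 + b1) * spinor_tensor X k (D i2 s) t (set8 (set4 b0 b1 false b3) finset.set0))
  + b3%:R * ((-1) ^+ (b0 + b1 + b2) *
      spinor_tensor X k (D i3 s) t (set8 (set4 b0 b1 b2 false) finset.set0)) :> K.
Proof.
rewrite /= ext_sumE big_split_ord /= [X in _ + X]big1 ?addr0 => [|i _]; last first.
  by rewrite -basis_vecr wedge_basis8r inE mul0r.
have rowE i : row (lshift 4 i) form_mx = row_mx 0 (basis_vec K i).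
  by rewrite rowE -[delta_mx _ _]/(basis_vec K (lshift 4 i)) -basis_vecl mul_form_mx row_mxKl row_mxKr.
rewrite (eq_bigr (fun i => (i \in set4 b0 b1 b2 b3)%:R * (ext_sign K i (set4 b0 b1 b2 b3) *
  spinor_tensor X k (D i s) t (set8 (set4 b0 b1 b2 b3 :\ i) finset.set0)))) => [|i _].
  by rewrite big_ord4 !(set4S K) mul1r.
by rewrite rowE V_act_r -basis_vecl wedge_basis8l.
Qed.

Lemma contractionC (a b : 'rV[K]_4) s : contraction a (contraction b s) = - contraction b (contraction a s).
Proof.
by apply/eqP; rewrite -addr_eq0 -!V_act_r V_act_rel V_form_rr scale0r.
Qed.

Lemma spinor_tensor_top s t :
  spinor_tensor X 4 s t (set8 [set: 'I_4] finset.set0) = 24 * S_form X (D i3 (D i2 (D i1 (D i0 s)))) t.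
Proof.
have DN i r : D i (- r) = - D i r by rewrite -!V_act_r V_actN.
rewrite -set4T; apply: (alternating_sum4 (f := fun r => S_form X r t) (d0 := D i0) (d1 := D i1) (d2 := D i2) (d3 := D i3)
  (F := fun k r b0 b1 b2 b3 => spinor_tensor X k r t (set8 (set4 b0 b1 b2 b3) finset.set0))) => //.
1-6: by move=> r; rewrite contractionC.
1-3: exact: DN.
- by move=> r; exact: S_formNl.
- by move=> r; rewrite /= ext_scaleE ext_one8 -set4_0 eqxx mulr1.
- by move=> *; rewrite spinor_tensor_coord.
Qed.

End TensorCoordinates.

Lemma cl_act0 (K : comNzRingType) m (x : clifford (@V_form K m)) : cl_act x 0 = 0.
Proof.
apply: (addrI (cl_act x 0)); rewrite -{1}[cl_act x 0]scale1r -cl_act_linear.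
by rewrite scale1r !addr0.
Qed.

Section InvariantClass.
Variables (R : realType) (X : abelian_surface R) (n : nat) (e : 'M[int]_4).
Hypothesis e_basis : oriented_basis X e.
Local Notation o := (orientation X).
Local Notation w := (w_class X n).
Local Notation N := (n.+1%:R : int).

Lemma ext_deg_c_class : ext_deg 4 (c_class e n).
Proof.
move=> L; rewrite (set8E L); move: [set _ | _] [set _ | _] => A B.
rewrite card_set8 (c_coord n e_basis) (set4E A) (set4E B) -set4T -set4_0 !set4_inj !card_set4.
move: (i0 \in A) (i1 \in A) (i2 \in A) (i3 \in A) (i0 \in B) (i1 \in B) (i2 \in B) (i3 \in B).
move=> a0 a1 a2 a3 b0 b1 b2 b3.
by case: a0 a1 a2 a3 b0 b1 b2 b3 => [] [] [] [] [] [] [] [] //= _; rewrite !mulr0.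
Qed.

Lemma ext_deg_int (K : comNzRingType) k m (s : ext int m) : ext_deg k s -> ext_deg k (ext_int K s).
Proof. by move=> s_deg I Ik; rewrite ffunE s_deg. Qed.

Lemma c_class_neq0 : ext_int rat (c_class e n) != 0.
Proof.
apply/eqP => /ffunP/(_ (set8 (set4 true true false false) (set4 true true false false))).
rewrite ext_zeroE ffunE (c_coord n e_basis) eqxx card_set4 -set4T -set4_0 !set4_inj /= !mulr0 !addr0 mulr1.
move/eqP; rewrite intr_eq0 mulf_eq0 /= expf_eq0 /=.
by rewrite pnatr_eq0.
Qed.

Lemma spinor_tensor_invariant (x : clifford (@V_form int 4)) (g : 'M[int]_(4 + 4)) :
  Spin_w X n x -> cl_induces x g -> ext_map g (spinor_tensor X 4 w w) = spinor_tensor X 4 w w.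
Proof.
case=> x_spin xw xg.
have act v s := Spin_act v s x_spin xg.
rewrite (@spinor_tensor_map R X int 4 g (cl_act x) w w) ?xw //; last by move=> *; apply: Spin_isom.
(* That g is an isometry follows by applying x to (u v + v u) w = (u, v) w and reading the
   coordinate at the empty set, where w is 1. *)
move=> u v; have E : V_form (u *m g) (v *m g) *: w = V_form u v *: w.
  have lin k : cl_act x (k *: w) = k *: w.
    by rewrite -[k *: w]addr0 cl_act_linear xw cl_act0.
  rewrite -[RHS]lin -[X in cl_act x X]V_act_rel -(scale1r (V_act u (V_act v w))) cl_act_linear.
  by rewrite scale1r !act xw V_act_rel.
have /ffunP/(_ finset.set0) := E; rewrite !ext_scaleE w_classE ext_addE ext_oppE ext_scaleE !ext_monoE.
have -> : (finset.set0 == [set: 'I_4]) = false.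
  by apply/eqP => /finset.setP/(_ i0); rewrite !inE.
by rewrite eqxx mulr0 subr0 !mulr1.
Qed.

Lemma ext_int_w (K : comNzRingType) :
  ext_int K w = ext_one - (n.+1%:R * o%:~R) *: ext_mono [set: 'I_4].
Proof.
rewrite w_classE [LHS](ext_applyD intr) ext_applyN ext_applyZ !ext_apply_mono /=.
by rewrite intrM rmorph_nat.
Qed.

(** The coordinate along the top power of H^1 is 24 (n+1)^2 up to sign: four contractions reduce w
    to a multiple of 1, which pairs with the point class in w. *)
Lemma spinor_tensor_neq0 : spinor_tensor X 4 w w != 0.
Proof.
apply/eqP => /ffunP/(_ (set8 [set: 'I_4] finset.set0)).
rewrite ext_zeroE spinor_tensor_top.
have -> : contraction (basis_vec int i3) (contraction (basis_vec int i2)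
   (contraction (basis_vec int i1) (contraction (basis_vec int i0) w))) = - (N * o) *: ext_one.
  apply/ffunP => L; rewrite (set4E L); move: (i0 \in L) (i1 \in L) (i2 \in L) (i3 \in L) => b0 b1 b2 b3.
  rewrite !(contraction_basisE, set4S int) w_classE !(ext_addE, ext_oppE, ext_scaleE, ext_monoE).
  by rewrite -set4T -set4_0 !set4_inj; case: b0 b1 b2 b3 => [] [] [] [] /=; ring.
rewrite S_formZl S_form4 w_classE !(ext_addE, ext_oppE, ext_scaleE, ext_monoE) -set4T -set4_0 !set4_inj /=.
rewrite intz.
have -> : 24 * (- (N * o) * (o * (1 * (0 - N * o * 1) + 0 * (1 - N * o * 0)
  + 0 * (0 - N * o * 0) + 0 * (0 - N * o * 0) - 0 * (0 - N * o * 0) - 0 * (0 - N * o * 0)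
  + 0 * (0 - N * o * 0) + 0 * (0 - N * o * 0) - 0 * (0 - N * o * 0) - 0 * (0 - N * o * 0)
  - 0 * (0 - N * o * 0) - 0 * (0 - N * o * 0) + 0 * (0 - N * o * 0) + 0 * (0 - N * o * 0)
  - 0 * (0 - N * o * 0) - 0 * (0 - N * o * 0)))) = 24 * N ^+ 2 * (o * (o * o)) by ring.
rewrite orientation_sqr mulr1 => /eqP; rewrite !mulf_eq0 /= pnatr_eq0 /=.
by have [->|->] := orientationE X.
Qed.

Lemma tensor_rat : exists2 k, k != 0 &
  ext_int rat (spinor_tensor X 4 w w) = k *: ext_int rat (c_class e n).
Proof.
have inv : Spin_w_invariant X n (ext_int rat (spinor_tensor X 4 w w)).
  move=> x g xw xg; rewrite -[X in _ = X](_ : ext_apply intr (ext_map g (spinor_tensor X 4 w w)) = _).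
    by rewrite ext_apply_map.
  by rewrite (spinor_tensor_invariant xw xg).
have deg : ext_deg 4 (ext_int rat (spinor_tensor X 4 w w)).
  exact/ext_deg_int/ext_deg_spinor_tensor.
have [k kE] := invariant_line deg inv e_basis.
exists k => //; apply/eqP => k0; move: kE; rewrite k0 scale0r => /ffunP T0.
move/eqP: spinor_tensor_neq0; apply; apply/ffunP => L.
by have := T0 L; rewrite ffunE !ext_zeroE => /eqP; rewrite intr_eq0 => /eqP.
Qed.

Lemma part1 : \dim <[ext_int rat (c_class e n)]> = 1%N /\
  forall c : ext rat (4 + 4),
    ext_deg 4 c /\ Spin_w_invariant X n c <-> c \in <[ext_int rat (c_class e n)]>%VS.
Proof.
split=> [|c]; first by rewrite dim_vline c_class_neq0.
split=> [[c_deg c_inv]|/vlineP[k ->]].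
  by have [k ->] := invariant_line c_deg c_inv e_basis; apply/vlineP; exists k.
split=> [I Ik|x g xw xg]; first by rewrite ext_scaleE (ext_deg_int rat ext_deg_c_class Ik) mulr0.
have [h h0 hE] := tensor_rat.
rewrite ext_mapZ; congr (_ *: _).
have -> : ext_int rat (c_class e n) = h^-1 *: ext_int rat (spinor_tensor X 4 w w).
  by rewrite hE scalerA mulVf // scale1r.
rewrite ext_mapZ; congr (_ *: _).
by rewrite -[LHS](ext_apply_map intr) (spinor_tensor_invariant xw xg).
Qed.

(** Clearing denominators makes the proportionality of c_w with the tensor an integral identity,
    which extends to K; over K the tensor is invariant by [spinor_tensor_map], whether or not g
    comes from an integral element. *)
Lemma c_class_isometry (K : numFieldType) (g : 'M[K]_(4 + 4)) (T : ext K 4 -> ext K 4) :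
  V_isometry g -> (forall v r, T (V_act v r) = V_act (v *m g) (T r)) ->
  (forall r r', S_form X (T r) (T r') = S_form X r r') ->
  T (ext_int K w) = ext_int K w ->
  ext_map g (ext_int K (c_class e n)) = ext_int K (c_class e n).
Proof.
move=> g_isom T_act T_isom Tw.
have inv : ext_map g (ext_int K (spinor_tensor X 4 w w)) = ext_int K (spinor_tensor X 4 w w).
  rewrite /ext_int [ext_apply _ _](spinor_tensor_apply X intr).
  by rewrite (@spinor_tensor_map R X K 4 g T _ _ g_isom T_act T_isom) -/(ext_int K w) Tw.
have [k k0 kE] := tensor_rat.
have kE' : (denq k)%:~R *: ext_int K (spinor_tensor X 4 w w) = (numq k)%:~R *: ext_int K (c_class e n).
  suff E : denq k *: spinor_tensor X 4 w w = numq k *: c_class e n.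
    by rewrite -![_%:~R *: ext_int K _](ext_applyZ intr) E.
  apply: (ext_apply_inj (f := intr : {rmorphism int -> rat})); first exact: intr_inj.
  rewrite !ext_applyZ -!/(ext_int rat _) kE scalerA; congr (_ *: _).
  by rewrite /= mulrC -numqE.
have c0 : ((numq k)%:~R : K) != 0 by rewrite intr_eq0 numq_eq0.
apply: (can_inj (scalerK c0)).
by rewrite /= -ext_mapZ -kE' ext_mapZ inv.
Qed.

End InvariantClass.

Lemma cl_act_sum (K : comNzRingType) m (x : clifford (@V_form K m)) (T : Type) (r : seq T)
    (Q : pred T) (F : T -> ext K m) :
  cl_act x (\sum_(i <- r | Q i) F i) = \sum_(i <- r | Q i) cl_act x (F i).
Proof.
apply: (big_morph (cl_act x)) => [s t|]; last exact: cl_act0.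
by rewrite -{1}[s]scale1r cl_act_linear scale1r.
Qed.

(** * C(V) as the endomorphism algebra of the spinors *)

Section Faithful.
Variables (K : numFieldType) (m : nat).
Local Notation Cl := (clifford (@V_form K m)).
Implicit Types (x y z : Cl) (s t : ext K m) (i j : 'I_m).

Let a i : Cl := cl_gen V_form (row_mx (basis_vec K i) 0).
Let b i : Cl := cl_gen V_form (row_mx 0 (basis_vec K i)).
(** Here [a i] creates and [b i] annihilates the index i. The product [p i] is the idempotent that
    keeps the monomials without i, and [vac] multiplies such idempotents. *)
Let p i : Cl := b i * a i.
Let vac (r : seq 'I_m) : Cl := foldr (fun i y => p i * y) 1 r.

Let form_lr i j : V_form (row_mx (basis_vec K i) 0) (row_mx 0 (basis_vec K j)) = (i == j)%:R.
Proof. by rewrite V_form_lr sum_basis basis_vecE eq_sym. Qed.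

Lemma cl_mul2_eq0 x : x *+ 2 = 0 -> x = 0.
Proof.
move=> x2; pose h : Cl := cl_scal m (2^-1 : K).
have h2 : h *+ 2 = 1.
  rewrite mulr2n /h -cl_scalD -cl_scal1; congr cl_scal.
  by rewrite [RHS]splitr mul1r.
by rewrite -[x]mul1r -h2 mulrnAl -mulrnAr x2 mulr0.
Qed.

Let aC i j : a i * a j = - (a j * a i).
Proof. by apply: cl_gen_anticomm; rewrite V_form_ll. Qed.
Let bC i j : b i * b j = - (b j * b i).
Proof. by apply: cl_gen_anticomm; rewrite V_form_rr. Qed.
Let abC i j : i != j -> a i * b j = - (b j * a i).
Proof. by move=> /negPf ij; apply: cl_gen_anticomm; rewrite form_lr ij. Qed.
Let baC i j : i != j -> b i * a j = - (a j * b i).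
Proof. by move=> ij; rewrite abC ?opprK // eq_sym. Qed.
Let aa i : a i * a i = 0. Proof. by apply/cl_mul2_eq0/cl_gen_isotropic; rewrite V_form_ll. Qed.
Let bb i : b i * b i = 0. Proof. by apply/cl_mul2_eq0/cl_gen_isotropic; rewrite V_form_rr. Qed.
Let ab1 i : a i * b i + b i * a i = 1.
Proof. by rewrite /a /b cl_genM form_lr eqxx. Qed.

Let p_a i j : i != j -> p i * a j = a j * p i.
Proof. by move=> ij; rewrite /p -[LHS]mulrA (aC i) mulrN !mulrA baC // mulNr opprK. Qed.
Let p_b i j : i != j -> p i * b j = b j * p i.
Proof. by move=> ij; rewrite /p -[LHS]mulrA abC // mulrN !mulrA (bC i) mulNr opprK. Qed.
Let p_p i j : p i * p j = p j * p i.
Proof.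
have [->//|ij] := eqVneq i j.
by rewrite {2}/p mulrA p_b // -mulrA p_a // mulrA.
Qed.
Let b_p i : b i * p i = 0. Proof. by rewrite /p mulrA bb mul0r. Qed.
Let p_a0 i : p i * a i = 0. Proof. by rewrite /p -mulrA aa mulr0. Qed.
Let split1 i : p i + a i * p i * b i = 1.
Proof.
have E : b i * a i = 1 - a i * b i by rewrite -(ab1 i) addrAC subrr add0r.
have -> : a i * p i * b i = a i * b i.
  by rewrite /p E mulrBr mulr1 mulrBl mulrA aa mul0r mul0r subr0.
by rewrite /p addrC ab1.
Qed.

Let p_idem i : p i * p i = p i.
Proof. by rewrite -[RHS]mulr1 -(split1 i) mulrDr !(mulrA (p i)) p_a0 !mul0r addr0. Qed.

Let vac_b r j : j \notin r -> vac r * b j = b j * vac r.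
Proof.
elim: r => [|i r IHr] /=; first by rewrite mulr1 mul1r.
rewrite inE negb_or eq_sym => /andP[ij jr]; rewrite -mulrA IHr //.
by rewrite (mulrA (p i)) p_b // -mulrA.
Qed.
Let p_vac r j : p j * vac r = vac r * p j.
Proof. by elim: r => [|i r IHr] /=; rewrite ?mulr1 ?mul1r // (mulrA (p j)) p_p -mulrA IHr mulrA. Qed.

Let b_vac r j : j \in r -> b j * vac r = 0.
Proof.
elim: r => //= i r IHr; rewrite inE => /orP[/eqP->|jr]; first by rewrite (mulrA (b i)) b_p mul0r.
have [->|ij] := eqVneq i j; first by rewrite (mulrA (b j)) b_p mul0r.
by rewrite (mulrA (b j)) -p_b // -mulrA IHr // mulr0.
Qed.

Let vac_a0 r j : j \in r -> vac r * a j = 0.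
Proof.
elim: r => //= i r IHr; rewrite inE => /orP[/eqP->|jr]; last by rewrite -mulrA IHr // mulr0.
by rewrite p_vac -mulrA p_a0 mulr0.
Qed.

(** By [split1], 1 lies in the two-sided ideal generated by [p i], so the factors [p i] can be
    stripped from both ends one at a time, absorbing a_i and b_i into y and z. *)
Lemma cl_vac_eq0 r x : uniq r -> (forall y z, vac r * y * x * z * vac r = 0) -> x = 0.
Proof.
elim: r x => [|i r IHr] x /=; first by move=> _ /(_ 1 1); rewrite !mulr1 !mul1r.
case/andP=> ir r_uniq x0; apply: IHr => // y z.
have E : vac r = p i * vac r + a i * (p i * vac r) * b i.
  by rewrite -[LHS]mul1r -{1}(split1 i) mulrDl -!mulrA vac_b.
have right u v : p i * vac r * u * x * v * vac r = 0.
  rewrite {2}E mulrDr x0 add0r.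
  by have := x0 u (v * a i); rewrite !mulrA => ->; rewrite mul0r.
rewrite {1}E !mulrDl right add0r.
transitivity (a i * (p i * vac r * (b i * y) * x * z * vac r)); first by rewrite -!mulrA.
by rewrite right mulr0.
Qed.

Let P := vac (enum 'I_m).

(* P projects onto the line of ext_one, and y in C(V) P represents s if y = x P, s = x ext_one
   for some x. *)
Inductive represented : Cl -> ext K m -> Prop :=
| rep_one : represented P ext_one
| rep_lin k y z s t : represented y s -> represented z t -> represented (cl_scal m k * y + z) (k *: s + t)
| rep_gen i y s : represented y s -> represented (a i * y) (wedge (basis_vec K i) s).

Lemma represented0 : represented 0 0.
Proof.
have := rep_lin (-1) rep_one rep_one; rewrite scaleN1r addNr.
suff -> : cl_scal m (-1 : K) * P + P = 0 by [].
rewrite -{2}[P]mul1r -mulrDl -cl_scal1 -cl_scalD addNr cl_scal0 mul0r.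
by [].
Qed.

Lemma represented_act y s x : represented y s -> represented (x * y) (cl_act x s).
Proof.
have rZ k z t : represented z t -> represented (cl_scal m k * z) (k *: t).
  by move=> zt; have := rep_lin k zt represented0; rewrite !addr0.
have rD z t z' t' : represented z t -> represented z' t' -> represented (z + z') (t + t').
  by move=> zt zt'; have := rep_lin 1 zt zt'; rewrite cl_scal1 mul1r scale1r.
have rb j z t : represented z t -> represented (b j * z) (contraction (basis_vec K j) t).
  elim=> {z t} [|k z z' t t' _ IHz _ IHz'|i z t zt IHz].
  - by rewrite contraction_one b_vac ?mem_enum //; apply: represented0.
  - rewrite contractionDr contractionZr mulrDr mulrA -cl_scalC -mulrA.
    exact: rep_lin.
  - rewrite contraction_wedge sum_basis basis_vecE.
    have -> : b j * (a i * z) = cl_scal m (j == i)%:R * z + (- 1) * (a i * (b j * z)).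
      rewrite mulN1r !mulrA -mulNr -mulrDl; congr (_ * z).
      rewrite /a /b; apply/eqP; rewrite eq_sym subr_eq; apply/eqP.
      by rewrite cl_genM V_formC form_lr eq_sym.
    have -> : -1 = cl_scal m (-1) :> Cl.
      by apply/eqP; rewrite eq_sym -addr_eq0 -cl_scal1 -cl_scalD addNr.
    rewrite -scaleN1r; apply: rD; [exact: rZ | apply: rZ].
    by constructor.
elim/cl_ind: x y s => u; elim: u => [k|v|u IHu u' IHu'|u IHu u' IHu'] y s ys.
- by rewrite cl_act_scal; apply: rZ.
- rewrite cl_act_gen -/(cl_gen V_form v) [X in V_act X s](row_mx_basis v) V_act_suml.
  have -> : cl_gen V_form v * y = \sum_i
      (cl_scal m (lsubmx v 0 i) * (a i * y) + cl_scal m (rsubmx v 0 i) * (b i * y)).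
    rewrite {1}(row_mx_basis v); elim/big_rec2: _ => [|i z v' _ IH].
      by rewrite -(scale0r 0) cl_genZ cl_scal0 !mul0r.
    by rewrite !cl_genD !cl_genZ !mulrDl IH !mulrA.
  elim/big_rec2: _ => [|i t z _ zt]; first exact: represented0.
  apply: (rD) => //; rewrite V_actDl !V_actZl V_act_l V_act_r; apply: rD; apply: rZ; last exact: rb.
  by constructor.
- by rewrite cl_piD mulrDl cl_actD; apply: rD; [apply: IHu | apply: IHu'].
- by rewrite cl_piM -mulrA cl_actM; apply: IHu; apply: IHu'.
Qed.

(** P is idempotent and kills every creation operator from the left, so only the coefficient of 1 in
    s survives. *)
Lemma represented_vac y s : represented y s -> P * y = cl_scal m (s finset.set0) * P.
Proof.
elim=> {y s} [|k y z s t _ IHy _ IHz|i y s _ _].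
- rewrite /ext_one ext_monoE eqxx cl_scal1 mul1r /P.
  elim: (enum 'I_m) (enum_uniq 'I_m) => [|i r IHr] /=; first by rewrite mulr1.
  move=> /andP[ir /IHr {}IHr]; rewrite -(mulrA (p i)) (mulrA (vac r)) -p_vac.
  by rewrite -(mulrA (p i)) IHr (mulrA (p i)) p_idem.
- by rewrite mulrDr mulrA -cl_scalC -mulrA IHy IHz ext_addE ext_scaleE cl_scalD cl_scalM mulrDl mulrA.
- by rewrite mulrA vac_a0 ?mem_enum // mul0r wedge_basisE inE mul0r cl_scal0 mul0r.
Qed.

(** For all y and z, P y x z P is P times a scalar, namely the coefficient of 1 in y x z applied to
    1. This coefficient is 0 if x acts by 0, and then [cl_vac_eq0] applies. *)
Theorem cl_act_faithful x : (forall s, cl_act x s = 0) -> x = 0.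
Proof.
move=> x0; apply: (cl_vac_eq0 (enum_uniq 'I_m)) => y z.
have := represented_vac (represented_act (y * (x * z)) rep_one).
rewrite !cl_actM x0 cl_act0 ext_zeroE cl_scal0 mul0r => <-.
by rewrite /P !mulrA.
Qed.

Lemma vac_act_one : cl_act P ext_one = ext_one.
Proof.
rewrite /P; elim: (enum 'I_m) => [|i r IHr]; first exact: cl_act1.
rewrite /= !cl_actM IHr !cl_act_gen V_act_l V_act_r contraction_wedge contraction_one.
by rewrite sum_basis basis_vecE eqxx scale1r wedge0r subr0.
Qed.

Lemma vac_act s : cl_act P s = s finset.set0 *: ext_one.
Proof.
elim/ext_ind: s => [|k s t IHs IHt|v s _].
- by rewrite vac_act_one /ext_one ext_monoE eqxx scale1r.
- by rewrite cl_act_linear IHs IHt ext_addE ext_scaleE scalerDl scalerA.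
have Pw i : cl_act P (wedge (basis_vec K i) s) = 0.
  by rewrite -V_act_l -(cl_act_gen (row_mx _ 0)) -cl_actM vac_a0 ?mem_enum // cl_act0l.
rewrite [X in X *: _](_ : _ = 0 :> K); last by rewrite wedgeE big_set0.
rewrite scale0r (row_basis v) wedge_suml cl_act_sum big1 // => i _.
by rewrite wedgeZl -[_ *: _]addr0 cl_act_linear Pw cl_act0 scaler0 addr0.
Qed.

(** The rank-one operators s |-> s_I t generate. Such an operator is x P y, where y moves the
    coordinate at I to the empty set, P projects onto the line of 1 and x creates t from 1. *)
Theorem cl_act_surjective (T : ext K m -> ext K m) :
  (forall k s t, T (k *: s + t) = k *: T s + T t) -> exists x, forall s, cl_act x s = T s.
Proof.
move=> T_lin; have T0 : T 0 = 0.
  by apply: (addrI (T 0)); rewrite -{1}[T 0]scale1r -T_lin scale1r !addr0.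
have create t : exists x, cl_act x ext_one = t.
  elim/ext_ind: t => [|k s t [x xs] [y yt]|v s [x xs]]; first by exists 1; apply: cl_act1.
    by exists (cl_scal m k * x + y); rewrite cl_actD cl_actM cl_act_scal xs yt.
  by exists (cl_gen V_form (row_mx v 0) * x); rewrite cl_actM xs cl_act_gen V_act_l.
have annihilate (I : {set 'I_m}) : exists x, forall s, cl_act x s finset.set0 = s I :> K.
  have [k] := ubnP #|I|; elim: k I => // k IHk I Ik.
  have [->|[i iI]] := set_0Vmem I; first by exists 1 => s; rewrite cl_act1.
  have [|x xE] := IHk (I :\ i); first by rewrite (cardsD1 i I) iI in Ik.
  exists (x * (cl_scal m (ext_sign K i I) * b i)) => s.
  rewrite !cl_actM xE cl_act_scal cl_act_gen V_act_r ext_scaleE contraction_basisE !inE eqxx /=.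
  have -> : ext_sign K i I = ext_sign K i (I :\ i) by rewrite -{1}(finset.setD1K iI) ext_sign_U1.
  by rewrite finset.setD1K // mul1r mulrA ext_sign_sqr mul1r.
have rank1 I t : exists x, forall s, cl_act x s = (s I : K) *: t.
  have [x xt] := create t; have [y yI] := annihilate I.
  exists (x * P * y) => s; rewrite !cl_actM vac_act yI.
  by rewrite -[_ *: ext_one]addr0 cl_act_linear cl_act0 addr0 xt.
have sums (r : seq {set 'I_m}) :
    exists x, forall s, cl_act x s = \sum_(I <- r) (s I : K) *: T (ext_mono I).
  elim: r => [|I r [x xE]]; first by exists 0 => s; rewrite big_nil cl_act0l.
  have [y yE] := rank1 I (T (ext_mono I)).
  by exists (y + x) => s; rewrite big_cons cl_actD yE xE.
have [x xE] := sums (index_enum _); exists x => s; rewrite xE [in RHS](ext_mono_sum s).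
by elim/big_rec2: _ => [|I y z _ ->]; rewrite ?T0 ?T_lin.
Qed.

(** Schur's lemma: the image of 1 is killed by all contractions, hence is a multiple of 1, and 1
    generates the spinors under wedging. *)
Lemma commuting_scalar (T : ext K m -> ext K m) :
  (forall k s t, T (k *: s + t) = k *: T s + T t) -> (forall v s, T (V_act v s) = V_act v (T s)) ->
  exists k, forall s, T s = k *: s.
Proof.
move=> T_lin T_act; exists (T ext_one finset.set0).
have T0 : T 0 = 0.
  by apply: (addrI (T 0)); rewrite -{1}[T 0]scale1r -T_lin scale1r !addr0.
have T1 : T ext_one = (T ext_one finset.set0 : K) *: ext_one.
  apply/ffunP => L; rewrite ext_scaleE /ext_one [in RHS]ext_monoE.
  have [->|[i iL]] := set_0Vmem L; first by rewrite eqxx mulr1.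
  have -> : (L == finset.set0) = false by apply/eqP => L0; rewrite L0 inE in iL.
  rewrite mulr0; have /ffunP/(_ (L :\ i)) : contraction (basis_vec K i) (T ext_one) = 0.
    by rewrite -V_act_r -T_act V_act_r contraction_one.
  rewrite contraction_basisE ext_zeroE !inE eqxx mul1r finset.setD1K // => /eqP.
  by rewrite mulf_eq0 signr_eq0 => /eqP.
elim/ext_ind => [|k s t IHs IHt|v s IHs]; first exact: T1.
  by rewrite T_lin IHs IHt scalerDr !scalerA mulrC.
by rewrite -V_act_l T_act IHs V_actZ.
Qed.

End Faithful.

(** * Lifting isometries to the spin group *)

Section SpinLift.
Variables (R : realType) (X : abelian_surface R) (K : numFieldType).
Local Notation Cl := (clifford (@V_form K 4)).
Local Notation gen := (cl_gen (@V_form K 4)).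
Implicit Types (x y : Cl) (s t : ext K 4).

Lemma ext_even_odd_eq0 s : ext_even s -> ext_odd s -> s = 0.
Proof.
by move=> se so; apply/ffunP => I; rewrite ext_zeroE; have [/se|/so] := boolP (odd #|I|).
Qed.

Lemma cl_homog_split (u : cl_expr 'rV[K]_(4 + 4)) : exists u0 u1,
  [/\ cl_homog false u0, cl_homog true u1 & cl_pi V_form u = cl_pi V_form u0 + cl_pi V_form u1].
Proof.
have gen0 : cl_pi V_form (CGen (0 : 'rV[K]_(4 + 4))) = 0.
  by rewrite -[LHS]/(gen 0) -(scale0r 0) cl_genZ cl_scal0 mul0r.
elim: u => [k|v|u [u0 [u1 [h0 h1 uE]]] u' [u0' [u1' [h0' h1' uE']]]|
    u [u0 [u1 [h0 h1 uE]]] u' [u0' [u1' [h0' h1' uE']]]].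
- by exists (CScal _ k), (CGen 0); split; [constructor | constructor | rewrite gen0 addr0].
- by exists (CScal _ 0), (CGen v); split; [constructor | constructor | rewrite -[cl_pi _ (CScal _ 0)]/(cl_scal 4 0) cl_scal0 add0r].
- exists (CAdd u0 u0'), (CAdd u1 u1'); split; try by constructor.
  by rewrite !cl_piD uE uE' addrACA.
exists (CAdd (CMul u0 u0') (CMul u1 u1')), (CAdd (CMul u0 u1') (CMul u1 u0')); split.
- by constructor; [apply: (homog_mul h0 h0') | apply: (homog_mul h1 h1')].
- by constructor; [apply: (homog_mul h0 h1') | apply: (homog_mul h1 h0')].
by rewrite !(cl_piD, cl_piM) uE uE' mulrDl !mulrDr [cl_pi _ u1 * cl_pi _ u0' + _]addrC addrACA.
Qed.

Definition ext_parity (p : bool) s : Prop := if p then ext_odd s else ext_even s.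

Lemma ext_parity_act p q (u : cl_expr 'rV[K]_(4 + 4)) s :
  cl_homog p u -> ext_parity q s -> ext_parity (p (+) q) (expr_act u s).
Proof.
move=> hu; elim: hu q s => {p u} [k|v|p u u' _ IHu _ IHu'|p p' u u' _ IHu _ IHu'] q s sq /=.
- by case: q sq => sq; [apply: ext_oddZ | apply: ext_evenZ].
- by case: q sq => sq; [apply: V_act_odd | apply: V_act_even].
- have := IHu q s sq; have := IHu' q s sq.
  by case: (p (+) q) => /= a b; [apply: ext_oddD | apply: ext_evenD].
- by rewrite -addbA; apply: IHu; apply: IHu'.
Qed.

(** Any x is the sum of an even and an odd element. If x preserves parity, the odd summand both
    preserves and reverses it, so it acts by 0 and vanishes by faithfulness. *)
Lemma cl_even_parity x : (forall s, ext_even s -> ext_even (cl_act x s)) ->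
  (forall s, ext_odd s -> ext_odd (cl_act x s)) -> cl_even x.
Proof.
elim/cl_ind: x => u xe xo; have [u0 [u1 [h0 h1 uE]]] := cl_homog_split u.
suff u10 : cl_pi V_form u1 = 0 by exists u0; rewrite // uE u10 addr0.
apply: cl_act_faithful; have actE s : cl_act (cl_pi V_form u1) s = cl_act (cl_pi V_form u) s + (-1) *: cl_act (cl_pi V_form u0) s.
  by rewrite uE cl_actD scaleN1r addrAC subrr add0r.
elim/ext_parts => [s t IHs IHt|s s_even|s s_odd].
- by rewrite -[s]scale1r cl_act_linear IHs IHt scaler0 addr0.
- apply: ext_even_odd_eq0; last by rewrite cl_actE; apply: (ext_parity_act (q := false) h1).
  rewrite actE; apply: ext_evenD; first exact: xe.
  by apply: ext_evenZ; rewrite cl_actE; apply: (ext_parity_act (q := false) h0).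
- apply: ext_even_odd_eq0; first by rewrite cl_actE; apply: (ext_parity_act (q := true) h1).
  rewrite actE; apply: ext_oddD; first exact: xo.
  by apply: ext_oddZ; rewrite cl_actE; apply: (ext_parity_act (q := true) h0).
Qed.

Lemma cl_act_inj x y : (forall s, cl_act x s = cl_act y s) -> x = y.
Proof.
move=> xy; apply/eqP; rewrite -subr_eq0; apply/eqP/cl_act_faithful => s.
by rewrite cl_actD cl_actNl xy subrr.
Qed.

(** T comes from some x by surjectivity, and faithfulness lets each condition defining the spin
    group be tested on spinors; x^* is the inverse because T preserves the pairing. *)
Lemma spin_of_operator (g : 'M[K]_(4 + 4)) (T : ext K 4 -> ext K 4) :
  (forall k s t, T (k *: s + t) = k *: T s + T t) ->
  (forall s, ext_even s -> ext_even (T s)) -> (forall s, ext_odd s -> ext_odd (T s)) ->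
  (forall s t, S_form X (T s) (T t) = S_form X s t) ->
  (forall v s, T (V_act v s) = V_act (v *m g) (T s)) ->
  exists x, [/\ Spin x, cl_induces x g & forall s, cl_act x s = T s].
Proof.
move=> T_lin T_even T_odd T_isom T_act; have [x xT] := cl_act_surjective T_lin.
have x_even : cl_even x by apply: cl_even_parity => s; rewrite xT; [apply: T_even | apply: T_odd].
have xx' s : cl_act (cl_star x) (cl_act x s) = s.
  apply/eqP; rewrite -subr_eq0; apply/eqP/(S_form_nondeg (X := X)) => t.
  rewrite S_formDl S_formNl S_formC -cl_act_adj // !xT T_isom S_formC subrr.
  by [].
have xx s : cl_act x (cl_act (cl_star x) s) = s.
  by apply: (linear_inverse (T := cl_act (cl_star x)) (T' := cl_act x)) => // *; apply: cl_act_linear.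
have ind : cl_induces x g.
  move=> v; apply: cl_act_inj => s; rewrite !cl_actM !cl_act_gen xT T_act -xT.
  by rewrite xx.
exists x; split=> //; split=> //; last by move=> v; eexists; apply: ind.
by apply: cl_act_inj => s; rewrite cl_actM xx cl_act1.
Qed.

(** Here x^3 serves as an inverse of x: since g^4 = 1, y x^3 commutes with V, hence is a scalar k.
    So y = k x, and the norm condition gives k^2 = 1. *)
Lemma spin_lift_unique (g : 'M[K]_(4 + 4)) x y :
  g ^+ 4 = 1 -> Spin x -> cl_induces x g -> (forall s, cl_act (x ^+ 4) s = s) ->
  Spin y -> cl_induces y g -> y = x \/ y = - x.
Proof.
move=> g4 x_spin xg x4 y_spin yg.
have xv v s := Spin_act v s x_spin xg; have yv v s := Spin_act v s y_spin yg.
have [k kE] : exists k, forall s, cl_act (y * (x * (x * x))) s = k *: s.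
  apply: commuting_scalar => [k s t|v s]; first exact: cl_act_linear.
  rewrite !cl_actM !xv yv -!mulmxA; congr V_act.
  by rewrite -[RHS](mulmx1 v) -[1%:M](g4) !exprS expr0 mulr1.
have yE : y = cl_scal 4 k * x.
  apply: cl_act_inj => s; rewrite cl_actM cl_act_scal -kE -{1}(x4 s) !exprS expr0 mulr1.
  by rewrite !cl_actM.
have k2 : k * k = 1.
  case: y_spin => _ yy _; case: x_spin => _ xx _; move: yy.
  rewrite yE cl_starM cl_star_scal -mulrA (mulrA x) xx mul1r -cl_scalM => /(congr1 (fun z : Cl => cl_act z ext_one)).
  rewrite cl_act_scal cl_act1 => /ffunP/(_ finset.set0).
  by rewrite ext_scaleE /ext_one ext_monoE eqxx mulr1.
have /eqP : k ^+ 2 = 1 by [].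
rewrite sqrf_eq1 yE => /orP[/eqP->|/eqP->]; [left | right].
  by rewrite cl_scal1 mul1r.
by apply: cl_act_inj => s; rewrite cl_actM cl_act_scal cl_actNl scaleN1r.
Qed.

End SpinLift.

(** * Eigenspaces of a complex structure *)

Section Eigenspaces.
Variables (K : numFieldType).
Variables (J : 'M[K]_(4 + 4)) (iota : K).
Hypotheses (J2 : J *m J = - 1%:M) (J_isom : V_isometry J) (i2 : iota ^+ 2 = -1).

Lemma eigenspace_isotropic : isotropic (eigenspace J iota).
Proof.
move=> u v /eigenspaceP uE /eigenspaceP vE; have := J_isom u v.
rewrite uE vE V_formZl V_formZr mulrA -expr2 i2 mulN1r => /eqP.
by rewrite eq_sym -addr_eq0 -mulr2n mulrn_eq0 => /eqP.
Qed.

Lemma eigen_proj (v : 'rV[K]_(4 + 4)) :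
  let u := 2^-1 *: (v - iota *: (v *m J)) in
  (u <= eigenspace J iota)%MS /\ (v - u <= eigenspace J (- iota))%MS.
Proof.
have J2v : v *m J *m J = - v by rewrite -mulmxA J2 mulmxN mulmx1.
have ii : iota * iota = -1 by rewrite -expr2.
set u := 2^-1 *: (v - iota *: (v *m J)).
have u2 : u + u = v - iota *: (v *m J) by rewrite -scalerDl (_ : 2^-1 + 2^-1 = 1) ?scale1r // [RHS]splitr mul1r.
have uJ : u *m J = iota *: u.
  rewrite -scalemxAl mulmxDl mulNmx -scalemxAl J2v scalerN opprK scalerA mulrC -scalerA.
  by rewrite scalerBr scalerA ii scaleN1r opprK addrC.
split; first exact/eigenspaceP; apply/eigenspaceP.
rewrite mulmxDl mulNmx uJ scaleNr scalerBr opprB; apply/eqP.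
by rewrite subr_eq addrAC -scalerDr u2 scalerBr scalerA ii scaleN1r opprK addrAC subrr add0r.
Qed.

End Eigenspaces.

(** Let W be isotropic and contain the eigenspace. The component in the opposite eigenspace of a
    vector of W lies in W, so it is orthogonal to both eigenspaces and vanishes. *)
Lemma eigenspace_maximal_isotropic (K : numFieldType) (J : 'M[K]_(4 + 4)) (iota : K) :
  J *m J = - 1%:M -> V_isometry J -> iota ^+ 2 = -1 -> maximal_isotropic (eigenspace J iota).
Proof.
move=> J2 J_isom i2; split; first exact: eigenspace_isotropic.
move=> W W_isot JW; apply/row_subP => k; set v := row k W.
have vW : (v <= W)%MS by apply: row_sub.
have [] := eigen_proj J2 i2 v; set u := _ *: _ => uE vuE.
suff vu0 : v - u = 0 by rewrite -[v](subrK u) vu0 add0r.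
have uW : (v - u <= W)%MS by rewrite addmx_sub // eqmx_opp (submx_trans uE).
apply: V_form_nondeg => z.
have [] := eigen_proj J2 i2 z; set z1 := _ *: _ => z1E zz1E.
rewrite -[z](subrK z1) V_formDr; have -> : V_form (v - u) z1 = 0.
  by apply: W_isot => //; apply: submx_trans z1E JW.
rewrite addr0; apply: (eigenspace_isotropic J_isom (iota := - iota)) => //.
by rewrite sqrrN.
Qed.

Section PairEigen.
Variables (R : realType) (X : abelian_surface R) (K : numFieldType).
Variables (xi eta : ext K 4).
Hypothesis pair_orth : orthogonal_pair X xi eta.

(** One has (v J - iota v) eta = - v (xi + iota eta), and only the zero vector kills eta. This
    identifies V^{1,0} with Z_l and V^{0,1} with its conjugate. *)
Lemma eigen_act iota v : iota ^+ 2 = -1 ->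
  (v <= eigenspace (plane_J X xi eta) iota)%MS <-> V_act v (xi + iota *: eta) = 0.
Proof.
move=> i2; have ii : iota * iota = -1 by rewrite -expr2.
rewrite V_actD V_actZ; split=> [/eigenspaceP vJ|vs0].
  have := plane_J_eta pair_orth v; rewrite vJ V_actZl => ->.
  by rewrite subrr.
apply/eigenspaceP; apply/eqP; rewrite -subr_eq0; apply/eqP.
apply: (V_act_inj (X := X) (s := eta)); first by case: pair_orth => _ _ ? ->.
rewrite V_actDl V_actNl V_actZl (plane_J_eta pair_orth).
by rewrite -opprD vs0 oppr0.
Qed.

End PairEigen.

Lemma map_orthogonal_pair (R : realType) (X : abelian_surface R) (K L : numFieldType)
    (f : {rmorphism K -> L}) xi eta :
  orthogonal_pair X xi eta -> orthogonal_pair X (ext_apply f xi) (ext_apply f eta).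
Proof.
case=> xe ee N0 Ne xe0; split; rewrite ?S_form_apply ?Ne ?xe0 ?rmorph0 ?fmorph_eq0 //.
- by move=> I oI; rewrite ext_applyE xe ?rmorph0.
- by move=> I oI; rewrite ext_applyE ee ?rmorph0.
Qed.

Lemma map_plane_J (R : realType) (X : abelian_surface R) (K L : numFieldType)
    (f : {rmorphism K -> L}) xi eta : orthogonal_pair X xi eta ->
  map_mx f (plane_J X xi eta) = plane_J X (ext_apply f xi) (ext_apply f eta).
Proof.
move=> pair; have pairL := map_orthogonal_pair f pair.
apply/row_matrixP => k; apply/eqP; rewrite -subr_eq0; apply/eqP.
apply: (V_act_inj (X := X) (s := ext_apply f eta)); first by case: pairL => _ _ ? ->.
rewrite V_actDl V_actNl [row k (plane_J _ _ _)]rowE (plane_J_eta pairL) opprK.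
rewrite -map_row -ext_apply_V_act rowE (plane_J_eta pair) ext_applyN ext_apply_V_act map_delta_mx.
by rewrite addNr.
Qed.

(** * Hodge types and the isometries a + b J *)

Section HodgeType.
Variables (R : realType) (J : 'M[R]_(4 + 4)).
Local Notation C := R[i].
Local Notation JC := (map_mx (real_complex R) J).
Hypothesis (J2 : J *m J = - 1%:M).
Implicit Types (c d : ext C (4 + 4)).

Lemma hodge_type_add p q c d : hodge_type J p q c -> hodge_type J p q d -> hodge_type J p q (c + d).
Proof.
case=> [N1 [a1 [u1 [v1 [hu1 hv1 ->]]]]] [N2 [a2 [u2 [v2 [hu2 hv2 ->]]]]].
pose glue T (f1 : 'I_N1 -> T) (f2 : 'I_N2 -> T) (i : 'I_(N1 + N2)) :=
  match split i with inl j => f1 j | inr j => f2 j end.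
have glue_l T f1 f2 j : @glue T f1 f2 (lshift _ j) = f1 j by rewrite /glue split_lshift.
have glue_r T f1 f2 j : @glue T f1 f2 (rshift _ j) = f2 j by rewrite /glue split_rshift.
exists (N1 + N2)%N, (glue _ a1 a2), (glue _ u1 u2), (glue _ v1 v2); split.
- by move=> i x; rewrite /glue; case: split => j; [apply: hu1 | apply: hu2].
- by move=> i x; rewrite /glue; case: split => j; [apply: hv1 | apply: hv2].
rewrite big_split_ord /=; congr (_ + _); apply: eq_bigr => i _.
  by rewrite !glue_l.
by rewrite !glue_r.
Qed.

Lemma hodge_type_scale p q k c : hodge_type J p q c -> hodge_type J p q (k *: c).
Proof.
case=> [N1 [a1 [u1 [v1 [hu1 hv1 ->]]]]]; exists N1, (fun i => k * a1 i), u1, v1; split=> //.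
by rewrite scaler_sumr; apply: eq_bigr => i _; rewrite scalerA.
Qed.

Lemma hodge_type0 p q : hodge_type J p q 0.
Proof.
exists 0%N, (fun=> 0), (fun=> [tuple of nseq p 0]), (fun=> [tuple of nseq q 0]).
by split; [case | case | rewrite big_ord0].
Qed.

Lemma wedge_cat m (a : 'rV[C]_m) (us vs : seq 'rV[C]_m) :
  wedge a (ext_prod (us ++ vs)) = (-1) ^+ size us *: ext_prod (us ++ a :: vs).
Proof.
elim: us => [|u us IHus] /=; first by rewrite scale1r wedge_def.
by rewrite !wedge_def wedgeC IHus wedgeZr exprS mulN1r scaleNr.
Qed.

Lemma hodge_type_wedge10 p q a c : (a <= V10 J)%MS -> hodge_type J p q c ->
  hodge_type J p.+1 q (wedge a c).
Proof.
move=> aV [N1 [a1 [u1 [v1 [hu1 hv1 ->]]]]].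
exists N1, a1, (fun i => [tuple of a :: u1 i]), v1; split=> //.
  by move=> i x; rewrite inE => /orP[/eqP->|] //; apply: hu1.
rewrite wedge_sumr; apply: eq_bigr => i _; rewrite wedgeZr; congr (_ *: _).
by rewrite /= wedge_def.
Qed.

Lemma hodge_type_wedge01 p q a c : (a <= V01 J)%MS -> hodge_type J p q c ->
  hodge_type J p q.+1 (wedge a c).
Proof.
move=> aV [N1 [a1 [u1 [v1 [hu1 hv1 ->]]]]].
exists N1, (fun i => (-1) ^+ p * a1 i), u1, (fun i => [tuple of a :: v1 i]); split=> //.
  by move=> i x; rewrite inE => /orP[/eqP->|] //; apply: hv1.
rewrite wedge_sumr; apply: eq_bigr => i _; rewrite wedgeZr wedge_cat size_tuple scalerA mulrC.
by [].
Qed.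

Lemma JC2 : JC *m JC = - 1%:M.
Proof. by rewrite -map_mxM J2 map_mxN map_mx1. Qed.

Lemma sqr_imag : ('i%C : C) ^+ 2 = -1. Proof. exact: sqr_i. Qed.

Lemma hodge_decomposition (vs : seq 'rV[C]_(4 + 4)) : exists h : nat -> ext C (4 + 4),
  (forall p, hodge_type J p (size vs - p) (h p)) /\
  ext_prod vs = \sum_(p < (size vs).+1) h p.
Proof.
elim: vs => [|v vs [h [hH hE]]] /=.
  exists (fun p => (p == 0%N)%:R *: ext_one); split; last by rewrite big_ord1 scale1r.
  case=> [|p]; rewrite ?scale0r ?scale1r; last exact: hodge_type0.
  exists 1%N, (fun=> 1), (fun=> [tuple]), (fun=> [tuple]).
  by split=> //; rewrite big_ord1 scale1r.
have [] := eigen_proj JC2 sqr_imag v; set u := _ *: _; set s := size vs; clearbody u => uE vuE.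
(* Past the top index the truncated difference [size vs - p] no longer grows with [vs], so those
   components are set to 0. *)
exists (fun p => (if p is p'.+1 then (if (p' <= s)%N then wedge u (h p') else 0) else 0)
   + (if (p <= s)%N then wedge (v - u) (h p) else 0)); split.
  move=> p; apply: hodge_type_add.
    case: p => [|p]; first exact: hodge_type0.
    rewrite subSS; case: ifP => _; last exact: hodge_type0.
    exact: (hodge_type_wedge10 uE (hH p)).
  case: ifP => ps; last exact: hodge_type0.
  by rewrite subSn //; exact: (hodge_type_wedge01 vuE (hH p)).
rewrite wedge_def -{1}[v](subrK u) addrC wedgeDl hE big_split /=; congr (_ + _).
  rewrite wedge_sumr [RHS]big_ord_recl /= add0r; apply: eq_bigr => p _.
  by rewrite /bump /= -ltnS ltn_ord.
rewrite wedge_sumr [RHS]big_ord_recr /= ltnn addr0; apply: eq_bigr => p _.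
by rewrite -ltnS ltn_ord.
Qed.

Lemma hodge_decomposition_deg k c : ext_deg k c -> exists h : nat -> ext C (4 + 4),
  (forall p, hodge_type J p (k - p) (h p)) /\ c = \sum_(p < k.+1) h p.
Proof.
move=> c_deg; have [h hP] : exists h : {set 'I_(4 + 4)} -> nat -> ext C (4 + 4), forall I,
    (forall p, hodge_type J p (k - p) (h I p)) /\ c I *: ext_mono I = \sum_(p < k.+1) h I p.
  suff H I : exists h, (forall p, hodge_type J p (k - p) (h p)) /\ c I *: ext_mono I = \sum_(p < k.+1) h p.
    by exists (fun I => sval (cid (H I))) => I; case: (cid (H I)).
  have [Ik|Ik] := eqVneq #|I| k; last first.
    exists (fun=> 0); split; first by move=> p; apply: hodge_type0.
    by rewrite c_deg // scale0r big1.
  have [h [hH hE]] := hodge_decomposition [seq row j 1%:M | j <- enum I].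
  rewrite size_map -cardE Ik in hH hE; exists (fun p => c I *: h p); split.
    by move=> p; apply: hodge_type_scale.
  by rewrite -scaler_sumr -hE -ext_map_mono ext_map1.
exists (fun p => \sum_I h I p); split.
  move=> p; elim/big_ind: _ => [|x y hx hy|I _]; first exact: hodge_type0.
    exact: hodge_type_add.
  by have [] := hP I.
rewrite exchange_big /= [LHS]ext_mono_sum; apply: eq_bigr => I _.
by have [] := hP I.
Qed.

Lemma ext_map_hodge_type a b p q c : hodge_type J p q c ->
  ext_map (a%:M + b *: JC) c = ((a + b * 'i%C) ^+ p * (a - b * 'i%C) ^+ q) *: c.
Proof.
case=> [N1 [a1 [u1 [v1 [hu1 hv1 ->]]]]]; rewrite ext_map_sum scaler_sumr; apply: eq_bigr => i _.
rewrite ext_mapZ ext_map_prod scalerA mulrC -scalerA; congr (_ *: _).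
have scal (k : C) (us vs : seq 'rV[C]_(4 + 4)) : (forall x, x \in us -> x *m (a%:M + b *: JC) = k *: x) ->
    ext_prod ([seq x *m (a%:M + b *: JC) | x <- us] ++ vs) = k ^+ size us *: ext_prod (us ++ vs).
  elim: us => [|u us IHus] us_eig /=; first by rewrite scale1r.
  rewrite !wedge_def us_eig ?mem_head // IHus => [|x xu]; last by rewrite us_eig // inE xu orbT.
  by rewrite wedgeZl wedgeZr scalerA exprS.
have eig k x : x *m JC = k *: x -> x *m (a%:M + b *: JC) = (a + b * k) *: x.
  by move=> xk; rewrite mulmxDr mul_mx_scalar -scalemxAr xk scalerA -scalerDl.
rewrite map_cat (scal (a + b * 'i%C)) ?size_tuple => [|x /hu1/eigenspaceP/eig //].
rewrite -scalerA; congr (_ *: _).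
have swap (us vs : seq 'rV[C]_(4 + 4)) k t : ext_prod vs = k *: ext_prod t ->
    ext_prod (us ++ vs) = k *: ext_prod (us ++ t).
  by move=> E; elim: us => //= u us IHus; rewrite !wedge_def IHus wedgeZr.
apply: swap; rewrite -[map _ _]cats0 (scal (a - b * 'i%C)) ?size_tuple ?cats0 // => x.
by move=> /hv1/eigenspaceP/eig ->; rewrite mulrN.
Qed.

Lemma hodge_type_invariant (a b : C) c : ext_deg 4 c ->
  (a + b * 'i%C) * (a - b * 'i%C) = 1 -> (a + b * 'i%C) ^+ 4 != 1 ->
  ext_map (a%:M + b *: JC) c = c -> hodge_type J 2 2 c.
Proof.
move=> c_deg ab ab4 cE; have [h [hH hE]] := hodge_decomposition_deg c_deg.
pose la := a + b * 'i%C; pose mu := a - b * 'i%C.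
pose th (p : nat) : C := la ^+ p * mu ^+ (4 - p).
(* ext_map (a + b J) acts on the part of type (p, 4 - p) by th p, which is 1 only if p = 2. *)
have powers k : \sum_(p < 5) th p ^+ k *: h p = c.
  elim: k => [|k IHk]; first by rewrite [RHS]hE; apply: eq_bigr => p _; rewrite expr0 scale1r.
  rewrite -[RHS]cE -IHk ext_map_sum; apply: eq_bigr => p _.
  by rewrite ext_mapZ (ext_map_hodge_type _ _ (hH p)) scalerA exprSr.
have polys (Q : {poly C}) : \sum_(p < 5) Q.[th p] *: h p = Q.[1] *: c.
  rewrite horner_coef scaler_suml.
  under eq_bigr => p _ do rewrite horner_coef scaler_suml.
  rewrite exchange_big; apply: eq_bigr => k _ /=; rewrite expr1n mulr1 -(powers k) scaler_sumr.
  by apply: eq_bigr => p _; rewrite scalerA.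
have ab1 : la * mu = 1 by [].
have la2 : la ^+ 2 != 1 by apply: contraNneq ab4 => la2; rewrite -/la (exprM la 2 2) la2 expr1n.
have mu4 k : la ^+ k != 1 -> mu ^+ k != 1.
  by apply: contraNneq => muk; rewrite -[la ^+ k]mulr1 -[X in _ * X]muk -exprMn ab1 expr1n eqxx.
have th0 : th 0%N != 1 by rewrite /th mul1r; apply: mu4.
have th1 : th 1%N != 1 by rewrite /th expr1 exprS mulrA ab1 mul1r; apply: mu4.
have th2 : th 2%N = 1 by rewrite /th -exprMn ab1 expr1n.
have th3 : th 3%N != 1 by rewrite /th expr1 exprSr -mulrA ab1 mulr1.
have th4 : th 4%N != 1 by rewrite /th mulr1.
(* Q vanishes at the eigenvalues of the other four types and not at 1, so applying it to the
   operator isolates the component of type (2, 2). The other eigenvalues may coincide. *)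
pose Q : {poly C} := ('X - (th 0%N)%:P) * ('X - (th 1%N)%:P) * ('X - (th 3%N)%:P) * ('X - (th 4%N)%:P).
have QE z : Q.[z] = (z - th 0%N) * (z - th 1%N) * (z - th 3%N) * (z - th 4%N).
  by rewrite /Q !hornerM !hornerXsubC.
have Q1 : Q.[1] != 0 by rewrite QE !mulf_neq0 // subr_eq0 eq_sym.
have := polys Q; rewrite !big_ord_recl big_ord0 /= /bump /= !add1n.
rewrite th2 (QE (th 0%N)) (QE (th 1%N)) (QE (th 3%N)) (QE (th 4%N)).
rewrite !subrr !(mul0r, mulr0, scale0r, add0r, addr0) => /(can_inj (scalerK Q1)) <-.
exact: hH.
Qed.

End HodgeType.

(** * A negative pair satisfies (a), (b) and (c) *)

Section RealPair.
Variables (R : realType) (X : abelian_surface R) (n : nat).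
Variables xi eta : ext R 4.
Hypothesis pair_orth : orthogonal_pair X xi eta.
Hypotheses (xi_neg : S_form X xi xi < 0) (xi_w : w_perp X n xi) (eta_w : w_perp X n eta).
Local Notation J := (plane_J X xi eta).
Local Notation N := (S_form X xi xi).
Local Notation rho := (plane_rot X xi eta 0 1).

Let one01 : 0 ^+ 2 + 1 ^+ 2 = 1 :> R. Proof. by rewrite expr0n expr1n add0r. Qed.
Let xi_even : ext_even xi. Proof. by case: pair_orth. Qed.
Let eta_even : ext_even eta. Proof. by case: pair_orth. Qed.
Let N_neq0 : N != 0. Proof. by case: pair_orth. Qed.
Let form_eta : S_form X eta eta = N. Proof. by case: pair_orth. Qed.
Let form_xe : S_form X xi eta = 0. Proof. by case: pair_orth. Qed.

(** From (1 + A)^2 = 2 A the determinant is a square up to a positive factor, hence nonnegative, and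
    its own square is 1. *)
Lemma complex_structure_det (A : 'M[R]_(4 + 4)) : A *m A = - 1%:M -> \det A = 1.
Proof.
move=> A2; have sq : (1%:M + A) *m (1%:M + A) = 2 *: A.
  rewrite mulmxDl mul1mx mulmxDr mulmx1 A2 [A + - _]addrC addrACA subrr add0r.
  by rewrite scaler_nat mulr2n.
have pos : 0 <= \det A.
  have := congr1 determinant sq; rewrite det_mulmx detZ -expr2 => E.
  have : 0 <= 2 ^+ (4 + 4) * \det A by rewrite -E sqr_ge0.
  by rewrite pmulr_rge0 // exprn_gt0.
have := congr1 determinant A2; rewrite det_mulmx -scaleN1r detZ det1 mulr1 -expr2.
rewrite (_ : (-1) ^+ (4 + 4) = 1 :> R) => [/eqP|]; last by rewrite -signr_odd.
rewrite sqrf_eq1 => /orP[/eqP//|/eqP A1]; move: pos; rewrite A1.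
by rewrite oppr_ge0 ler10.
Qed.

Lemma plane_rot_J v s : rho (V_act v s) = V_act (v *m J) (rho s).
Proof. by rewrite plane_rot_act // (_ : 0%:M + 1 *: J = J) // scale1r raddf0 add0r. Qed.

(** On even spinors b enters only through b^2 and a b, so for a = 0 the inverse rotation, with - b,
    coincides with rho. *)
Lemma plane_rot_even_sqr s : ext_even s -> rho (rho s) = s.
Proof.
move=> s_even; rewrite -[RHS](plane_rotK pair_orth one01); set t := rho s.
have t_even : ext_even t by apply: plane_rot_even_parity.
rewrite !plane_rotE odd_part_even // plane_j0 !scaler0.
by rewrite sqrrN !(mulr0, mul0r, oppr0).
Qed.

Lemma plane_rot_odd_sqr s : ext_odd s -> rho (rho s) = - s.
Proof.
move=> s_odd; rewrite (plane_rot_odd pair_orth _ _ s_odd) scale0r add0r scale1r.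
rewrite plane_rot_odd //; last exact: plane_j_odd.
by rewrite scale0r add0r scale1r plane_j_sqr.
Qed.

Lemma plane_rot_four s : rho (rho (rho (rho s))) = s.
Proof.
elim/ext_parts: s => [s t IHs IHt|s s_even|s s_odd].
- have rD s' t' : rho (s' + t') = rho s' + rho t' by exact: plane_rotD.
  by move: (rho) rD IHs IHt => f fD IHs IHt; rewrite !fD IHs IHt.
- by rewrite (plane_rot_even_sqr s_even) plane_rot_even_sqr.
rewrite (plane_rot_odd_sqr s_odd) (plane_rot_odd_sqr (s := - s)) ?opprK //.
by rewrite -scaleN1r; apply: ext_oddZ.
Qed.

Definition pair_span : {vspace ext R 4} := (<[xi]> + <[eta]>)%VS.

Lemma pair_spanP s : reflect (exists a b, s = a *: xi + b *: eta) (s \in pair_span).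
Proof.
apply: (iffP memv_addP) => [[u /vlineP[a ->]] [v /vlineP[b ->]] ->|[a [b ->]]].
  by exists a, b.
by exists (a *: xi); [exact: memvZ (memv_line _) | exists (b *: eta) => //; exact: memvZ (memv_line _)].
Qed.

Lemma pair_span_dim : \dim pair_span = 2%N.
Proof.
rewrite dimv_disjoint_sum ?dim_vline.
  have -> : xi != 0 by apply: contraNneq N_neq0 => ->; rewrite S_form0l.
  by have -> : eta != 0 by apply: contraNneq N_neq0 => eta0; rewrite -form_eta eta0 S_form0l.
apply/eqP; rewrite -subv0; apply/subvP => s; rewrite memv_cap memv0 => /andP[/vlineP[a sa] /vlineP[b sb]].
have : S_form X s xi = 0 by rewrite sb S_formZl S_formC form_xe mulr0.
by rewrite sa S_formZl => /eqP; rewrite mulf_eq0 (negPf N_neq0) orbF => /eqP->; rewrite scale0r.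
Qed.

Lemma plane_rot_eigen s : s \in pair_span <-> ext_even s /\ rho s = - s.
Proof.
have rxi : rho xi = - xi.
  by rewrite plane_rot_xi // expr0n expr1n sub0r mulr0 mul0r oppr0 scale0r addr0 scaleN1r.
have reta : rho eta = - eta.
  by rewrite plane_rot_eta // expr0n expr1n sub0r mulr0 mul0r scale0r add0r scaleN1r.
split=> [/pair_spanP[a [b ->]]|[s_even]].
  split; first by apply: ext_evenD; apply: ext_evenZ.
  by rewrite plane_rotD !plane_rotZ rxi reta !scalerN opprD.
rewrite plane_rotE even_part_id // odd_part_even // plane_j0 !scaler0 !addr0 => E.
apply/pair_spanP; exists (S_form X s xi / N), (S_form X s eta / N); apply/ffunP => I.
have /ffunP/(_ I) := E; rewrite !(ext_addE, ext_scaleE, ext_oppE) expr0n expr1n.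
rewrite !(mulr0, mul0r) addr0 subr0 sub0r.
move: (s I : R) (xi I : R) (eta I : R) (S_form X s xi / N) (S_form X s eta / N) => z p q x y.
rewrite (_ : -1 - 1 = - 2 :> R); last by ring.
move=> E1; apply: (mulfI (_ : 2 != 0 :> R)); first by rewrite pnatr_eq0.
have : z + - 2 * x * p + - 2 * y * q + z = 0 by rewrite E1 addNr.
move/eqP; rewrite (_ : _ + z = 2 * z - 2 * (x * p + y * q)); last by ring.
by rewrite subr_eq0 => /eqP.
Qed.

End RealPair.

Section PairHodge.
Variables (R : realType) (X : abelian_surface R) (n : nat).
Variables xi eta : ext R 4.
Hypothesis pair_orth : orthogonal_pair X xi eta.
Hypotheses (xi_neg : S_form X xi xi < 0) (xi_w : w_perp X n xi) (eta_w : w_perp X n eta).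
Local Notation J := (plane_J X xi eta).
Local Notation N := (S_form X xi xi).
Local Notation rho := (plane_rot X xi eta 0 1).

Let one01 : 0 ^+ 2 + 1 ^+ 2 = 1 :> R. Proof. by rewrite expr0n expr1n add0r. Qed.

Lemma w_perpD (s t : ext R 4) : w_perp X n s -> w_perp X n t -> w_perp X n (s + t).
Proof.
case=> s_even sw [t_even tw]; split; first exact: ext_evenD.
by rewrite S_formDl sw tw addr0.
Qed.

Lemma w_perpZ k (s : ext R 4) : w_perp X n s -> w_perp X n (k *: s).
Proof.
by case=> s_even sw; split; [exact: ext_evenZ | rewrite S_formZl sw mulr0].
Qed.

Lemma pair_span_w_perp s : s \in pair_span xi eta -> w_perp X n s.
Proof. by case/pair_spanP=> a [b ->]; apply: w_perpD; apply: w_perpZ. Qed.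

Lemma pair_span_neg s : s \in pair_span xi eta -> s != 0 -> S_form X s s < 0.
Proof.
case/pair_spanP=> a [b ->] s0; case: (pair_orth) => _ _ _ Ne xe.
rewrite !(S_formDl, S_formDr, S_formZl, S_formZr) Ne (S_formC X eta xi) xe.
rewrite !mulr0 add0r addr0; move: (N) xi_neg => q q_neg.
rewrite (_ : _ + _ = (a ^+ 2 + b ^+ 2) * q); last by ring.
rewrite pmulr_rlt0 //.
rewrite lt_neqAle eq_sym addr_ge0 ?sqr_ge0 // andbT paddr_eq0 ?sqr_ge0 // !sqrf_eq0.
by apply: contra s0 => /andP[/eqP-> /eqP->]; rewrite !scale0r addr0.
Qed.

Lemma pair_spin : exists x, [/\ Spin x, cl_induces x J & forall s, cl_act x s = rho s].
Proof.
apply: (spin_of_operator (X := X)) => [k s t|s|s|s t|v s].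
- exact: plane_rot_linear.
- exact: plane_rot_even_parity.
- exact: plane_rot_odd_parity.
- exact: plane_rot_isom.
- exact: plane_rot_J.
Qed.

Lemma pair_spinN : exists x, [/\ Spin x, cl_induces x J & forall s, cl_act x s = - rho s].
Proof.
apply: (spin_of_operator (X := X)) => [k s t|s sP|s sP|s t|v s].
- by rewrite scalerN -opprD; congr (- _); exact: plane_rot_linear.
- by rewrite -scaleN1r; apply: ext_evenZ; exact: plane_rot_even_parity.
- by rewrite -scaleN1r; apply: ext_oddZ; exact: plane_rot_odd_parity.
- by rewrite S_formNl S_formNr opprK; exact: plane_rot_isom.
- by rewrite V_actN; congr (- _); exact: plane_rot_J.
Qed.

Lemma pair_eigenspace x (k : R) : k ^+ 2 = 1 -> (forall s, cl_act x s = k *: rho s) ->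
  spinor_involution x /\ exists (l : R) (W : {vspace ext R 4}),
          [/\ is_eigenspace x l W, \dim W = 2%N, forall s, s \in W -> w_perp X n s &
              forall s, s \in W -> s != 0 -> S_form X s s < 0].
Proof.
move=> k2 xE; have k0 : k != 0 by apply/eqP => k0; move: k2; rewrite k0 expr0n => /eqP; rewrite eq_sym oner_eq0.
split=> [s s_even|].
  rewrite !xE; split; first by apply: ext_evenZ; apply: plane_rot_even_parity.
  by rewrite (plane_rotZ X xi eta 0 1 k (rho s)) plane_rot_even_sqr // scalerA -expr2 k2 scale1r.
(* On S^+, rho is -1 on the plane and 1 on its orthogonal complement, so the plane is the eigenspace
   of k rho for - k. *)
exists (- k), (pair_span xi eta); split.
- move=> s; rewrite xE; split=> [/(plane_rot_eigen pair_orth)[s_even ->]|[s_even E]].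
    by split=> //; rewrite scalerN scaleNr.
  apply/(plane_rot_eigen pair_orth); split=> //.
  by apply: (scalerI k0); rewrite E scaleNr scalerN.
- exact: (pair_span_dim pair_orth).
- exact: pair_span_w_perp.
- exact: pair_span_neg.
Qed.

Lemma pair_hodge_b : hodge_b X n J.
Proof.
have [x [x_spin xJ xE]] := pair_spin; have [x' [x'_spin x'J x'E]] := pair_spinN.
have x'x : x' = - x by apply: cl_act_inj => s; rewrite cl_actNl x'E xE.
have J2 := plane_J_sqr pair_orth.
have lifts y : Spin_lift J y <-> y = x \/ y = - x.
  split=> [[y_spin yJ]|[->|->]]; [|by split|by rewrite -x'x; split].
  apply: (spin_lift_unique (g := J) _ x_spin xJ) => // [|s].
    rewrite (_ : J ^+ 4 = (J *m J) *m (J *m J)); last exact: (exprM J 2 2).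
    by rewrite J2 mulmxN mulNmx opprK mulmx1.
  by rewrite !exprS expr0 mulr1 !cl_actM !xE plane_rot_four.
split.
- by split=> [u v|]; [exact: plane_J_orth | exact: complex_structure_det].
- exists x; split=> // xx; case: (pair_orth) => _ _ N0 _ _; case/eqP: N0.
  have : cl_act x xi = cl_act (- x) xi by rewrite -xx.
  rewrite cl_actNl xE plane_rot_xi // expr0n expr1n sub0r mulr0 mul0r oppr0 scale0r addr0.
  rewrite scaleN1r opprK => E; suff -> : xi = 0 by rewrite S_form0l.
  apply: (scalerI (_ : 2 != 0 :> R)); first by rewrite pnatr_eq0.
  by rewrite scaler0 scaler_nat mulr2n -{1}E addNr.
- move=> y /lifts[->|->]; first by apply: (pair_eigenspace (k := 1)) => [|s]; rewrite ?expr1n ?scale1r.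
  by apply: (pair_eigenspace (k := -1)) => [|s]; rewrite ?sqrrN ?expr1n // cl_actNl xE scaleN1r.
Qed.

End PairHodge.

Section PairHodgeType.
Variables (R : realType) (X : abelian_surface R) (n : nat) (e : 'M[int]_4).
Variables xi eta : ext R 4.
Hypothesis e_basis : oriented_basis X e.
Hypothesis pair_orth : orthogonal_pair X xi eta.
Hypotheses (xi_neg : S_form X xi xi < 0) (xi_w : w_perp X n xi) (eta_w : w_perp X n eta).
Local Notation C := R[i].
Local Notation J := (plane_J X xi eta).
Local Notation emb := (real_complex R).
Local Notation xiC := (ext_apply emb xi).
Local Notation etaC := (ext_apply emb eta).

Lemma ext_int_emb (s : ext int 4) : ext_apply emb (ext_int R s) = ext_int C s.
Proof. by apply/ffunP => I; rewrite ext_applyE !ffunE rmorph_int. Qed.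

Lemma map_J : map_mx emb J = plane_J X xiC etaC.
Proof. exact: map_plane_J. Qed.

Lemma pairC_orth : orthogonal_pair X xiC etaC.
Proof. exact: map_orthogonal_pair. Qed.

Lemma plane_J_isometry (K : numFieldType) (s t : ext K 4) (a b : K) :
  orthogonal_pair X s t -> a ^+ 2 + b ^+ 2 = 1 -> V_isometry (a%:M + b *: plane_J X s t).
Proof.
move=> st ab u v; rewrite !mulmxDr !mul_mx_scalar -!scalemxAr.
have skew x y : V_form (x *m plane_J X s t) y = - V_form x (y *m plane_J X s t).
  by rewrite -(plane_J_orth st x) -mulmxA plane_J_sqr // mulmxN mulmx1 V_formNr opprK.
rewrite !(V_formDl, V_formDr, V_formZl, V_formZr) skew plane_J_orth //.
move: (V_form u v) (V_form u (v *m _)) => p q.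
rewrite -[RHS]mul1r -ab; ring.
Qed.

Lemma pair_hodge_a : hodge_a J.
Proof.
have J2 : map_mx emb J *m map_mx emb J = - 1%:M by apply/JC2/plane_J_sqr.
have J_isom : V_isometry (map_mx emb J).
  by rewrite map_J => u v; apply/plane_J_orth/pairC_orth.
split; apply: eigenspace_maximal_isotropic => //; last rewrite sqrrN; exact: sqr_imag.
Qed.

Lemma w_even (K : comNzRingType) : ext_even (ext_int K (w_class X n)).
Proof.
rewrite ext_int_w => I I_odd; rewrite !(ext_addE, ext_oppE, ext_scaleE, ext_monoE).
have -> : (I == finset.set0) = false by apply: contraTF I_odd => /eqP->; rewrite cards0.
have -> : (I == [set: 'I_4]) = false by apply: contraTF I_odd => /eqP->; rewrite cardsT card_ord.
by rewrite mulr0 subr0.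
Qed.

Lemma pair_hodge_c : hodge_type J 2 2 (ext_int C (c_class e n)).
Proof.
have five : (5 != 0 :> C) by rewrite pnatr_eq0.
(* A rational point of the unit circle other than 1, -1, i and - i. *)
have ab : (3 / 5) ^+ 2 + (4 / 5) ^+ 2 = 1 :> C by field.
apply: (hodge_type_invariant _ (a := 3 / 5) (b := 4 / 5)).
- exact: plane_J_sqr.
- exact/ext_deg_int/(ext_deg_c_class n e_basis).
- have := sqr_imag R; move: 'i%C => z i2.
  transitivity ((3 / 5) ^+ 2 - (4 / 5) ^+ 2 * z ^+ 2); first by ring.
  by rewrite i2 mulrN1 opprK.
- apply/eqP => z4; have : 0 < 1152 ^+ 2 + 336 ^+ 2 :> C by rewrite addr_gt0 // exprn_gt0 // ltr0n.
  have i2 := sqr_imag R; move: 'i%C z4 i2 => z z4 i2.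
  (* As (3 + 4 i)^4 = -527 - 336 i, a fourth power equal to 1 would give 336 i = -1152; squaring
     contradicts the positivity of 1152^2 + 336^2. *)
  have : 625 * (3 / 5 + 4 / 5 * z) ^+ 4 = -527 - 336 * z.
    have -> : 625 * (3 / 5 + 4 / 5 * z) ^+ 4 = 81 + 432 * z + 864 * z ^+ 2 + 768 * z ^+ 2 * z + 256 * (z ^+ 2) ^+ 2.
      by field.
    by rewrite i2; ring.
  rewrite z4 mulr1 => E; have {}E : 336 * z = - 1152 by rewrite -[LHS]opprK -[- (336 * z)](addKr (-527)) -E; ring.
  by rewrite -[1152 ^+ 2]sqrrN -E exprMn i2 mulrN1 addNr ltxx.
rewrite map_J; apply: (c_class_isometry (X := X) e_basis (T := plane_rot X xiC etaC (3 / 5) (4 / 5))).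
- by apply: plane_J_isometry => //; apply: pairC_orth.
- by move=> v r; apply: plane_rot_act => //; apply: pairC_orth.
- by move=> r r'; apply: plane_rot_isom => //; apply: pairC_orth.
apply: plane_rot_perp; first exact: w_even.
- by rewrite S_formC -ext_int_emb S_form_apply; case: xi_w => _ ->; rewrite rmorph0.
- by rewrite S_formC -ext_int_emb S_form_apply; case: eta_w => _ ->; rewrite rmorph0.
Qed.

Lemma pair_hodge_structure : hodge_structures X n e J.
Proof.
split; [exact: plane_J_sqr | exact: pair_hodge_a | exact: pair_hodge_b | exact: pair_hodge_c].
Qed.
End PairHodgeType.

(** * Points of the period domain as negative pairs *)

Section ComplexPair.
Variables (R : realType).
Local Notation C := R[i].
Local Notation emb := (real_complex R).
Implicit Types (s : ext C 4) (xi eta : ext R 4).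

Definition complex_pair xi eta : ext C 4 := ext_apply emb xi + 'i%C *: ext_apply emb eta.
Definition ext_Re s : ext R 4 := ext_apply (fun z : C => complex.Re z) s.
Definition ext_Im s : ext R 4 := ext_apply (fun z : C => complex.Im z) s.

Lemma complex_pair_ReIm s : complex_pair (ext_Re s) (ext_Im s) = s.
Proof.
apply/ffunP => I; rewrite ext_addE ext_scaleE !ext_applyE !ffunE.
by rewrite [RHS]complexE.
Qed.

Lemma ext_Re_pair xi eta : ext_Re (complex_pair xi eta) = xi.
Proof.
apply/ffunP => I; rewrite ffunE ext_addE ext_scaleE !ext_applyE /=.
by rewrite !(mul0r, mulr0, subr0, addr0).
Qed.

Lemma ext_Im_pair xi eta : ext_Im (complex_pair xi eta) = eta.
Proof.
apply/ffunP => I; rewrite ffunE ext_addE ext_scaleE !ext_applyE /=.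
by rewrite !(mul0r, mul1r, add0r, addr0).
Qed.

Lemma ext_conj_pair xi eta :
  ext_conj (complex_pair xi eta) = ext_apply emb xi - 'i%C *: ext_apply emb eta.
Proof.
rewrite /complex_pair /ext_conj ext_applyD ext_applyZ -scaleNr; congr (_ + _ *: _).
- by apply/ffunP => I; rewrite !ext_applyE /= oppr0.
- by rewrite /=; simpc.
- by apply/ffunP => I; rewrite !ext_applyE /= oppr0.
Qed.

Lemma complex_eq0 (a b : R) : emb a + 'i%C * emb b = 0 -> a = 0 /\ b = 0.
Proof. by simpc => /eqP; rewrite eq_complex /= => /andP[/eqP-> /eqP->]. Qed.

Section Omega.
Variables (X : abelian_surface R) (n : nat).
Local Notation form := (S_form X).

(** The real and imaginary parts of a generator of a point of the period domain: isotropy of xi + i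
    eta means equal norms and orthogonality, and the sign condition then makes the common norm
    negative. *)
Definition negative_pair xi eta : Prop :=
  [/\ orthogonal_pair X xi eta, form xi xi < 0, w_perp X n xi & w_perp X n eta].

Lemma S_form_pair xi eta :
  form (complex_pair xi eta) (complex_pair xi eta) =
    emb (form xi xi - form eta eta) + 'i%C * emb (2 * form xi eta) /\
  form (complex_pair xi eta) (ext_conj (complex_pair xi eta)) = emb (form xi xi + form eta eta).
Proof.
rewrite ext_conj_pair /complex_pair.
rewrite !(S_formDl, S_formDr, S_formZl, S_formZr, S_formNr) !S_form_apply (S_formC X eta xi).
move: (form xi xi) (form xi eta) (form eta eta) => p q r.
rewrite rmorphM (rmorph_nat emb 2) rmorphB rmorphD.
have key1 (z a b c : C) : z ^+ 2 = -1 -> a + z * b + (z * b + z * (z * c)) = a - c + z * (2 * b).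
  move=> i2; transitivity (a + z * (2 * b) + z ^+ 2 * c); [ring | rewrite i2; ring].
have key2 (z a b c : C) : z ^+ 2 = -1 -> a - z * b + (z * b + z * - (z * c)) = a + c.
  move=> i2; transitivity (a - z ^+ 2 * c); [ring | rewrite i2; ring].
by split; [apply: key1 | apply: key2]; apply: sqr_imag.
Qed.

Lemma w_perp_pair xi eta :
  w_perp X n (complex_pair xi eta) <-> w_perp X n xi /\ w_perp X n eta.
Proof.
have formE : form (complex_pair xi eta) (ext_int C (w_class X n)) =
    emb (form xi (ext_int R (w_class X n))) + 'i%C * emb (form eta (ext_int R (w_class X n))).
  by rewrite -ext_int_emb S_formDl S_formZl !S_form_apply.
rewrite /w_perp formE; split=> [[s_even /complex_eq0[-> ->]]|[[xe ->] [ee ->]]].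
  split; split=> // I I_odd; have := s_even I I_odd; rewrite ext_addE ext_scaleE !ext_applyE;
    by case/complex_eq0.
split; last by rewrite !rmorph0 mulr0 addr0.
by move=> I I_odd; rewrite ext_addE ext_scaleE !ext_applyE xe // ee // !rmorph0 mulr0 addr0.
Qed.

Lemma pair_neq0 xi eta : negative_pair xi eta -> complex_pair xi eta != 0.
Proof.
case=> _ N0 _ _; apply: contraTneq N0 => s0; rewrite -(ext_Re_pair xi eta) s0.
have -> : ext_Re 0 = 0 by apply/ffunP => I; rewrite !ffunE.
by rewrite S_form0l ltxx.
Qed.

Lemma negative_pair_omega xi eta : negative_pair xi eta -> Omega X n <[complex_pair xi eta]>%VS.
Proof.
move=> np; have s_neq0 := pair_neq0 np; case: np => -[_ _ _ Ne xe] N0 xw ew.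
have [ss sc] := S_form_pair xi eta.
have /w_perp_pair[s_even s_w] := conj xw ew.
split.
- by rewrite dim_vline s_neq0.
- move=> s /vlineP[k ->]; split; first exact: ext_evenZ.
  by rewrite S_formZl s_w mulr0.
- by move=> s /vlineP[k ->]; rewrite S_formZl S_formZr ss Ne xe subrr mulr0 !rmorph0 mulr0 addr0 !mulr0.
move=> s /vlineP[k ->] ks0; have -> : ext_conj (k *: complex_pair xi eta) = k^* *: ext_conj (complex_pair xi eta).
  exact: ext_applyZ.
rewrite S_formZl S_formZr sc mulrA -normCK Ne.
have k0 : k != 0 by apply: contraNneq ks0 => ->; rewrite scale0r.
rewrite pmulr_rlt0 ?exprn_gt0 ?normr_gt0 //.
rewrite -[0](rmorph0 emb) ltcR -mulr2n pmulrn_llt0 //.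
Qed.

Lemma omega_negative_pair l s : Omega X n l -> s \in l -> s != 0 ->
  negative_pair (ext_Re s) (ext_Im s).
Proof.
case=> _ lw lss lsc sl s0; have := lw s sl; have := lss s sl; have := lsc s sl s0.
rewrite -(complex_pair_ReIm s); move: (ext_Re s) (ext_Im s) => xi eta.
rewrite ext_Re_pair ext_Im_pair.
have [-> ->] := S_form_pair xi eta; rewrite -[0 : C](rmorph0 emb) ltcR => N0.
rewrite rmorph0 => /complex_eq0[/eqP]; rewrite subr_eq0 => /eqP Ne /eqP.
rewrite mulf_eq0 pnatr_eq0 /= => /eqP xe /w_perp_pair[xw ew].
have {}N0 : form xi xi < 0 by move: N0; rewrite -Ne -mulr2n pmulrn_llt0 //.
split=> //; split=> //; [by case: xw | by case: ew | exact: ltr0_neq0].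
Qed.

Lemma omega_line l s : Omega X n l -> s \in l -> s != 0 -> l = <[s]>%VS.
Proof.
case=> l1 _ _ _ sl s0; apply/esym/eqP.
by rewrite eqEdim -memvE sl l1 dim_vline s0.
Qed.

Lemma omega_vpick l : Omega X n l -> vpick l != 0.
Proof. by case=> l1 _ _ _; rewrite vpick0 -dimv_eq0 l1. Qed.

End Omega.
End ComplexPair.

Section PeriodMap.
Variables (R : realType) (X : abelian_surface R) (n : nat).
Local Notation C := R[i].
Local Notation emb := (real_complex R).
Local Notation form := (S_form X).
Implicit Types (xi eta : ext R 4).

Lemma plane_J_unique (K : numFieldType) (xi eta : ext K 4) (A : 'M[K]_(4 + 4)) :
  orthogonal_pair X xi eta -> (forall v, V_act (v *m A) eta = - V_act v xi) ->
  A = plane_J X xi eta.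
Proof.
move=> pair A_eta; apply/row_matrixP => k; apply/eqP; rewrite -subr_eq0; apply/eqP.
apply: (V_act_inj (X := X) (s := eta)); first by case: pair => _ _ ? ->.
by rewrite V_actDl V_actNl !rowE A_eta plane_J_eta // subrr.
Qed.

Lemma plane_J_opp xi eta : orthogonal_pair X xi eta ->
  orthogonal_pair X xi (- eta) /\ plane_J X xi (- eta) = - plane_J X xi eta.
Proof.
move=> pair; have pair' : orthogonal_pair X xi (- eta).
  case: pair => xe ee N0 Ne xi_eta; split=> //.
  - by rewrite -scaleN1r; apply: ext_evenZ.
  - by rewrite S_formNl S_formNr opprK.
  - by rewrite S_formNr xi_eta oppr0.
split=> //; apply/esym/plane_J_unique => // v.
by rewrite mulmxN V_actNl V_actN opprK plane_J_eta.
Qed.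

(** For s = xi + i eta the relations between J, xi and eta say that (v J) s = - i (v s), a condition
    that passes to the complex multiples of s and determines J. *)
Lemma plane_J_scale xi eta (k : C) :
  let s := k *: complex_pair xi eta in
  orthogonal_pair X xi eta -> orthogonal_pair X (ext_Re s) (ext_Im s) ->
  plane_J X (ext_Re s) (ext_Im s) = plane_J X xi eta.
Proof.
move=> s pair pair'; apply/esym/plane_J_unique => // v.
have sE I : s I = k * (emb (xi I) + 'i%C * emb (eta I)) :> C.
  by rewrite ext_scaleE ext_addE ext_scaleE !ext_applyE.
have -> : ext_Re s = complex.Re k *: xi - complex.Im k *: eta.
  apply/ffunP => I; rewrite [LHS]ffunE sE ext_addE ext_oppE !ext_scaleE.
  by case: (k) (xi I : R) (eta I : R) => a b p q /=; simpc.
have -> : ext_Im s = complex.Im k *: xi + complex.Re k *: eta.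
  apply/ffunP => I; rewrite [LHS]ffunE sE ext_addE !ext_scaleE.
  by case: (k) (xi I : R) (eta I : R) => a b p q /=; simpc; rewrite addrC.
rewrite !(V_actD, V_actZ, V_actN) plane_J_eta // plane_J_xi //.
by rewrite opprB scalerN.
Qed.

(** On the period domain any other generator of the line gives the same matrix, by
    [plane_J_scale]. *)
Definition period_J (l : {vspace ext C 4}) : 'M[R]_(4 + 4) :=
  plane_J X (ext_Re (vpick l)) (ext_Im (vpick l)).

Lemma pair_V10 xi eta (v : 'rV[C]_(4 + 4)) : orthogonal_pair X xi eta ->
  (v <= V10 (plane_J X xi eta))%MS <-> V_act v (complex_pair xi eta) = 0.
Proof.
move=> pair; rewrite /V10 map_plane_J //.
by apply: eigen_act; [apply: map_orthogonal_pair | apply: sqr_imag].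
Qed.

Lemma pair_V01 xi eta (v : 'rV[C]_(4 + 4)) : orthogonal_pair X xi eta ->
  (v <= V01 (plane_J X xi eta))%MS <-> V_act v (ext_conj (complex_pair xi eta)) = 0.
Proof.
move=> pair; rewrite /V01 map_plane_J // ext_conj_pair -scaleNr.
by apply: eigen_act; [apply: map_orthogonal_pair | rewrite sqrrN; apply: sqr_imag].
Qed.

Lemma omega_pick_pair l : Omega X n l ->
  negative_pair X n (ext_Re (vpick l)) (ext_Im (vpick l)).
Proof. by move=> lO; apply: (omega_negative_pair lO (memv_pick l) (omega_vpick lO)). Qed.

Lemma period_J_eigenspaces l : Omega X n l ->
  (forall v, (v <= V10 (period_J l))%MS <-> Z_line l v) /\
  (forall v, (v <= V01 (period_J l))%MS <-> Z_conj_line l v).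
Proof.
move=> lO; have [pair _ _ _] := omega_pick_pair lO.
have lE := omega_line lO (memv_pick l) (omega_vpick lO).
split=> v.
  rewrite /period_J pair_V10 // complex_pair_ReIm.
  split=> [vs s|vl]; last exact/vl/memv_pick.
  by rewrite lE => /vlineP[k ->]; rewrite V_actZ vs scaler0.
rewrite /period_J pair_V01 // complex_pair_ReIm.
split=> [vs s|vl]; last exact/vl/memv_pick.
rewrite lE => /vlineP[k ->]; have -> : ext_conj (k *: vpick l) = k^* *: ext_conj (vpick l) by exact: ext_applyZ.
by rewrite V_actZ vs scaler0.
Qed.

Lemma pair_omega_period_J xi eta : negative_pair X n xi eta ->
  exists2 l, Omega X n l & period_J l = plane_J X xi eta.
Proof.
move=> np; have lO := negative_pair_omega np; exists <[complex_pair xi eta]>%VS => //.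
have [pair' _ _ _] := omega_pick_pair lO; have [pair _ _ _] := np.
rewrite /period_J; have /vlineP[k kE] := memv_pick <[complex_pair xi eta]>%VS.
by move: pair'; rewrite kE => pair'; apply: plane_J_scale.
Qed.

End PeriodMap.

Lemma span_conj (K : numFieldType) (x y : ext K 4) (a b c d z : K) : z ^+ 2 = -1 ->
  exists p q, (a *: x + b *: y) + z *: (c *: x + d *: y) = p *: (x + z *: y) + q *: (x - z *: y).
Proof.
move=> z2; exists (2^-1 * ((a + z * c) - z * (b + z * d))), (2^-1 * ((a + z * c) + z * (b + z * d))).
apply/ffunP => I; rewrite !(ext_addE, ext_oppE, ext_scaleE).
move: (x I : K) (y I : K) => p q.
have two_neq0 : 2 != 0 :> K by rewrite pnatr_eq0.
transitivity (a * p + z * c * p - z ^+ 2 * (b * q + z * d * q)); first by rewrite z2; ring.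
by field.
Qed.

(** * The complex structure determines the period *)

Section PeriodMapInjective.
Variables (R : realType) (X : abelian_surface R) (n : nat).
Local Notation C := R[i].
Local Notation emb := (real_complex R).
Local Notation form := (S_form X).
Implicit Types (xi eta : ext R 4).

Lemma plane_rot_determined xi eta xi' eta' (s : ext R 4) :
  negative_pair X n xi eta -> negative_pair X n xi' eta' ->
  plane_J X xi eta = plane_J X xi' eta' ->
  plane_rot X xi eta 0 1 s = plane_rot X xi' eta' 0 1 s.
Proof.
move=> [pair _ xw ew] [pair' _ xw' ew'] JJ'.
pose r := plane_rot X xi eta 0 1; pose r' := plane_rot X xi' eta' 0 1.
have r_lin k t u : r (k *: t + u) = k *: r t + r u by apply: plane_rot_linear.
have r'_lin k t u : r' (k *: t + u) = k *: r' t + r' u by apply: plane_rot_linear.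
have r_J v t : r (V_act v t) = V_act (v *m plane_J X xi eta) (r t) by apply: plane_rot_J.
have r'_J v t : r' (V_act v t) = V_act (v *m plane_J X xi eta) (r' t).
  by rewrite JJ'; apply: plane_rot_J.
have r4 t : r (r (r (r t))) = t by apply: plane_rot_four.
have w_fix a b : orthogonal_pair X a b -> w_perp X n a -> w_perp X n b ->
    plane_rot X a b 0 1 (ext_int R (w_class X n)) = ext_int R (w_class X n).
  move=> ab [_ aw] [_ bw]; apply: plane_rot_perp; first exact: w_even.
    by rewrite S_formC.
  by rewrite S_formC.
have rw := w_fix _ _ pair xw ew; have r'w := w_fix _ _ pair' xw' ew'.
rewrite -/r in rw; rewrite -/r' in r'w; rewrite -/(r s) -/(r' s).
move: r r' r_lin r'_lin r_J r'_J r4 rw r'w => r r' r_lin r'_lin r_J r'_J r4 rw r'w.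
have J2 := plane_J_sqr pair.
(* Both lifts of J differ by a scalar, which is 1 since they fix w. *)
have [k kE] : exists k, forall t, r' (r (r (r t))) = k *: t.
  apply: commuting_scalar => [k t u|v t]; first by rewrite !r_lin r'_lin.
  rewrite !r_J r'_J -(mulmxA v) J2 mulmxN mulmx1 -(mulmxA (- v)) J2 mulmxN mulmx1 opprK.
  by [].
have k1 : k = 1.
  have := kE (ext_int R (w_class X n)); rewrite !rw r'w => /ffunP/(_ finset.set0).
  rewrite ext_scaleE ext_int_w ext_addE ext_oppE ext_scaleE !ext_monoE eqxx.
  rewrite [finset.set0 == _](_ : _ = false) ?mulr0 ?subr0 ?mulr1 // -set4T -set4_0.
  by rewrite set4_inj.
by rewrite -[in RHS](r4 s) kE k1 scale1r.
Qed.

Lemma plane_J_inj xi eta xi' eta' :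
  negative_pair X n xi eta -> negative_pair X n xi' eta' ->
  plane_J X xi eta = plane_J X xi' eta' ->
  complex_pair xi' eta' \in <[complex_pair xi eta]>%VS.
Proof.
move=> np np' JJ'.
have span' t : t \in pair_span xi' eta' -> t \in pair_span xi eta.
  have [[pair _ _ _] [pair' _ _ _]] := (np, np').
  move/(plane_rot_eigen pair') => [t_even tE]; apply/(plane_rot_eigen pair); split=> //.
  by rewrite (plane_rot_determined t np np').
have [a [b xiE]] : exists a b, xi' = a *: xi + b *: eta.
  by apply/pair_spanP/span'/pair_spanP; exists 1, 0; rewrite scale1r scale0r addr0.
have [c [d etaE]] : exists c d, eta' = c *: xi + d *: eta.
  by apply/pair_spanP/span'/pair_spanP; exists 0, 1; rewrite scale1r scale0r add0r.
have [p [q E]] : exists p q, complex_pair xi' eta' = p *: complex_pair xi eta + q *: ext_conj (complex_pair xi eta).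
  rewrite ext_conj_pair /complex_pair xiE etaE !ext_applyD !ext_applyZ.
  by apply: span_conj; apply: sqr_imag.
have [[pair _ _ _] [pair' _ _ _]] := (np, np').
have J2 := JC2 (plane_J_sqr pair).
(* The projection to V^{1,0} of a nonzero real vector is nonzero, since half that vector is its real
   part. *)
have [u_10 _] := eigen_proj J2 (sqr_imag R) (map_mx emb (row (lshift 4 i0) 1%:M)).
move: u_10; set u := 2^-1 *: _; rewrite -/(V10 (plane_J X xi eta)) => u_10.
have u0 : u != 0.
  rewrite scaler_eq0 invr_eq0 pnatr_eq0 subr_eq0; apply/eqP => /rowP/(_ (lshift 4 i0)).
  rewrite -map_mxM !mxE eqxx => /(congr1 (fun z : C => complex.Re z)) /=.
  by rewrite mul0r mulr0 subrr => /eqP; rewrite oner_eq0.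
have us : V_act u (complex_pair xi eta) = 0 by apply/(pair_V10 _ pair).
have us' : V_act u (complex_pair xi' eta') = 0 by apply/(pair_V10 _ pair'); rewrite -JJ'.
(* The vector u kills both s and s' = p s + q conj(s). If q were nonzero, it would kill conj(s) and
   lie in V^{0,1} as well as in V^{1,0}. *)
have q0 : q = 0.
  apply/eqP; apply: contraNT u0 => q0.
  have : V_act u (ext_conj (complex_pair xi eta)) = 0.
    by move: us'; rewrite E V_actD !V_actZ us scaler0 add0r => /eqP; rewrite scaler_eq0 (negPf q0) => /eqP.
  move/(pair_V01 _ pair)/eigenspaceP => u_01; move/eigenspaceP: u_10; rewrite u_01.
  move/eqP; rewrite scaleNr eq_sym -addr_eq0 -mulr2n -scaler_nat scalerA scaler_eq0 mulf_eq0 pnatr_eq0 /=.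
  by have /negPf-> : 'i%C != 0 :> C by rewrite eq_complex /= oner_eq0 andbF.
by rewrite E q0 scale0r addr0; apply: memvZ (memv_line _).
Qed.

Lemma period_J_inj l l' : Omega X n l -> Omega X n l' ->
  period_J X l = period_J X l' -> l = l'.
Proof.
move=> lO lO' JJ'.
have := plane_J_inj (omega_pick_pair lO) (omega_pick_pair lO') JJ'.
rewrite !complex_pair_ReIm -(omega_line lO (memv_pick l) (omega_vpick lO)) => ll'.
by rewrite (omega_line lO ll' (omega_vpick lO')) -(omega_line lO' (memv_pick l') (omega_vpick lO')).
Qed.

End PeriodMapInjective.

(** * Recovering the pair from a Hodge structure *)

Section Commutant.
Variables (K : numFieldType) (m : nat) (g : 'M[K]_(m + m)) (h : ext K m -> ext K m).
Hypothesis m_gt2 : (2 < m)%N.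
Hypothesis hg : forall v s, ext_even s -> h (V_act v s) = V_act (v *m g) s.
Implicit Types (p v : 'rV[K]_(m + m)) (i j l : 'I_m).
Local Notation bi2 i j := (wedge (basis_vec K i) (wedge (basis_vec K j) ext_one)).
Local Notation ve i := (row_mx (basis_vec K i) 0 : 'rV[K]_(m + m)).
Local Notation vf i := (row_mx 0 (basis_vec K i) : 'rV[K]_(m + m)).

Let another i j : exists k : 'I_m, k != i /\ k != j.
Proof.
case: (pickP [pred k | (k != i) && (k != j)]) => [k /andP[ki kj]|none]; first by exists k.
have sub : [set: 'I_m] \subset [set i; j].
  apply/fintype.subsetP => k _; have := none k; rewrite !inE /= => /negbT.
  by rewrite negb_and !negbK.
have := subset_leq_card sub; rewrite cardsT card_ord cards2 => mle.
by have := leq_trans m_gt2 mle; case: (i != j).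
Qed.

Let act_one p l : V_act p ext_one [set l] = lsubmx p 0 l :> K.
Proof.
rewrite -{1}(hsubmxK p) V_act_row contraction_one addr0 wedgeE big_set1.
rewrite /ext_sign (_ : [set j in [set l] | _] = finset.set0); last first.
  by apply/finset.setP => j; rewrite !inE; case: eqP => // ->; rewrite ltnn.
by rewrite cards0 mul1r /ext_one ext_monoE setDv eqxx mulr1.
Qed.

Let sum_basis_r (a : 'rV[K]_m) i : \sum_j a 0 j * basis_vec K i 0 j = a 0 i.
Proof. by rewrite -[RHS]sum_basis; apply: eq_bigr => j _; rewrite mulrC. Qed.

Let act_two p i j l :
  V_act p (bi2 i j) [set l] = rsubmx p 0 i * (l == j)%:R - rsubmx p 0 j * (l == i)%:R :> K.
Proof.
have one (a : 'rV[K]_m) k : wedge a ext_one [set k] = a 0 k :> K.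
  by rewrite -V_act_l act_one row_mxKl.
rewrite -{1}(hsubmxK p) V_act_row ext_addE [X in X + _](_ : _ = 0 :> K) ?add0r; last first.
  by rewrite wedgeE big_set1 setDv wedgeE big_set0 !mulr0.
rewrite !contraction_wedge contraction_one wedge0r subr0 !sum_basis_r wedgeZr.
by rewrite ext_addE ext_oppE !ext_scaleE !one !basis_vecE.
Qed.

Let one_even : ext_even (ext_one : ext K m).
Proof.
by move=> I I_odd; rewrite /ext_one ext_monoE; case: eqP I_odd => // ->; rewrite cards0.
Qed.

Let two_even i j : ext_even (bi2 i j).
Proof.
move=> I I_odd; rewrite !wedge_basisE /ext_one ext_monoE; case: eqP; last by rewrite !mulr0.
have [iI|_ _] := boolP (i \in I); last by rewrite mul0r.
have [jI E|_ _] := boolP (j \in I :\ i); last by rewrite mul0r !mulr0.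
have := cardsD1 i I; have := cardsD1 j (I :\ i); rewrite iI jI E cards0 => -> cI.
by rewrite cI in I_odd.
Qed.

Let h0 : h 0 = 0.
Proof. by rewrite -(V_act0l ext_one) hg // mul0mx V_act0l. Qed.

Let lsub_f j k : lsubmx (vf j *m g) 0 k = 0.
Proof. by rewrite -act_one -hg // V_act_r contraction_one h0 ext_zeroE. Qed.

Let rsub_e i k : rsubmx (ve i *m g) 0 k = 0.
Proof.
have [j [ji jk]] := another i k.
have E0 i' j' l : i' = i \/ j' = i -> V_act (ve i *m g) (bi2 i' j') [set l] = 0 :> K.
  move=> ij; rewrite -hg // V_act_l (_ : wedge _ _ = 0) ?h0 ?ext_zeroE //.
  case: ij => ->; first by rewrite -/(wedge _ _); exact: wedge_self.
  by rewrite wedgeC wedge_self wedge0r oppr0.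
have [->|ki] := eqVneq k i.
  have := E0 i j j (or_introl erefl).
  by rewrite act_two eqxx (negPf ji) mulr1 mulr0 subr0.
have := E0 i k i (or_introl erefl).
by rewrite act_two eqxx eq_sym (negPf ki) mulr1 mulr0 sub0r => /eqP; rewrite oppr_eq0 => /eqP.
Qed.

Let lsub_e i j l : i != j ->
  lsubmx (ve i *m g) 0 l = rsubmx (vf j *m g) 0 j * (l == i)%:R - rsubmx (vf j *m g) 0 i * (l == j)%:R.
Proof.
move=> ij; rewrite -act_one -hg // V_act_l.
have -> : wedge (basis_vec K i) ext_one = V_act (vf j) (bi2 j i).
  rewrite V_act_r !contraction_wedge contraction_one wedge0r subr0 !sum_basis_r !basis_vecE eqxx.
  by rewrite (negPf ij) scale0r wedge0r subr0 scale1r.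
by rewrite hg // act_two.
Qed.

(** Any coincidence v s = v' s' with s and s' even forces (v g) s = (v' g) s'. The ones used are
    e_j^* 1 = 0, e_i (e_i /\ e_j) = 0 and e_i 1 = e_j^* (e_j /\ e_i) for i different from j. They
    remove the off-diagonal entries and link the diagonal ones; three indices are needed to choose
    one away from two given ones. *)
Lemma commutant_scalar : exists k, g = k%:M.
Proof.
have m_gt0 : (0 < m)%N by case: (m) m_gt2.
pose o := Ordinal m_gt0; pose al i := lsubmx (ve i *m g) 0 i; pose be j := rsubmx (vf j *m g) 0 j.
have al_be i j : i != j -> al i = be j.
  by move=> ij; rewrite /al (lsub_e _ ij) eqxx (negPf ij) mulr1 mulr0 subr0.
have al_o i : al i = al o.
  by have [j [ji jo]] := another i o; rewrite !(al_be _ j) // eq_sym.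
have be_o j : be j = al o by have [i [ij _]] := another j j; rewrite -(al_be i) ?al_o.
have ve_g i : ve i *m g = al o *: ve i.
  rewrite -[LHS]hsubmxK scale_row_mx scaler0; congr row_mx; apply/rowP => l; last by rewrite rsub_e mxE.
  have [j [ji jl]] := another i l; rewrite (lsub_e _ (_ : i != j)); last by rewrite eq_sym.
  by rewrite [RHS]mxE basis_vecE (eq_sym l j) (negPf jl) mulr0 subr0 -/(be j) be_o.
have vf_g j : vf j *m g = al o *: vf j.
  rewrite -[LHS]hsubmxK scale_row_mx scaler0; congr row_mx; apply/rowP => l; first by rewrite lsub_f mxE.
  rewrite [RHS]mxE basis_vecE; have [->|lj] := eqVneq l j; first by rewrite mulr1 -/(be j) be_o.
  have := lsub_e j lj; rewrite eqxx eq_sym (negPf lj) mulr0 mulr1 sub0r ve_g.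
  rewrite scale_row_mx row_mxKl mxE basis_vecE eq_sym (negPf lj) mulr0 => /eqP.
  by rewrite eq_sym oppr_eq0 => /eqP.
exists (al o); apply/row_matrixP => k; rewrite rowE [RHS]rowE mul_mx_scalar.
rewrite [delta_mx _ _](row_mx_basis) mulmx_suml scaler_sumr; apply: eq_bigr => i _.
by rewrite mulmxDl scalerDr -!scalemxAl ve_g vf_g !scalerA [al o * _]mulrC [al o * _]mulrC.
Qed.

End Commutant.

Section PeriodMapSurjective.
Variables (R : realType) (X : abelian_surface R) (n : nat).
Local Notation form := (S_form X).
Implicit Types (xi eta s t : ext R 4).

Lemma negative_plane_pair (W : {vspace ext R 4}) : \dim W = 2%N ->
  (forall s, s \in W -> w_perp X n s) -> (forall s, s \in W -> s != 0 -> form s s < 0) ->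
  exists xi eta, negative_pair X n xi eta /\ pair_span xi eta = W.
Proof.
move=> W2 Ww W_neg; set xi := vpick W.
have xiW : xi \in W by apply: memv_pick.
have xi0 : xi != 0 by rewrite vpick0 -dimv_eq0 W2.
have [t tW t_xi] : exists2 t, t \in W & t \notin <[xi]>%VS.
  by apply/subvPn; apply/negP => /dimvS; rewrite W2 dim_vline; case: (xi != 0).
have N0 := W_neg xi xiW xi0.
pose eta1 := t - (form t xi / form xi xi) *: xi.
have eta1W : eta1 \in W by rewrite memvB ?memvZ.
have eta10 : eta1 != 0.
  by apply: contraNneq t_xi => /eqP; rewrite subr_eq0 => /eqP->; apply/memvZ/memv_line.
have N1 := W_neg eta1 eta1W eta10.
have xi_eta1 : form xi eta1 = 0.
  by rewrite S_formC /eta1 S_formDl S_formNl S_formZl divfK ?subrr // ltr0_neq0.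
(* The scaling gives eta the norm of xi; the quotient is positive, as both norms are negative. *)
pose c := Num.sqrt (form xi xi / form eta1 eta1).
have c2 : c ^+ 2 = form xi xi / form eta1 eta1 by rewrite sqr_sqrtr // mulr_le0 ?invr_le0 ?ltW.
have etaW : c *: eta1 \in W by rewrite memvZ.
have pair : orthogonal_pair X xi (c *: eta1).
  split.
  - by case: (Ww xi xiW).
  - by case: (Ww _ etaW).
  - exact: ltr0_neq0.
  - by rewrite S_formZl S_formZr mulrA -expr2 c2 divfK // ltr0_neq0.
  - by rewrite S_formZr xi_eta1 mulr0.
exists xi, (c *: eta1); split; first by split=> //; apply: Ww.
apply/eqP; rewrite eqEdim (pair_span_dim pair) W2 leqnn andbT.
by apply/subvP => s /pair_spanP[a [b ->]]; rewrite memvD ?memvZ.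
Qed.

(** The plane is the whole eigenspace of the involution x for k in S^+, and x is an isometry, so x
    is - k on the orthogonal complement of the plane. Thus x agrees with - k rho on S^+. *)
Lemma lift_eigenvalue xi eta J x k : negative_pair X n xi eta -> Spin_lift J x ->
  spinor_involution x -> is_eigenspace x k (pair_span xi eta) ->
  k ^+ 2 = 1 /\ forall s, ext_even s -> cl_act x (plane_rot X xi eta 0 1 s) = - k *: s.
Proof.
move=> [pair N0 xw ew] [x_spin xJ] x_inv x_eig.
have one01 : 0 ^+ 2 + 1 ^+ 2 = 1 :> R by rewrite expr0n expr1n add0r.
have actZ c s : cl_act x (c *: s) = c *: cl_act x s.
  by rewrite -[c *: s]addr0 cl_act_linear cl_act0 addr0.
have actD s t : cl_act x (s + t) = cl_act x s + cl_act x t.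
  by rewrite -[s]scale1r cl_act_linear !scale1r.
have xi_span : xi \in pair_span xi eta.
  by apply/pair_spanP; exists 1, 0; rewrite scale1r scale0r addr0.
have eta_span : eta \in pair_span xi eta.
  by apply/pair_spanP; exists 0, 1; rewrite scale1r scale0r add0r.
have eig s : s \in pair_span xi eta -> cl_act x s = k *: s by case/x_eig.
have xi0 : xi != 0 by apply: contraTneq N0 => ->; rewrite S_form0l ltxx.
have k2 : k ^+ 2 = 1.
  have [xi_even _] := (x_eig xi).1 xi_span; have [_] := x_inv xi xi_even.
  rewrite !(eig xi) // actZ eig // scalerA -expr2 => /eqP.
  rewrite -subr_eq0 -{2}[xi]scale1r -scalerBl scaler_eq0 (negPf xi0) orbF subr_eq0.
  by move/eqP.
have kk : k * k = 1 by rewrite -expr2.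
have span_case s : s \in pair_span xi eta -> cl_act x (plane_rot X xi eta 0 1 s) = - k *: s.
  by move=> sW; have [_ ->] := (plane_rot_eigen pair s).1 sW; rewrite -scaleN1r actZ eig // scaleN1r scaleNr.
split=> // s s_even; rewrite -(even_part_id s_even).
elim/(plane_ind pair): {s_even} s => [c s t IHs IHt|||s s_even sxi seta|s s_odd].
- by rewrite even_part_linear plane_rot_linear actD actZ IHs IHt scalerDr !scalerA mulrC.
- by rewrite even_part_id; [exact: span_case | case: pair].
- by rewrite even_part_id; [exact: span_case | case: pair].
- rewrite even_part_id // plane_rot_perp //.
  have [xs_even xxs] := x_inv s s_even.
  (* This eigenvector lies in the span of xi and eta, but is orthogonal to it. *)
  have t_span : s + k *: cl_act x s \in pair_span xi eta.
    apply/x_eig; split; first by apply: ext_evenD => //; apply: ext_evenZ.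
    by rewrite actD actZ xxs scalerDr scalerA kk scale1r addrC.
  have perp r : r \in pair_span xi eta -> form s r = 0 -> form (s + k *: cl_act x s) r = 0.
    move=> rW sr; rewrite S_formDl S_formZl sr add0r.
    rewrite -[r]scale1r -kk -scalerA -(eig r rW) S_formZr.
    by rewrite Spin_isom // sr !mulr0.
  have t0 : s + k *: cl_act x s = 0.
    apply: contraTeq isT => t0; have := pair_span_neg pair N0 t_span t0.
    have /pair_spanP[a [b tE]] := t_span; rewrite {2}tE S_formDr !S_formZr.
    by rewrite !perp // !mulr0 addr0 ltxx.
  by rewrite -[LHS]scale1r -kk -scalerA; have /eqP := t0; rewrite addrC addr_eq0 => /eqP->; rewrite scalerN scaleNr.
- by rewrite even_part_odd // plane_rot0 cl_act0 scaler0.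
Qed.

Lemma hodge_b_pair J : complex_structure J -> hodge_b X n J ->
  exists xi eta, negative_pair X n xi eta /\ J = plane_J X xi eta.
Proof.
move=> J2 [_ [x [_ lifts]] J_inv]; have x_lift : Spin_lift J x by apply/lifts; left.
have [x_inv [k [W [x_eig W2 Ww W_neg]]]] := J_inv x x_lift.
have [xi [eta [np WE]]] := negative_plane_pair W2 Ww W_neg.
rewrite -WE in x_eig; have [k2 xrho] := lift_eigenvalue np x_lift x_inv x_eig.
have kk : k * k = 1 by rewrite -expr2.
have [pair N0 xw ew] := np; case: x_lift => x_spin xJ.
pose J' := plane_J X xi eta.
(* By [lift_eigenvalue] and k^2 = 1 this is the identity on S^+, while it carries the action of v to
   that of v J' J; [commutant_scalar] then makes J' J a scalar. *)
pose h s := - k *: cl_act x (plane_rot X xi eta 0 1 s).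
have hg v s : ext_even s -> h (V_act v s) = V_act (v *m (J' *m J)) s.
  move=> s_even; rewrite /h (plane_rot_J pair) (Spin_act _ _ x_spin xJ) xrho //.
  by rewrite V_actZ scalerA mulrNN kk scale1r mulmxA.
have [c JJ'] := commutant_scalar (isT : (2 < 4)%N) hg.
have J'2 := plane_J_sqr pair; rewrite -/J' in J'2.
have JE : J = (- c) *: J'.
  by rewrite -[J]mul1mx -[1%:M]opprK -J'2 mulNmx -mulmxA JJ' mul_mx_scalar scaleNr.
have c2 : c ^+ 2 = 1.
  move: J2; rewrite /complex_structure JE -scalemxAl -scalemxAr J'2 scalerA mulrNN -expr2.
  move=> /matrixP/(_ ord0 ord0); rewrite !mxE eqxx mulrN => /eqP; rewrite eqr_opp mulr1 => /eqP.
  by [].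
(* As J = - c J', the case c = 1 is that of - J', which belongs to the conjugate pair xi, - eta. *)
have /orP[/eqP c1|/eqP c1] : (c == 1) || (c == -1) by rewrite -sqrf_eq1 c2.
  exists xi, (- eta); have [pair' ->] := plane_J_opp pair; split; last by rewrite JE c1 scaleN1r.
  split=> //; rewrite -scaleN1r; exact: w_perpZ.
by exists xi, eta; rewrite JE c1 opprK scale1r.
Qed.

End PeriodMapSurjective.

Theorem proposition1p6 (R : realType) (X : abelian_surface R) (n : nat) (e : 'M[int]_4)
    (n_ge2 : (2 <= n)%N) (e_basis : oriented_basis X e) :
  (\dim <[ext_int rat (c_class e n)]> = 1%N /\
   forall c : ext rat (4 + 4),
     ext_deg 4 c /\ Spin_w_invariant X n c <-> c \in <[ext_int rat (c_class e n)]>%VS) /\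
  exists J_ : {vspace ext R[i] 4} -> 'M[R]_(4 + 4),
    (forall l, Omega X n l ->
       (forall v, (v <= V10 (J_ l))%MS <-> Z_line l v) /\
       (forall v, (v <= V01 (J_ l))%MS <-> Z_conj_line l v)) /\
    set_bij (Omega X n) (hodge_structures X n e) J_.
Proof.
split; first exact: part1 e_basis.
exists (period_J X); split=> [l lO|]; first exact: (period_J_eigenspaces lO).
split.
- move=> l lO; have [pair N0 xw ew] := omega_pick_pair lO.
  exact: pair_hodge_structure.
- move=> l l' /set_mem lO /set_mem lO'; exact: (period_J_inj lO lO').
- move=> J [J2 _ J_b _]; have [xi [eta [np ->]]] := hodge_b_pair J2 J_b.
  by have [l lO lJ] := pair_omega_period_J np; exists l.
Qed.
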